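(* Let $g:\mathbb{C}\to\mathbb{C}$ be an entire function with $g(0)\neq 0$, let $(\zeta_k)_k$ be an enumeration, in order of nondecreasing modulus, of the distinct zeros of $g$ (a finite, possibly empty, or countably infinite family), and let $\pi_n(x)=p_n(nx)$ be the rescaled Appell polynomials associated with $g$. Let $n\ge 0$ be an integer and $x\in\mathbb{C}\setminus\{0\}$. For each $k$ put $$\theta_k=\mathrm{Arg}(x\zeta_k)-i\log|x\zeta_k| ,\qquad F(\theta)=\frac{e^{n(e^{i\theta}-i\theta)}}{g(e^{i\theta}/x)} .$$ Assume that: (i) every $\theta_k$ lying on the steepest descent curve $C$ is a simple zero of $\theta\mapsto g(e^{i\theta}/x)$; (ii) $\int_{c_1(Y)}F\,d\theta+\int_{c_2(Y)}F\,d\theta\to 0$ as $Y\to-\infty$ through values of $Y$ for which no pole of $F$ lies on $c_1(Y)\cup c_2(Y)$; (iii) the series $\sum_k\Theta(\psi(\theta_k))\,\mathrm{Res}(F;\theta=\theta_k)$ converges (it may have infinitely many nonzero terms). Then $$\frac{\pi_n(x)}{n!}=\frac{x^n}{2\pi}\left(e^n\,\mathrm{PV}\int_{-\infty}^{\infty}\frac{\theta'(\tau)\,e^{-n\tau^2}}{g(e^{i\theta(\tau)}/x)}\,d\tau-2\pi i\sum_{k}\Theta\big(\psi(\theta_k)\big)\,\mathrm{Res}\left(\frac{e^{n(e^{i\theta}-i\theta)}}{g(e^{i\theta}/x)};\theta=\theta_k\right)\right).$$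
   Context: The Appell polynomials $p_n$, $n=0,1,2,\dots$, associated with an entire function $g$ with $g(0)\ne 0$ are defined by $\sum_{n\ge 0}p_n(x)\frac{z^n}{n!}=\frac{e^{zx}}{g(z)}$ (Taylor expansion in $z$ about $z=0$). The rescaled Appell polynomials are $\pi_n(x)=p_n(nx)$. $\mathrm{Arg}(z)\in(-\pi,\pi]$ denotes the principal argument. The points $\theta_k$ are exactly the zeros of $\theta\mapsto g(e^{i\theta}/x)$ in the strip $\mathrm{Re}(\theta)\in(-\pi,\pi]$. $\Theta(t)=1$ if $t>0$, $\Theta(0)=1/2$, $\Theta(t)=0$ if $t<0$. Steepest descent curve $C$: the set of points $\theta=X+iY$ with $X\in(-\pi,\pi)$ and $Y=\log\left(\frac{\sin X}{X}\right)$ if $X\ne 0$, $Y=0$ if $X=0$. It is parametrized by the smooth curve $\theta:\mathbb{R}\to\mathbb{C}$, where $\theta(0)=0$; for $\tau>0$, $\theta(\tau)$ is the unique solution of $e^{i\theta}-i\theta=1-\tau^2$ in the region $\{\theta\in\mathbb{C}:\mathrm{Re}(\theta)\in(0,\pi),\ \mathrm{Im}(\theta)<0\}$; and for $\tau<0$, $\theta(\tau)=-\overline{\theta(-\tau)}$. $\theta'(\tau)$ is its derivative. The function $\psi$ is defined for $\mathrm{Re}(w)\in(-\pi,\pi)$ by $\psi(w)=\mathrm{Im}(w)-\log\left(\frac{\sin \mathrm{Re}(w)}{\mathrm{Re}(w)}\right)$ if $\mathrm{Re}(w)\neq 0$ and $\psi(w)=\mathrm{Im}(w)$ if $\mathrm{Re}(w)=0$;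 thus $\psi(w)>0$ means that $w$ is above $C$ and $\psi(w)=0$ that $w\in C$. If $\mathrm{Re}(w)=\pi$, set $\psi(w)=+\infty$, so that $\Theta(\psi(w))=1$. For $Y<0$, let $X(Y)\in(0,\pi)$ be the unique number with $\frac{\sin X(Y)}{X(Y)}=e^{Y}$; then $c_1(Y)$ is the oriented segment from $-\pi+iY$ to $-X(Y)+iY$ and $c_2(Y)$ the oriented segment from $X(Y)+iY$ to $\pi+iY$. $\mathrm{Res}(F;\theta=\theta_k)$ is the residue of $F$, as a function of the complex variable $\theta$, at $\theta_k$. $\mathrm{PV}\int_{-\infty}^{\infty}$ is the limit as $T\to+\infty$ of $\int_{-T}^{T}$ (with $T$ avoiding values for which $T$ or $-T$ is a pole of the integrand), with Cauchy principal values taken at the simple poles on the real $\tau$-axis. *)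

(* Defs.v *)
From Stdlib Require Import Reals Factorial ClassicalEpsilon.
From Coquelicot Require Import Coquelicot.

Open Scope R_scope.

Definition Cexp (z : C) : C :=
  (exp (Re z) * cos (Im z), exp (Re z) * sin (Im z)).

(** Values in [(-PI, PI]]: [acos] ranges over [[0, PI]], and the lower
    half-plane is reflected.  [Arg 0] is a junk value. *)
Definition Arg (z : C) : R :=
  if Rle_dec 0 (Im z) then acos (Re z / Cmod z) else - acos (Re z / Cmod z).

Definition entire (g : C -> C) : Prop :=
  forall z : C, ex_derive (K := C_AbsRing) (V := C_NormedModule) g z.

Definition simple_zero (f : C -> C) (a : C) : Prop :=
  f a = RtoC 0 /\
  exists d : C,
    is_derive (K := C_AbsRing) (V := C_NormedModule) f a d /\ d <> RtoC 0.

(** For [f] meromorphic ([U] is [C]), or the restriction of such a function to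
    the real axis ([U] is [R]).  The value of [f] at [a] itself, which
    is a junk value of a quotient by zero, is irrelevant. *)
Definition is_pole {U : UniformSpace} (f : U -> C) (a : U) : Prop :=
  filterlim (fun u => Cmod (f u)) (locally' a) (Rbar_locally p_infty).

(** Near [a], [f] has the Laurent expansion
    [f w = \sum_j b_j (w - a) ^ (j - (m + 1))] with finite principal part;
    the coefficient of [(w - a)^(-1)] is [b_m]. *)
Definition is_residue (f : C -> C) (a c : C) : Prop :=
  exists (m : nat) (b : nat -> C) (r : R),
    0 < r /\
    (forall w : C, 0 < Cmod (w - a) < r ->
       is_pseries (K := C_AbsRing) (V := C_NormedModule)
         b (w - a)%C ((w - a) ^ (S m) * f w)%C) /\
    b m = c.

Definition Res (f : C -> C) (a : C) : C :=
  iota (T := C_CompleteNormedModule) (is_residue f a).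

Definition is_appell (g : C -> C) (p : nat -> C -> C) : Prop :=
  forall x : C, exists r : R, 0 < r /\
    forall z : C, Cmod z < r ->
      is_pseries (K := C_AbsRing) (V := C_NormedModule)
        (fun n => p n x / RtoC (INR (fact n)))%C z (Cexp (z * x) / g z)%C.

Definition rescaled (p : nat -> C -> C) (n : nat) (x : C) : C :=
  p n (RtoC (INR n) * x)%C.

(** The number of terms of a family is [N : option nat], with [None] for a
    countably infinite family; the indices of the family start at 0. *)
Definition valid_index (N : option nat) (k : nat) : bool :=
  match N with Some m => Nat.ltb k m | None => true end.

Definition enumerates_zeros (g : C -> C) (N : option nat) (zeta : nat -> C)
  : Prop :=
  (forall z : C, g z = RtoC 0 <->
     exists k : nat, valid_index N k = true /\ zeta k = z) /\
  (forall j k : nat, valid_index N j = true -> valid_index N k = true ->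
     zeta j = zeta k -> j = k) /\
  (forall j k : nat, (j <= k)%nat -> valid_index N k = true ->
     Cmod (zeta j) <= Cmod (zeta k)).

(** [Arg (x z) - i log |x z|]. *)
Definition theta_pt (x z : C) : C := (Arg (x * z), - ln (Cmod (x * z))).

Definition on_curve (w : C) : Prop :=
  - PI < Re w < PI /\
  Im w = if Req_EM_T (Re w) 0 then 0 else ln (sin (Re w) / Re w).

(** Meaningful for [Re w] in [(-PI, PI]] only. *)
Definition psi (w : C) : Rbar :=
  if Req_EM_T (Re w) PI then p_infty
  else if Req_EM_T (Re w) 0 then Finite (Im w)
  else Finite (Im w - ln (sin (Re w) / Re w)).

Definition Theta (t : Rbar) : R :=
  match t with
  | Finite r => if Rlt_dec 0 r then 1 else if Rlt_dec r 0 then 0 else 1 / 2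
  | p_infty => 1
  | m_infty => 0
  end.

Definition curve_pos (tau : R) : C :=
  iota (T := C_CompleteNormedModule) (fun w : C =>
    0 < Re w < PI /\ Im w < 0 /\
    (Cexp (Ci * w) - Ci * w)%C = RtoC (1 - tau ^ 2)).

Definition curve (tau : R) : C :=
  if Rlt_dec 0 tau then curve_pos tau
  else if Rlt_dec tau 0 then (- Cconj (curve_pos (- tau)))%C
  else RtoC 0.

Definition curve' (tau : R) : C :=
  (Derive (fun t => Re (curve t)) tau, Derive (fun t => Im (curve t)) tau).

Definition X_at (Y : R) : R :=
  iota (T := R_CompleteNormedModule)
    (fun X : R => 0 < X < PI /\ sin X / X = exp Y).

Definition on_c1 (Y : R) (w : C) : Prop :=
  Im w = Y /\ - PI <= Re w <= - X_at Y.

Definition on_c2 (Y : R) (w : C) : Prop :=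
  Im w = Y /\ X_at Y <= Re w <= PI.

Definition int_c1 (f : C -> C) (Y : R) : C :=
  RInt (V := C_R_CompleteNormedModule)
    (fun t => f (t, Y)) (- PI) (- X_at Y).

Definition int_c2 (f : C -> C) (Y : R) : C :=
  RInt (V := C_R_CompleteNormedModule)
    (fun t => f (t, Y)) (X_at Y) PI.

Definition segments_vanish (f : C -> C) : Prop :=
  filterlim (fun Y => (int_c1 f Y + int_c2 f Y)%C)
    (within (fun Y => forall w : C, on_c1 Y w \/ on_c2 Y w ->
                        ~ is_pole (U := C_UniformSpace) f w)
            (Rbar_locally m_infty))
    (locally (T := C_UniformSpace) (RtoC 0)).

(** [h] with the symmetric open [eps]-neighbourhoods of its poles removed. *)
Definition excise (h : R -> C) (eps t : R) : C :=
  if excluded_middle_informative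
       (exists q : R, is_pole (U := R_UniformSpace) h q /\ Rabs (t - q) < eps)
  then RtoC 0 else h t.

Definition is_PV (h : R -> C) (a b : R) (l : C) : Prop :=
  filterlimi
    (fun eps => is_RInt (V := C_R_NormedModule) (excise h eps) a b)
    (at_right 0) (locally (T := C_UniformSpace) l).

(** [filterlimi] also asserts that the inner principal value exists for every
    large [T] such that neither [T] nor [- T] is a pole. *)
Definition is_PV_line (h : R -> C) (l : C) : Prop :=
  filterlimi (fun T => is_PV h (- T) T)
    (within (fun T => ~ is_pole (U := R_UniformSpace) h T /\
                      ~ is_pole (U := R_UniformSpace) h (- T))
            (Rbar_locally p_infty))
    (locally (T := C_UniformSpace) l).

Definition g_theta (g : C -> C) (x theta : C) : C :=
  g (Cexp (Ci * theta) / x)%C.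

Definition F_theta (g : C -> C) (n : nat) (x theta : C) : C :=
  (Cexp (RtoC (INR n) * (Cexp (Ci * theta) - Ci * theta))
   / g_theta g x theta)%C.

Definition curve_integrand (g : C -> C) (n : nat) (x : C) (tau : R) : C :=
  (curve' tau * RtoC (exp (- INR n * tau ^ 2)) / g_theta g x (curve tau))%C.

Definition residue_term (g : C -> C) (n : nat) (x : C)
  (N : option nat) (zeta : nat -> C) (k : nat) : C :=
  if valid_index N k
  then (RtoC (Theta (psi (theta_pt x (zeta k)))) *
        Res (F_theta g n x) (theta_pt x (zeta k)))%C
  else RtoC 0.

(* Main.v *)
(** With [z = e^(i theta) / x], the form [F d theta] is [x^(-n) / i] times
    [e^(n x z) / (g z z^(n+1)) dz], whose residue at [z = 0] is
    [p_n (n x) / n!].  On a large square, partial fractions write this form as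
    [dP + c_0 dz / z + sum_a c_a dz / (z - a)], over the zeros [a] of [g], with
    [P] regular off the multiple poles, and [x^(-n) c_a / i] is the residue of
    [F] at [theta_a].  In the variable [theta], every [dz / (z - a)] has a
    primitive of the form
    [w (i (theta - theta_a) + Log (1 - a / z)) + (1 - w) Log (1 - z / a)].
    For [w = 1], [0], [1/2] it is regular along a graph passing respectively
    below [theta_a], above it, and through it, up to a symmetric logarithmic
    singularity that cancels in principal value.  Integrating over the curve cut
    at the parameters [- T] and [T] and closed by the segments [c_1], [c_2], only
    the increments over one period remain: [2 pi i c_0] and [2 pi i w c_a], with
    [w = Theta (psi theta_a)] for the poles above the cutting level and [w = 0]
    for the others.  When a pole lies at the cutting level, the formula is
    obtained by letting the level tend to it from below. *)
Require Import Defs.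
From Stdlib Require Import Reals Factorial ClassicalEpsilon.
From Stdlib Require Import Lra Lia List Permutation.
From Coquelicot Require Import Coquelicot.

Open Scope R_scope.

(** * Limits, derivatives and integrals of complex functions *)

(** Poles may lie on the contour, accumulate at infinity, or sit exactly at a cutting level, so a
    residue theorem applied configuration by configuration would split into many cases. With an
    explicit primitive every integral becomes a difference of end values, and the position of a pole
    relative to the curve only decides where a logarithmic cut is placed. Hypothesis (i) keeps the
    non-logarithmic part [P] continuous at a pole on the curve: a multiple pole would leave a power
    whose symmetric jump need not vanish. The principal value over the line only avoids [T] with a
    pole of the integrand at [T] or [- T], whereas (ii) speaks of levels at which both whole
    segments are free of poles; this mismatch is why the level is approached from below. The residue
    series may converge only conditionally, so the finite set of poles above a level must be an
    initial segment of the enumeration. It is one, because the height of a pole is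
    [- ln |x zeta_k|]: nondecreasing modulus means nonincreasing height. *)

Ltac note_rmin a b :=
  lazymatch goal with
  | _ : Rmin a b <= a |- _ => fail
  | _ => pose proof (Rmin_l a b); pose proof (Rmin_r a b)
  end.
Ltac rmin :=
  repeat match goal with
  | H : context [Rmin ?a ?b] |- _ => note_rmin a b
  | |- context [Rmin ?a ?b] => note_rmin a b
  end; lra.

Notation nearC z := (locally (T := C_UniformSpace) z).
Notation nearR t := (locally (T := R_UniformSpace) t).

(** The uniform structure of [C] is that of the product, with squares as balls; passing from squares
    to discs costs the factor [sqrt 2]. *)
Lemma nearC_iff (z : C) (P : C -> Prop) :
  nearC z P <-> exists del, 0 < del /\ forall w, Cmod (w - z) < del -> P w.
Proof.
split.
- intros [e He]. exists e. split. apply cond_pos.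
  intros w Hw. apply He. apply C_NormedModule_mixin_compat1. exact Hw.
- intros [d [Hd H]].
  assert (H2 : 0 < sqrt 2) by (apply sqrt_lt_R0; lra).
  assert (Hp : 0 < d / sqrt 2) by (apply Rdiv_lt_0_compat; lra).
  exists (mkposreal _ Hp). intros y Hy. apply H.
  generalize (C_NormedModule_mixin_compat2 z y (mkposreal _ Hp) Hy).
  simpl. replace (sqrt 2 * (d / sqrt 2)) with d by (field; lra).
  intros K; exact K.
Qed.

Lemma nearR_iff (t : R) (P : R -> Prop) :
  nearR t P <-> exists del, 0 < del /\ forall s, Rabs (s - t) < del -> P s.
Proof.
split.
- intros [e He]. exists e. split; [apply cond_pos|]. intros s Hs. now apply He.
- intros [d [Hd H]]. exists (mkposreal d Hd). intros y Hy. now apply H.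
Qed.

Lemma filter_imp2 {T} (F : (T -> Prop) -> Prop) {FF : Filter F} (P Q S : T -> Prop) :
  (forall w, P w -> Q w -> S w) -> F P -> F Q -> F S.
Proof.
intros H HP HQ. generalize (filter_and P Q HP HQ). apply filter_imp.
intros w [H1 H2]; auto.
Qed.

Lemma RtoC_ne r : r <> 0 -> RtoC r <> RtoC 0.
Proof. intros H E. apply H. now apply RtoC_inj. Qed.

Lemma Ci_sqr : (Ci * Ci)%C = (- (1))%C.
Proof. apply injective_projections; simpl; ring. Qed.

Lemma Cminus_eq_0 (a b : C) : (a - b)%C = RtoC 0 -> a = b.
Proof. intros H. replace a with ((a - b) + b)%C by ring. rewrite H. ring. Qed.

(** Limits measured by [Cmod] along an arbitrary filter: one set of rules then serves at a complex
    point, at a real point and at [at_right 0]. *)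
Definition clim {T : Type} (F : (T -> Prop) -> Prop) (f : T -> C) (c : C) : Prop :=
  forall eps, 0 < eps -> F (fun w => Cmod (f w - c) < eps).

Lemma clim_filterlim {T} F {FF : Filter F} (f : T -> C) c :
  clim F f c <-> filterlim f F (nearC c).
Proof.
split.
- intros H P HP. apply nearC_iff in HP. destruct HP as [d [Hd HP]].
  unfold filtermap. generalize (H d Hd). apply filter_imp. intros w. apply HP.
- intros H e He. apply (H (fun y => Cmod (y - c) < e)). apply nearC_iff.
  exists e. split; auto.
Qed.

Lemma clim_const {T} F {FF : Filter F} (c : C) : clim (T := T) F (fun _ => c) c.
Proof.
intros e He. apply filter_forall. intros _.
replace (c - c)%C with (RtoC 0) by ring. now rewrite Cmod_0.
Qed.

Lemma clim_ext_near {T} F {FF : Filter F} (f g : T -> C) c :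
  F (fun w => f w = g w) -> clim F f c -> clim F g c.
Proof.
intros H K e He. generalize (K e He). generalize H. apply filter_imp2; [typeclasses eauto|].
intros w -> L; exact L.
Qed.

Lemma clim_ext {T} F {FF : Filter F} (f g : T -> C) c :
  (forall w, f w = g w) -> clim F f c -> clim F g c.
Proof. intros H. apply clim_ext_near; auto. now apply filter_forall. Qed.

Lemma clim_eq {T} F (f : T -> C) a b : clim F f a -> a = b -> clim F f b.
Proof. now intros H <-. Qed.

Lemma clim_plus {T} F {FF : Filter F} (f g : T -> C) a b :
  clim F f a -> clim F g b -> clim F (fun w => f w + g w)%C (a + b)%C.
Proof.
intros Hf Hg e He.
generalize (Hg (e / 2) ltac:(lra)). generalize (Hf (e / 2) ltac:(lra)).
apply filter_imp2; [typeclasses eauto|].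
intros w H1 H2. replace (f w + g w - (a + b))%C with ((f w - a) + (g w - b))%C by ring.
eapply Rle_lt_trans. apply Cmod_triangle. lra.
Qed.

Lemma clim_mult {T} F {FF : Filter F} (f g : T -> C) a b :
  clim F f a -> clim F g b -> clim F (fun w => f w * g w)%C (a * b)%C.
Proof.
intros Hf Hg e He.
set (K := Cmod a + Cmod b + 1).
assert (Ka := Cmod_ge_0 a). assert (Kb := Cmod_ge_0 b).
assert (HK : 0 < K) by (unfold K; lra).
set (d := Rmin 1 (e / K)).
assert (Hd : 0 < d).
{ unfold d. apply Rmin_case. lra. apply Rdiv_lt_0_compat; lra. }
generalize (Hg d Hd). generalize (Hf d Hd).
apply filter_imp2; [typeclasses eauto|].
intros w H1 H2.
replace (f w * g w - a * b)%C with
  ((f w - a) * (g w - b) + ((f w - a) * b + a * (g w - b)))%C by ring.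
assert (d <= 1) by apply Rmin_l.
assert (d * K <= e).
{ assert (d <= e / K) by apply Rmin_r.
  apply (Rmult_le_compat_r K) in H0; [|lra].
  replace (e / K * K) with e in H0 by (field; lra). exact H0. }
eapply Rle_lt_trans. apply Cmod_triangle.
assert (T1 := Cmod_triangle ((f w - a) * b) (a * (g w - b))).
rewrite !Cmod_mult in *.
set (u := Cmod (f w - a)) in *. set (v := Cmod (g w - b)) in *.
assert (0 <= u) by apply Cmod_ge_0.
unfold K in *. nra.
Qed.

Lemma clim_opp {T} F {FF : Filter F} (f : T -> C) a :
  clim F f a -> clim F (fun w => - f w)%C (- a)%C.
Proof.
intros H e He. generalize (H e He). apply filter_imp. intros w Hw.
replace (- f w - - a)%C with (- (f w - a))%C by ring. now rewrite Cmod_opp.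
Qed.

Lemma clim_minus {T} F {FF : Filter F} (f g : T -> C) a b :
  clim F f a -> clim F g b -> clim F (fun w => f w - g w)%C (a - b)%C.
Proof. intros H1 H2. apply clim_plus; auto. now apply clim_opp. Qed.

Lemma clim_inv {T} F {FF : Filter F} (f : T -> C) a : a <> RtoC 0 ->
  clim F f a -> clim F (fun w => / f w)%C (/ a)%C.
Proof.
intros Ha Hf e He.
assert (Ka := proj1 (Cmod_gt_0 a) Ha).
set (d := Rmin (Cmod a / 2) (e * (Cmod a * Cmod a / 2))).
assert (Hd : 0 < d).
{ assert (0 < Cmod a * Cmod a) by now apply Rmult_lt_0_compat.
  unfold d. apply Rmin_case. lra. apply Rmult_lt_0_compat; lra. }
generalize (Hf d Hd). apply filter_imp. intros w Hw.
assert (d <= Cmod a / 2) by apply Rmin_l.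
assert (d <= e * (Cmod a * Cmod a / 2)) by apply Rmin_r.
assert (T1 := Cmod_triangle (a - f w) (f w)).
replace (a - f w + f w)%C with a in T1 by ring.
replace (a - f w)%C with (- (f w - a))%C in T1 by ring. rewrite Cmod_opp in T1.
assert (f w <> RtoC 0) by (apply Cmod_gt_0; lra).
replace (/ f w - / a)%C with (- (f w - a) / (f w * a))%C by (field; auto).
rewrite Cmod_div by (apply Cmult_neq_0; auto).
rewrite Cmod_opp, Cmod_mult.
apply (Rmult_lt_reg_r (Cmod (f w) * Cmod a)). nra.
unfold Rdiv. rewrite Rmult_assoc, Rinv_l by nra. rewrite Rmult_1_r.
eapply Rlt_le_trans. apply Hw. eapply Rle_trans. apply H0.
apply Rmult_le_compat_l; nra.
Qed.

Lemma clim_div {T} F {FF : Filter F} (f g : T -> C) a b : b <> RtoC 0 ->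
  clim F f a -> clim F g b -> clim F (fun w => f w / g w)%C (a / b)%C.
Proof. intros H1 H2 H3. apply clim_mult; auto. now apply clim_inv. Qed.

Lemma clim_unique {T} F {FF : ProperFilter F} (f : T -> C) a b :
  clim F f a -> clim F f b -> a = b.
Proof.
intros Ha Hb. destruct (Ceq_dec a b) as [E|E]; auto. exfalso.
assert (E' : (a - b)%C <> RtoC 0) by (intros Z; apply E, Cminus_eq_0; auto).
apply Cmod_gt_0 in E'.
assert (K : F (fun w => False)).
{ generalize (Hb (Cmod (a - b) / 2) ltac:(lra)).
  generalize (Ha (Cmod (a - b) / 2) ltac:(lra)). apply filter_imp2; [typeclasses eauto|].
  intros w H1 H2. assert (T1 := Cmod_triangle (a - f w) (f w - b)).
  replace (a - f w + (f w - b))%C with (a - b)%C in T1 by ring.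
  replace (a - f w)%C with (- (f w - a))%C in T1 by ring. rewrite Cmod_opp in T1.
  lra. }
apply filter_ex in K. now destruct K.
Qed.

(** This carries the final estimate from pole-free cutting levels to a level that may hold a
    pole. *)
Lemma clim_bound {T} F {FF : ProperFilter F} (f : T -> C) a M :
  clim F f a -> F (fun w => Cmod (f w) <= M) -> Cmod a <= M.
Proof.
intros Ha HM. apply Rnot_lt_le. intros L.
assert (K : F (fun w => False)).
{ generalize HM. generalize (Ha (Cmod a - M) ltac:(lra)). apply filter_imp2; [typeclasses eauto|].
  intros w H1 H2. assert (T1 := Cmod_triangle (a - f w) (f w)).
  replace (a - f w + f w)%C with a in T1 by ring.
  replace (a - f w)%C with (- (f w - a))%C in T1 by ring. rewrite Cmod_opp in T1.
  lra. }
apply filter_ex in K. now destruct K.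
Qed.

(** * Continuity and differentiability in a complex or a real variable *)

Definition ccont (f : C -> C) (z : C) : Prop := clim (nearC z) f (f z).
Definition rcont (f : R -> C) (t : R) : Prop := clim (nearR t) f (f t).

Lemma clim_comp {T} F {FF : Filter F} (f : T -> C) (g : C -> C) a :
  clim F f a -> ccont g a -> clim F (fun w => g (f w)) (g a).
Proof.
intros Hf Hg e He. apply (proj1 (clim_filterlim F f a)) in Hf.
apply (Hf (fun y => Cmod (g y - g a) < e)). now apply Hg.
Qed.

Lemma rcont_continuous f t :
  rcont f t <-> continuous (U := C_UniformSpace) (T := R_UniformSpace) f t.
Proof. apply clim_filterlim. typeclasses eauto. Qed.

Lemma clim_near {T} F {FF : Filter F} (f : T -> C) c P :
  clim F f c -> nearC c P -> F (fun w => P (f w)).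
Proof. intros H HP. apply (proj1 (clim_filterlim F f c)) in H. now apply H. Qed.

Lemma ccont_const c z : ccont (fun _ => c) z.
Proof. apply clim_const. typeclasses eauto. Qed.
Lemma ccont_id z : ccont (fun w => w) z.
Proof. intros e He. apply nearC_iff. exists e. split; auto. Qed.
Lemma rcont_const c z : rcont (fun _ => c) z.
Proof. apply clim_const. typeclasses eauto. Qed.

(** Caratheodory's form of differentiability. *)
Definition cderiv (f : C -> C) (z l : C) : Prop :=
  exists q : C -> C, (forall w, f w = (f z + q w * (w - z))%C) /\
    ccont q z /\ q z = l.

Definition rderiv (f : R -> C) (t : R) (l : C) : Prop :=
  exists q : R -> C, (forall s, f s = (f t + q s * RtoC (s - t))%C) /\
    rcont q t /\ q t = l.

Lemma cderiv_eps f z l : cderiv f z l <->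
  forall eps, 0 < eps ->
    nearC z (fun w => Cmod (f w - f z - l * (w - z)) <= eps * Cmod (w - z)).
Proof.
split.
- intros [q [Hq [Hc <-]]] e He. generalize (Hc e He). apply filter_imp.
  intros w Hw. rewrite (Hq w).
  replace (f z + q w * (w - z) - f z - q z * (w - z))%C
    with ((q w - q z) * (w - z))%C by ring.
  rewrite Cmod_mult. apply Rmult_le_compat_r. apply Cmod_ge_0. lra.
- intros H.
  exists (fun w => if Ceq_dec w z then l else ((f w - f z) / (w - z))%C).
  split; [|split].
  + intros w. destruct (Ceq_dec w z) as [->|E]. ring. field.
    intros Z; apply E, Cminus_eq_0; auto.
  + intros e He. generalize (H (e / 2) ltac:(lra)). apply filter_imp.
    intros w Hw. destruct (Ceq_dec z z) as [_|E]; [|congruence].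
    destruct (Ceq_dec w z) as [->|E].
    replace (l - l)%C with (RtoC 0) by ring. now rewrite Cmod_0.
    assert (E' : (w - z)%C <> RtoC 0) by (intros Z; apply E, Cminus_eq_0; auto).
    replace ((f w - f z) / (w - z) - l)%C with
      ((f w - f z - l * (w - z)) / (w - z))%C by (field; auto).
    rewrite Cmod_div by auto. apply Cmod_gt_0 in E'.
    apply (Rmult_lt_reg_r (Cmod (w - z))); auto.
    unfold Rdiv. rewrite Rmult_assoc, Rinv_l by lra. nra.
  + destruct (Ceq_dec z z); congruence.
Qed.

Lemma rderiv_eps f t l : rderiv f t l <->
  forall eps, 0 < eps ->
    nearR t (fun s => Cmod (f s - f t - l * RtoC (s - t)) <= eps * Rabs (s - t)).
Proof.
split.
- intros [q [Hq [Hc <-]]] e He. generalize (Hc e He). apply filter_imp.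
  intros w Hw. rewrite (Hq w).
  replace (f t + q w * RtoC (w - t) - f t - q t * RtoC (w - t))%C
    with ((q w - q t) * RtoC (w - t))%C by ring.
  rewrite Cmod_mult, Cmod_R. apply Rmult_le_compat_r. apply Rabs_pos. lra.
- intros H.
  exists (fun w => if Req_EM_T w t then l else ((f w - f t) / RtoC (w - t))%C).
  split; [|split].
  + intros w. destruct (Req_EM_T w t) as [->|E].
    replace (t - t) with 0 by ring. ring. field.
    intros Z. apply RtoC_inj in Z. lra.
  + intros e He. generalize (H (e / 2) ltac:(lra)). apply filter_imp.
    intros w Hw. destruct (Req_EM_T t t) as [_|E]; [|congruence].
    destruct (Req_EM_T w t) as [->|E].
    replace (l - l)%C with (RtoC 0) by ring. now rewrite Cmod_0.
    assert (E' : RtoC (w - t) <> RtoC 0) by (apply RtoC_ne; lra).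
    replace ((f w - f t) / RtoC (w - t) - l)%C with
      ((f w - f t - l * RtoC (w - t)) / RtoC (w - t))%C by (field; auto).
    rewrite Cmod_div by auto. apply Cmod_gt_0 in E'.
    apply (Rmult_lt_reg_r (Cmod (RtoC (w - t)))); auto.
    unfold Rdiv. rewrite Rmult_assoc, Rinv_l by lra.
    rewrite Cmod_R in *. nra.
  + destruct (Req_EM_T t t); congruence.
Qed.

(** Derivatives over [C_AbsRing] use the neighbourhoods given by the absolute value, continuity uses
    those of the product; the two filters agree. *)
Lemma nearA_iff (z : C) (P : C -> Prop) :
  locally (T := AbsRing_UniformSpace C_AbsRing) z P <-> nearC z P.
Proof.
rewrite nearC_iff. split.
- intros [e He]. exists e. split; [apply cond_pos|]. intros w Hw. now apply He.
- intros [d [Hd H]]. exists (mkposreal d Hd). intros w Hw. now apply H.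
Qed.

Lemma cderiv_is_derive f z l : cderiv f z l <->
  is_derive (K := C_AbsRing) (V := C_NormedModule) f z l.
Proof.
rewrite cderiv_eps. split.
- intros H. split. apply is_linear_scal_l.
  intros x Hx. apply (is_filter_lim_locally_unique
    (V := AbsRing_NormedModule C_AbsRing)) in Hx. subst x.
  intros e. apply nearA_iff. generalize (H e (cond_pos e)). apply filter_imp.
  intros w Hw.
  assert (E : (minus (minus (f w) (f z)) (scal (minus w z) l) : C)
    = (f w - f z - l * (w - z))%C)
    by (unfold minus, plus, opp, scal; simpl; unfold mult; simpl; ring).
  rewrite <- E in Hw. exact Hw.
- intros [_ H] e He.
  assert (Hz : is_filter_lim (locally (T := AbsRing_UniformSpace C_AbsRing) z) z)
    by (intros P HP; exact HP).
  specialize (H z Hz (mkposreal e He)). apply nearA_iff in H.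
  generalize H. apply filter_imp.
  intros w Hw.
  assert (E : (minus (minus (f w) (f z)) (scal (minus w z) l) : C)
    = (f w - f z - l * (w - z))%C)
    by (unfold minus, plus, opp, scal; simpl; unfold mult; simpl; ring).
  rewrite <- E. exact Hw.
Qed.

Lemma rderiv_is_derive f z l : rderiv f z l <->
  is_derive (K := R_AbsRing) (V := C_R_NormedModule) f z l.
Proof.
rewrite rderiv_eps. split.
- intros H. split. apply is_linear_scal_l.
  intros x Hx. apply (is_filter_lim_locally_unique
    (V := AbsRing_NormedModule R_AbsRing)) in Hx. subst x.
  intros e. generalize (H e (cond_pos e)). apply filter_imp.
  intros w Hw.
  assert (E : (minus (minus (f w) (f z)) (scal (V := C_R_ModuleSpace) (minus w z) l) : C)
    = (f w - f z - l * RtoC (w - z))%C).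
  { apply injective_projections; unfold minus, plus, opp, scal; simpl;
    unfold plus, opp, scal; simpl; unfold mult; simpl; ring. }
  rewrite <- E in Hw. rewrite Cmod_norm in Hw. exact Hw.
- intros [_ H] e He.
  assert (Hz : is_filter_lim (nearR z) z)
    by (intros P HP; exact HP).
  specialize (H z Hz (mkposreal e He)).
  generalize H. apply filter_imp.
  intros w Hw.
  assert (E : (minus (minus (f w) (f z)) (scal (V := C_R_ModuleSpace) (minus w z) l) : C)
    = (f w - f z - l * RtoC (w - z))%C).
  { apply injective_projections; unfold minus, plus, opp, scal; simpl;
    unfold plus, opp, scal; simpl; unfold mult; simpl; ring. }
  rewrite <- E. rewrite Cmod_norm. exact Hw.
Qed.

Lemma cderiv_ccont f z l : cderiv f z l -> ccont f z.
Proof.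
intros [q [Hq [Hc Hl]]]. unfold ccont.
apply (clim_ext _ (fun w => f z + q w * (w - z))%C). intros; now rewrite <- Hq.
apply clim_eq with (f z + q z * (z - z))%C; [|ring].
apply clim_plus. typeclasses eauto. apply ccont_const.
apply clim_mult; [typeclasses eauto| assumption|].
apply clim_minus. typeclasses eauto. apply ccont_id. apply ccont_const.
Qed.

Lemma clim_RtoC_id t : clim (nearR t) (fun s => RtoC s) (RtoC t).
Proof.
intros e He. apply nearR_iff. exists e. split; auto. intros s Hs.
rewrite <- RtoC_minus, Cmod_R. exact Hs.
Qed.

Lemma rderiv_rcont f z l : rderiv f z l -> rcont f z.
Proof.
intros [q [Hq [Hc Hl]]]. unfold rcont.
apply (clim_ext _ (fun w => f z + q w * RtoC (w - z))%C). intros; now rewrite <- Hq.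
apply clim_eq with (f z + q z * (RtoC z - RtoC z))%C; [|ring].
apply clim_plus. typeclasses eauto. apply rcont_const.
apply clim_mult; [typeclasses eauto| assumption|].
apply (clim_ext _ (fun s => RtoC s - RtoC z)%C). intros; now rewrite RtoC_minus.
apply clim_minus. typeclasses eauto. apply clim_RtoC_id. apply rcont_const.
Qed.

Lemma cderiv_const c z : cderiv (fun _ => c) z (RtoC 0).
Proof.
exists (fun _ => RtoC 0). split; [|split]; auto. intros; ring. apply ccont_const.
Qed.
Lemma cderiv_id z : cderiv (fun w => w) z (RtoC 1).
Proof.
exists (fun _ => RtoC 1). split; [|split]; auto. intros; ring. apply ccont_const.
Qed.
Lemma cderiv_eq f z l l' : cderiv f z l -> l = l' -> cderiv f z l'.
Proof. now intros H <-. Qed.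
Lemma cderiv_plus f g z a b : cderiv f z a -> cderiv g z b ->
  cderiv (fun w => f w + g w)%C z (a + b)%C.
Proof.
intros [p [H1 [H2 <-]]] [q [K1 [K2 <-]]].
exists (fun w => p w + q w)%C. split; [|split]; auto.
intros w; rewrite H1, K1; ring. apply clim_plus; auto. typeclasses eauto.
Qed.
Lemma cderiv_mult f g z a b : cderiv f z a -> cderiv g z b ->
  cderiv (fun w => f w * g w)%C z (a * g z + f z * b)%C.
Proof.
intros Hf Hg. assert (Cg := cderiv_ccont _ _ _ Hg).
destruct Hf as [p [H1 [H2 <-]]]. destruct Hg as [q [K1 [K2 <-]]].
exists (fun w => p w * g w + f z * q w)%C. split; [|split]; auto.
intros w. rewrite (H1 w). rewrite (K1 w). ring.
apply clim_plus; [typeclasses eauto| |]; apply clim_mult; auto; try typeclasses eauto.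
apply ccont_const.
Qed.
Lemma cderiv_opp f z a : cderiv f z a -> cderiv (fun w => - f w)%C z (- a)%C.
Proof.
intros [p [H1 [H2 <-]]]. exists (fun w => - p w)%C. split; [|split]; auto.
intros w; rewrite H1; ring. apply clim_opp; auto. typeclasses eauto.
Qed.
Lemma cderiv_minus f g z a b : cderiv f z a -> cderiv g z b ->
  cderiv (fun w => f w - g w)%C z (a - b)%C.
Proof. intros H1 H2. apply cderiv_plus; auto. now apply cderiv_opp. Qed.
Lemma cderiv_scal c f z a : cderiv f z a -> cderiv (fun w => c * f w)%C z (c * a)%C.
Proof.
intros H. eapply cderiv_eq. apply cderiv_mult. apply cderiv_const. exact H. cbv beta; ring.
Qed.
Lemma cderiv_comp f g z a b : cderiv g (f z) b -> cderiv f z a ->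
  cderiv (fun w => g (f w)) z (b * a)%C.
Proof.
intros Hg Hf. assert (Cf := cderiv_ccont _ _ _ Hf).
destruct Hf as [p [H1 [H2 <-]]]. destruct Hg as [q [K1 [K2 <-]]].
exists (fun w => q (f w) * p w)%C. split; [|split]; auto.
intros w. rewrite (K1 (f w)). rewrite (H1 w) at 2. ring.
apply clim_mult; auto. typeclasses eauto.
apply (clim_comp _ f q); auto.
Qed.
Lemma ext_near_eq (f g : C -> C) z : nearC z (fun w => f w = g w) -> f z = g z.
Proof. intros H. now apply locally_singleton in H. Qed.
Lemma cderiv_ext_near f g z l : nearC z (fun w => f w = g w) ->
  cderiv f z l -> cderiv g z l.
Proof.
rewrite !cderiv_eps. intros H K e He. assert (E := ext_near_eq _ _ _ H).
generalize (K e He). generalize H. apply filter_imp2; [typeclasses eauto|].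
intros w -> L. now rewrite <- E.
Qed.
Lemma cderiv_ext f g z l : (forall w, f w = g w) -> cderiv f z l -> cderiv g z l.
Proof. intros H. apply cderiv_ext_near. now apply filter_forall. Qed.
Lemma cderiv_inv f z a : f z <> RtoC 0 -> cderiv f z a ->
  cderiv (fun w => / f w)%C z (- a / (f z * f z))%C.
Proof.
intros Hz Hf. assert (Cf := cderiv_ccont _ _ _ Hf).
assert (N : nearC z (fun w => f w <> RtoC 0)).
{ apply (clim_near _ f (f z) (fun y => y <> RtoC 0)); auto.
  apply nearC_iff. exists (Cmod (f z)). split. now apply Cmod_gt_0.
  intros w Hw E. rewrite E in Hw. replace (0 - f z)%C with (- f z)%C in Hw by ring.
  rewrite Cmod_opp in Hw. lra. }
destruct Hf as [p [H1 [H2 <-]]].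
apply (cderiv_ext_near (fun w => / f z + (- p w / (f w * f z)) * (w - z))%C).
generalize N. apply filter_imp. intros w Hw.
replace (p w * (w - z))%C with (f w - f z)%C by (rewrite (H1 w); ring).
replace (/ f z + - p w / (f w * f z) * (w - z))%C with
  (/ f z - (p w * (w - z)) / (f w * f z))%C by (field; auto).
replace (p w * (w - z))%C with (f w - f z)%C by (rewrite (H1 w); ring).
field; auto.
exists (fun w => - p w / (f w * f z))%C. split; [|split]; auto.
intros w. ring.
apply clim_div; [typeclasses eauto| | |].
now apply Cmult_neq_0. apply clim_opp; auto; typeclasses eauto.
apply clim_mult; auto. typeclasses eauto. apply ccont_const.
Qed.
Lemma cderiv_div f g z a b : g z <> RtoC 0 -> cderiv f z a -> cderiv g z b ->
  cderiv (fun w => f w / g w)%C z (a / g z - f z * b / (g z * g z))%C.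
Proof.
intros Hz Hf Hg. eapply cderiv_eq. apply cderiv_mult. exact Hf.
apply cderiv_inv; [exact Hz | exact Hg]. cbv beta; field; auto.
Qed.
Lemma cderiv_pow n z : cderiv (fun w => w ^ S n)%C z (RtoC (INR (S n)) * z ^ n)%C.
Proof.
induction n as [|n IH].
- apply (cderiv_ext (fun w => w)). intros; simpl; ring.
  eapply cderiv_eq. apply cderiv_id. simpl. ring.
- apply (cderiv_ext (fun w => w * w ^ S n)%C). intros; simpl; ring.
  eapply cderiv_eq. apply cderiv_mult. apply cderiv_id. apply IH.
  rewrite (S_INR (S n)), RtoC_plus. simpl Cpow. ring.
Qed.

Lemma rderiv_eq f z l l' : rderiv f z l -> l = l' -> rderiv f z l'.
Proof. now intros H <-. Qed.
Lemma rderiv_comp f g z a b : cderiv g (f z) b -> rderiv f z a ->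
  rderiv (fun w => g (f w)) z (b * a)%C.
Proof.
intros Hg Hf. assert (Cf := rderiv_rcont _ _ _ Hf).
destruct Hf as [p [H1 [H2 <-]]]. destruct Hg as [q [K1 [K2 <-]]].
exists (fun w => q (f w) * p w)%C. split; [|split]; auto.
intros w. rewrite (K1 (f w)). rewrite (H1 w) at 2. ring.
apply clim_mult; auto. typeclasses eauto.
apply (clim_comp _ f q); auto.
Qed.
Lemma rderiv_pair (u v : R -> R) t a b : is_derive u t a -> is_derive v t b ->
  rderiv (fun s => (u s, v s)) t (a, b).
Proof.
intros [_ Hu] [_ Hv]. apply rderiv_eps. intros e He.
assert (Hz : is_filter_lim (nearR t) t) by (intros P HP; exact HP).
assert (He2 : 0 < e / 2) by lra.
generalize (Hv t Hz (mkposreal _ He2)). generalize (Hu t Hz (mkposreal _ He2)).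
apply filter_imp2; [typeclasses eauto|]. intros s H1 H2.
match goal with |- Cmod ?z <= _ => set (Z := z) end.
assert (H3 := Cmod_triangle (RtoC (fst Z)) (Ci * RtoC (snd Z))%C).
rewrite Cmod_mult, Cmod_Ci, !Cmod_R in H3.
replace (RtoC (fst Z) + Ci * RtoC (snd Z))%C with Z in H3
  by (apply injective_projections; simpl; ring).
assert (E1 : fst Z = minus (minus (u s) (u t)) (scal (minus s t) a)).
{ unfold Z, minus, plus, opp, scal; simpl; unfold mult; simpl. ring. }
assert (E2 : snd Z = minus (minus (v s) (v t)) (scal (minus s t) b)).
{ unfold Z, minus, plus, opp, scal; simpl; unfold mult; simpl. ring. }
rewrite E1, E2 in H3.
change (Rabs (minus (minus (u s) (u t)) (scal (minus s t) a)) <= e / 2 * Rabs (s - t)) in H1.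
change (Rabs (minus (minus (v s) (v t)) (scal (minus s t) b)) <= e / 2 * Rabs (s - t)) in H2.
lra.
Qed.
Lemma rderiv_fst f t l : rderiv f t l -> is_derive (fun s => fst (f s)) t (fst l).
Proof.
rewrite rderiv_eps. intros H. split. apply is_linear_scal_l.
intros x Hx. apply (is_filter_lim_locally_unique
    (V := AbsRing_NormedModule R_AbsRing)) in Hx. subst x.
intros e. generalize (H e (cond_pos e)). apply filter_imp.
intros s Hs. eapply Rle_trans; [|apply Hs].
eapply Rle_trans; [|apply re_le_Cmod]. right. unfold Re.
unfold norm; simpl. unfold abs; simpl. f_equal.
unfold minus, plus, opp, scal; simpl; unfold mult; simpl. ring.
Qed.
Lemma rderiv_snd f t l : rderiv f t l -> is_derive (fun s => snd (f s)) t (snd l).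
Proof.
rewrite rderiv_eps. intros H. split. apply is_linear_scal_l.
intros x Hx. apply (is_filter_lim_locally_unique
    (V := AbsRing_NormedModule R_AbsRing)) in Hx. subst x.
intros e. generalize (H e (cond_pos e)). apply filter_imp.
intros s Hs. eapply Rle_trans; [|apply Hs].
eapply Rle_trans; [|apply Rmax_Cmod]. eapply Rle_trans; [|apply Rmax_r]. right.
unfold norm; simpl. unfold abs; simpl. f_equal.
unfold minus, plus, opp, scal; simpl; unfold mult; simpl. ring.
Qed.

(** * Integrals of complex functions of a real variable *)

Definition rint (f : R -> C) (a b : R) (l : C) : Prop :=
  is_RInt (V := C_R_NormedModule) f a b l.

Lemma rint_FTC (W h : R -> C) a b :
  (forall t, Rmin a b <= t <= Rmax a b -> rderiv W t (h t)) ->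
  (forall t, Rmin a b <= t <= Rmax a b -> rcont h t) ->
  rint h a b (W b - W a)%C.
Proof.
intros H1 H2. apply (is_RInt_derive (V := C_R_CompleteNormedModule) W h).
intros t Ht. apply rderiv_is_derive. auto.
intros t Ht. apply rcont_continuous. auto.
Qed.
Lemma rint_ex f a b : (forall t, Rmin a b <= t <= Rmax a b -> rcont f t) ->
  exists l, rint f a b l.
Proof.
intros H. apply (ex_RInt_continuous (V := C_R_CompleteNormedModule)).
intros t Ht. apply rcont_continuous. auto.
Qed.
Lemma rint_unique f a b l l' : rint f a b l -> rint f a b l' -> l = l'.
Proof.
intros H H'.
rewrite <- (is_RInt_unique (V := C_R_CompleteNormedModule) f a b l H).
now rewrite <- (is_RInt_unique (V := C_R_CompleteNormedModule) f a b l' H').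
Qed.
Lemma rint_ext f g a b l : (forall t, Rmin a b < t < Rmax a b -> f t = g t) ->
  rint f a b l -> rint g a b l.
Proof. apply is_RInt_ext. Qed.
Lemma rint_chasles f a b c l m : rint f a b l -> rint f b c m -> rint f a c (l + m)%C.
Proof. apply (is_RInt_Chasles (V := C_R_NormedModule)). Qed.
Lemma rint_swap f a b l : rint f a b l -> rint f b a (- l)%C.
Proof. apply (is_RInt_swap (V := C_R_NormedModule)). Qed.
Lemma rint_plus f g a b l m : rint f a b l -> rint g a b m ->
  rint (fun t => f t + g t)%C a b (l + m)%C.
Proof. apply (is_RInt_plus (V := C_R_NormedModule)). Qed.
Lemma rint_point f a : rint f a a (RtoC 0).
Proof. apply (is_RInt_point (V := C_R_NormedModule)). Qed.
Lemma rint_const c a b : rint (fun _ => c) a b (RtoC (b - a) * c)%C.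
Proof.
replace (RtoC (b - a) * c)%C with (scal (V := C_R_ModuleSpace) (b - a) c).
apply (is_RInt_const (V := C_R_NormedModule)).
apply injective_projections; simpl; unfold scal; simpl; unfold mult; simpl; ring.
Qed.
Lemma rint_bound f a b l M : (forall t, Rmin a b <= t <= Rmax a b -> Cmod (f t) <= M) ->
  rint f a b l -> Cmod l <= Rabs (b - a) * M.
Proof.
intros H1 H2. rewrite Cmod_norm.
apply (norm_RInt_le_const_abs (V := C_R_NormedModule) f a b l M); auto.
intros x Hx. rewrite <- Cmod_norm. auto.
Qed.
(** The target is a vector space over the reals here, so multiplication by a complex constant is
    checked on real and imaginary parts. *)
Lemma rint_scal c f a b l : rint f a b l -> rint (fun t => c * f t)%C a b (c * l)%C.
Proof.
intros H.
assert (H1 := is_RInt_fct_extend_fst (U := R_NormedModule) (V := R_NormedModule) _ _ _ _ H).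
assert (H2 := is_RInt_fct_extend_snd (U := R_NormedModule) (V := R_NormedModule) _ _ _ _ H).
apply (is_RInt_fct_extend_pair (U := R_NormedModule) (V := R_NormedModule)).
- apply (is_RInt_minus (V := R_NormedModule)).
  apply (is_RInt_scal (V := R_NormedModule)); auto.
  apply (is_RInt_scal (V := R_NormedModule)); auto.
- apply (is_RInt_plus (V := R_NormedModule)).
  apply (is_RInt_scal (V := R_NormedModule)); auto.
  apply (is_RInt_ext (V := R_NormedModule) (fun y => scal (snd c) (fst (f y)))).
  intros; unfold scal; simpl; unfold mult; simpl; ring.
  replace (Im c * Re l)%R with (scal (snd c) (fst l)) by reflexivity.
  apply (is_RInt_scal (V := R_NormedModule)); auto.
Qed.
Lemma rint_minus f g a b l m : rint f a b l -> rint g a b m ->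
  rint (fun t => f t - g t)%C a b (l - m)%C.
Proof. apply (is_RInt_minus (V := C_R_NormedModule)). Qed.
Lemma rcont_bounded f a b : (forall t, a <= t <= b -> rcont f t) ->
  exists M, 0 < M /\ forall t, a <= t <= b -> Cmod (f t) <= M.
Proof.
intros H. destruct (Rle_dec a b) as [L|L].
2:{ exists 1. split. lra. intros; lra. }
destruct (continuity_ab_maj (fun t => Cmod (f t)) a b L) as [m [Hm _]].
- intros c Hc. apply continuity_pt_locally. intros e.
  generalize (H c Hc e (cond_pos e)). apply filter_imp. intros s Hs.
  eapply Rle_lt_trans; [|apply Hs].
  assert (T1 := Cmod_triangle (f s - f c) (f c)).
  replace (f s - f c + f c)%C with (f s) in T1 by ring.
  assert (T2 := Cmod_triangle (f c - f s) (f s)).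
  replace (f c - f s + f s)%C with (f c) in T2 by ring.
  replace (f c - f s)%C with (- (f s - f c))%C in T2 by ring. rewrite Cmod_opp in T2.
  apply Rabs_le. lra.
- exists (Cmod (f m) + 1). split. generalize (Cmod_ge_0 (f m)); lra.
  intros t Ht. generalize (Hm t Ht); lra.
Qed.

(** * Integrals along rectangles and Goursat's theorem *)

Definition RI (f : R -> C) (a b : R) : C := RInt (V := C_R_CompleteNormedModule) f a b.

Lemma RI_rint f a b l : rint f a b l -> RI f a b = l.
Proof. apply (is_RInt_unique (V := C_R_CompleteNormedModule)). Qed.

Lemma RI_correct f a b : (forall t, Rmin a b <= t <= Rmax a b -> rcont f t) ->
  rint f a b (RI f a b).
Proof.
intros H. destruct (rint_ex f a b H) as [l Hl]. now rewrite (RI_rint _ _ _ _ Hl).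
Qed.

Lemma rderiv_hor c s : rderiv (fun t => (t, c)) s (RtoC 1).
Proof.
apply (rderiv_pair (fun t => t) (fun _ => c)).
apply (is_derive_id (K := R_AbsRing)). apply (is_derive_const (V := R_NormedModule) c).
Qed.
Lemma rderiv_ver b s : rderiv (fun t => (b, t)) s Ci.
Proof.
apply (rderiv_pair (fun _ => b) (fun t => t)).
apply (is_derive_const (V := R_NormedModule) b). apply (is_derive_id (K := R_AbsRing)).
Qed.
Lemma rcont_comp (f : C -> C) (g : R -> C) t : ccont f (g t) -> rcont g t ->
  rcont (fun s => f (g s)) t.
Proof. intros H1 H2. unfold rcont. now apply (clim_comp _ g f). Qed.
Lemma rcont_hor (f : C -> C) c s : ccont f (s, c) -> rcont (fun t => f (t, c)) s.
Proof. intros H. apply (rcont_comp f (fun t => (t, c))); auto.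
eapply rderiv_rcont. apply rderiv_hor. Qed.
Lemma rcont_ver (f : C -> C) b s : ccont f (b, s) -> rcont (fun t => f (b, t)) s.
Proof. intros H. apply (rcont_comp f (fun t => (b, t))); auto.
eapply rderiv_rcont. apply rderiv_ver. Qed.

Definition inrect (a b c d : R) (z : C) : Prop :=
  Rmin a b <= fst z <= Rmax a b /\ Rmin c d <= snd z <= Rmax c d.

(** Integral of [f] along the boundary of [[a, b] x [c, d]], signed when
    [b < a] or [d < c]. *)
Definition bdint (f : C -> C) (a b c d : R) : C :=
  (RI (fun s => f (s, c)) a b + Ci * RI (fun s => f (b, s)) c d
   - RI (fun s => f (s, d)) a b - Ci * RI (fun s => f (a, s)) c d)%C.

Lemma RI_hor (f : C -> C) a b c d y : Rmin c d <= y <= Rmax c d ->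
  (forall z, inrect a b c d z -> ccont f z) ->
  rint (fun s => f (s, y)) a b (RI (fun s => f (s, y)) a b).
Proof. intros Hy H. apply RI_correct. intros t Ht. apply rcont_hor, H. now split. Qed.
Lemma RI_ver (f : C -> C) a b c d x : Rmin a b <= x <= Rmax a b ->
  (forall z, inrect a b c d z -> ccont f z) ->
  rint (fun s => f (x, s)) c d (RI (fun s => f (x, s)) c d).
Proof. intros Hy H. apply RI_correct. intros t Ht. apply rcont_ver, H. now split. Qed.

Lemma Rmin_Rmax_l a b : Rmin a b <= a <= Rmax a b.
Proof. split. apply Rmin_l. apply Rmax_l. Qed.
Lemma Rmin_Rmax_r a b : Rmin a b <= b <= Rmax a b.
Proof. split. apply Rmin_r. apply Rmax_r. Qed.

Lemma bdint_minus f g a b c d :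
  (forall z, inrect a b c d z -> ccont f z) -> (forall z, inrect a b c d z -> ccont g z) ->
  bdint (fun z => f z - g z)%C a b c d = (bdint f a b c d - bdint g a b c d)%C.
Proof.
intros Hf Hg. unfold bdint.
rewrite (RI_rint (fun s => f (s, c) - g (s, c))%C a b _ (rint_minus _ _ _ _ _ _
  (RI_hor f a b c d c (Rmin_Rmax_l c d) Hf) (RI_hor g a b c d c (Rmin_Rmax_l c d) Hg))).
rewrite (RI_rint (fun s => f (s, d) - g (s, d))%C a b _ (rint_minus _ _ _ _ _ _
  (RI_hor f a b c d d (Rmin_Rmax_r c d) Hf) (RI_hor g a b c d d (Rmin_Rmax_r c d) Hg))).
rewrite (RI_rint (fun s => f (a, s) - g (a, s))%C c d _ (rint_minus _ _ _ _ _ _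
  (RI_ver f a b c d a (Rmin_Rmax_l a b) Hf) (RI_ver g a b c d a (Rmin_Rmax_l a b) Hg))).
rewrite (RI_rint (fun s => f (b, s) - g (b, s))%C c d _ (rint_minus _ _ _ _ _ _
  (RI_ver f a b c d b (Rmin_Rmax_r a b) Hf) (RI_ver g a b c d b (Rmin_Rmax_r a b) Hg))).
ring.
Qed.

Lemma bdint_bound f a b c d M :
  (forall z, inrect a b c d z -> ccont f z) ->
  (forall z, inrect a b c d z -> Cmod (f z) <= M) ->
  Cmod (bdint f a b c d) <= 2 * M * (Rabs (b - a) + Rabs (d - c)).
Proof.
intros Hf HM. unfold bdint.
assert (B1 := rint_bound _ _ _ _ M (fun t Ht => HM (t, c) (conj Ht (Rmin_Rmax_l c d)))
  (RI_hor f a b c d c (Rmin_Rmax_l c d) Hf)).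
assert (B2 := rint_bound _ _ _ _ M (fun t Ht => HM (t, d) (conj Ht (Rmin_Rmax_r c d)))
  (RI_hor f a b c d d (Rmin_Rmax_r c d) Hf)).
assert (B3 := rint_bound _ _ _ _ M (fun t Ht => HM (a, t) (conj (Rmin_Rmax_l a b) Ht))
  (RI_ver f a b c d a (Rmin_Rmax_l a b) Hf)).
assert (B4 := rint_bound _ _ _ _ M (fun t Ht => HM (b, t) (conj (Rmin_Rmax_r a b) Ht))
  (RI_ver f a b c d b (Rmin_Rmax_r a b) Hf)).
set (u1 := RI (fun s => f (s, c)) a b) in *. set (u2 := RI (fun s => f (s, d)) a b) in *.
set (u3 := RI (fun s => f (a, s)) c d) in *. set (u4 := RI (fun s => f (b, s)) c d) in *.
unfold Cminus.
assert (T1 := Cmod_triangle (u1 + Ci * u4 + - u2) (- (Ci * u3))).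
assert (T2 := Cmod_triangle (u1 + Ci * u4) (- u2)).
assert (T3 := Cmod_triangle u1 (Ci * u4)).
rewrite Cmod_opp in T1, T2. rewrite Cmod_mult, Cmod_Ci in T1, T3. lra.
Qed.

Lemma bdint_primitive F f a b c d :
  (forall z, inrect a b c d z -> ccont f z) ->
  (forall z, inrect a b c d z -> cderiv F z (f z)) ->
  bdint f a b c d = RtoC 0.
Proof.
intros Hf HF. unfold bdint.
assert (H1 : forall y, Rmin c d <= y <= Rmax c d ->
  RI (fun s => f (s, y)) a b = (F (b, y) - F (a, y))%C).
{ intros y Hy. apply RI_rint. apply (rint_FTC (fun s => F (s, y))).
  - intros t Ht. eapply rderiv_eq.
    apply (rderiv_comp (fun t => (t, y)) F). apply HF; now split. apply rderiv_hor.
    ring.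
  - intros t Ht. apply rcont_hor, Hf. now split. }
assert (H2 : forall x, Rmin a b <= x <= Rmax a b ->
  (Ci * RI (fun s => f (x, s)) c d)%C = (F (x, d) - F (x, c))%C).
{ intros x Hx. rewrite <- (RI_rint _ _ _ _ (rint_scal Ci _ _ _ _ (RI_ver f a b c d x Hx Hf))).
  apply RI_rint. apply (rint_FTC (fun s => F (x, s))).
  - intros t Ht. eapply rderiv_eq.
    apply (rderiv_comp (fun t => (x, t)) F). apply HF; now split. apply rderiv_ver.
    cbv beta. ring.
  - intros t Ht. apply clim_mult. typeclasses eauto. apply rcont_const.
    apply rcont_ver, Hf. now split. }
rewrite (H1 c (Rmin_Rmax_l c d)), (H1 d (Rmin_Rmax_r c d)).
rewrite (H2 a (Rmin_Rmax_l a b)), (H2 b (Rmin_Rmax_r a b)). ring.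
Qed.

Lemma inrect_sub a b c d a' b' c' d' z :
  Rmin a b <= a' <= Rmax a b -> Rmin a b <= b' <= Rmax a b ->
  Rmin c d <= c' <= Rmax c d -> Rmin c d <= d' <= Rmax c d ->
  inrect a' b' c' d' z -> inrect a b c d z.
Proof.
intros Ha Hb Hc Hd [H1 H2].
assert (Rmin a b <= Rmin a' b') by (apply Rmin_glb; lra).
assert (Rmax a' b' <= Rmax a b) by (apply Rmax_lub; lra).
assert (Rmin c d <= Rmin c' d') by (apply Rmin_glb; lra).
assert (Rmax c' d' <= Rmax c d) by (apply Rmax_lub; lra).
split; lra.
Qed.

Lemma bdint_split_x f a m b c d : Rmin a b <= m <= Rmax a b ->
  (forall z, inrect a b c d z -> ccont f z) ->
  bdint f a b c d = (bdint f a m c d + bdint f m b c d)%C.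
Proof.
intros Hm Hf. unfold bdint.
assert (H1 : forall y, Rmin c d <= y <= Rmax c d ->
  RI (fun s => f (s, y)) a b = (RI (fun s => f (s, y)) a m + RI (fun s => f (s, y)) m b)%C).
{ intros y Hy. apply RI_rint.
  apply rint_chasles with m; apply RI_correct; intros t Ht; apply rcont_hor, Hf.
  apply (inrect_sub a b c d a m y y); auto using Rmin_Rmax_l, Rmin_Rmax_r.
  split; simpl; auto. rewrite Rmin_left, Rmax_left; lra.
  apply (inrect_sub a b c d m b y y); auto using Rmin_Rmax_l, Rmin_Rmax_r.
  split; simpl; auto. rewrite Rmin_left, Rmax_left; lra. }
rewrite (H1 c (Rmin_Rmax_l c d)), (H1 d (Rmin_Rmax_r c d)). ring.
Qed.

Lemma bdint_split_y f a b c m d : Rmin c d <= m <= Rmax c d ->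
  (forall z, inrect a b c d z -> ccont f z) ->
  bdint f a b c d = (bdint f a b c m + bdint f a b m d)%C.
Proof.
intros Hm Hf. unfold bdint.
assert (H1 : forall x, Rmin a b <= x <= Rmax a b ->
  RI (fun s => f (x, s)) c d = (RI (fun s => f (x, s)) c m + RI (fun s => f (x, s)) m d)%C).
{ intros x Hx. apply RI_rint.
  apply rint_chasles with m; apply RI_correct; intros t Ht; apply rcont_ver, Hf.
  apply (inrect_sub a b c d x x c m); auto using Rmin_Rmax_l, Rmin_Rmax_r.
  split; simpl; auto. rewrite Rmin_left, Rmax_left; lra.
  apply (inrect_sub a b c d x x m d); auto using Rmin_Rmax_l, Rmin_Rmax_r.
  split; simpl; auto. rewrite Rmin_left, Rmax_left; lra. }
rewrite (H1 a (Rmin_Rmax_l a b)), (H1 b (Rmin_Rmax_r a b)). ring.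
Qed.

Lemma Cmod_le_abs (z : C) : Cmod z <= Rabs (fst z) + Rabs (snd z).
Proof.
assert (H3 := Cmod_triangle (RtoC (fst z)) (Ci * RtoC (snd z))%C).
rewrite Cmod_mult, Cmod_Ci, !Cmod_R in H3.
replace (RtoC (fst z) + Ci * RtoC (snd z))%C with z in H3
  by (apply injective_projections; simpl; ring). lra.
Qed.

(** The intervals from [a n] to [a n + w / 2 ^ n] are nested, so the supremum of the left ends lies
    in all of them. *)
Lemma nested_limit (a : nat -> R) (w : R) : 0 <= w ->
  (forall n, a n <= a (S n) <= a n + w / 2 ^ S n) ->
  exists x, forall n, a n <= x <= a n + w / 2 ^ n.
Proof.
intros Hw H.
assert (Hp : forall n, 0 < 2 ^ n) by (intros; apply pow_lt; lra).
assert (H2 : forall n, a (S n) + w / 2 ^ S n <= a n + w / 2 ^ n).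
{ intros n. specialize (H n). specialize (Hp n).
  replace (w / 2 ^ n) with (w / 2 ^ S n + w / 2 ^ S n) by (simpl; field; lra). lra. }
assert (Hinc : forall n m, a n <= a (n + m)%nat).
{ intros n m; induction m. rewrite Nat.add_0_r; lra.
  rewrite Nat.add_succ_r. destruct (H (n + m)%nat); lra. }
assert (Hdec : forall n m, a (n + m)%nat + w / 2 ^ (n + m) <= a n + w / 2 ^ n).
{ intros n m; induction m. rewrite Nat.add_0_r; lra.
  rewrite Nat.add_succ_r. specialize (H2 (n + m)%nat); lra. }
assert (Hwn : forall n, 0 <= w / 2 ^ n).
{ intros n. apply Rmult_le_pos; auto. left. now apply Rinv_0_lt_compat. }
assert (Hub : forall n m, a n <= a m + w / 2 ^ m).
{ intros n m. destruct (Nat.le_ge_cases n m) as [L|L].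
  - replace m with (n + (m - n))%nat by lia. specialize (Hinc n (m - n)%nat).
    specialize (Hwn (n + (m - n))%nat). lra.
  - replace n with (m + (n - m))%nat by lia. specialize (Hdec m (n - m)%nat).
    specialize (Hwn (m + (n - m))%nat). lra. }
destruct (completeness (fun r => exists n, r = a n)) as [x [Hx1 Hx2]].
- exists (a 0%nat + w / 2 ^ 0). intros r [n ->]. apply Hub.
- exists (a 0%nat). now exists 0%nat.
- exists x. intros n. split. apply Hx1. now exists n.
  apply Hx2. intros r [m ->]. apply Hub.
Qed.

(** Subdivision: a nonzero integral leaves at least a quarter of its modulus on one of the four
    quarters. These shrink to a point where [f] is affine up to a small multiple of the distance,
    and affine functions integrate to 0, so the integral at generation [n] is too small. *)
Lemma goursat f a b c d : a <= b -> c <= d ->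
  (forall z, inrect a b c d z -> exists l, cderiv f z l) ->
  bdint f a b c d = RtoC 0.
Proof.
intros Hab Hcd Hf.
destruct (Ceq_dec (bdint f a b c d) (RtoC 0)) as [E|E]; auto. exfalso.
apply Cmod_gt_0 in E. set (eta := Cmod (bdint f a b c d)) in *.
set (w := b - a). set (h := d - c).
assert (Hw : 0 <= w) by (unfold w; lra). assert (Hh : 0 <= h) by (unfold h; lra).
assert (Hp : forall n, 0 < 2 ^ n) by (intros; apply pow_lt; lra).
assert (Hwn : forall u n, 0 <= u -> 0 <= u / 2 ^ n).
{ intros u n Hu. apply Rmult_le_pos; auto. left. now apply Rinv_0_lt_compat. }
(* [p] is the lower left corner of a rectangle of generation [n] that keeps its share of the
   integral. *)
set (Bad := fun (n : nat) (p : R * R) =>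
  a <= fst p /\ fst p + w / 2 ^ n <= b /\ c <= snd p /\ snd p + h / 2 ^ n <= d /\
  eta / 4 ^ n <= Cmod (bdint f (fst p) (fst p + w / 2 ^ n) (snd p) (snd p + h / 2 ^ n))).
assert (Hc : forall z, inrect a b c d z -> ccont f z).
{ intros z Hz. destruct (Hf z Hz) as [l Hl]. eapply cderiv_ccont; eauto. }
assert (Step : forall n p, Bad n p -> exists p', Bad (S n) p' /\
  fst p <= fst p' <= fst p + w / 2 ^ S n /\ snd p <= snd p' <= snd p + h / 2 ^ S n).
{ intros n [x y] (H1 & H2 & H3 & H4 & H5). cbn [fst snd] in *.
  set (w' := w / 2 ^ S n). set (h' := h / 2 ^ S n).
  assert (Ew : w / 2 ^ n = w' + w') by (unfold w'; simpl; field; specialize (Hp n); lra).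
  assert (Eh : h / 2 ^ n = h' + h') by (unfold h'; simpl; field; specialize (Hp n); lra).
  assert (Hw' : 0 <= w') by now apply Hwn. assert (Hh' : 0 <= h') by now apply Hwn.
  rewrite Ew, Eh in *.
  assert (Hsub : forall x1 x2 y1 y2 z, x <= x1 <= x + (w' + w') -> x <= x2 <= x + (w' + w') ->
    y <= y1 <= y + (h' + h') -> y <= y2 <= y + (h' + h') ->
    inrect x1 x2 y1 y2 z -> ccont f z).
  { intros x1 x2 y1 y2 z K1 K2 K3 K4 Hz. apply Hc.
    apply (inrect_sub a b c d x1 x2 y1 y2);
    rewrite ?(Rmin_left a b), ?(Rmax_right a b), ?(Rmin_left c d), ?(Rmax_right c d) by lra; auto; lra. }
  rewrite (bdint_split_x f x (x + w')) in H5.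
  2:{ rewrite Rmin_left, Rmax_right; lra. }
  2:{ intros z. apply Hsub; lra. }
  rewrite (bdint_split_y f x (x + w') y (y + h')) in H5.
  2:{ rewrite Rmin_left, Rmax_right; lra. }
  2:{ intros z. apply Hsub; lra. }
  rewrite (bdint_split_y f (x + w') (x + (w' + w')) y (y + h')) in H5.
  2:{ rewrite Rmin_left, Rmax_right; lra. }
  2:{ intros z. apply Hsub; lra. }
  replace (x + (w' + w')) with (x + w' + w') in * by ring.
  replace (y + (h' + h')) with (y + h' + h') in * by ring.
  set (e1 := bdint f x (x + w') y (y + h')) in *.
  set (e2 := bdint f x (x + w') (y + h') (y + h' + h')) in *.
  set (e3 := bdint f (x + w') (x + w' + w') y (y + h')) in *.
  set (e4 := bdint f (x + w') (x + w' + w') (y + h') (y + h' + h')) in *.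
  assert (T1 := Cmod_triangle (e1 + e2) (e3 + e4)).
  assert (T2 := Cmod_triangle e1 e2). assert (T3 := Cmod_triangle e3 e4).
  assert (E4 : eta / 4 ^ n = 4 * (eta / 4 ^ S n)) by (simpl; field; apply pow_nonzero; lra).
  unfold Bad. fold w' h'.
  destruct (Rle_dec (eta / 4 ^ S n) (Cmod e1)) as [L1|L1].
  { exists (x, y). cbn [fst snd]. repeat split; auto; lra. }
  destruct (Rle_dec (eta / 4 ^ S n) (Cmod e2)) as [L2|L2].
  { exists (x, y + h'). cbn [fst snd]. repeat split; auto; lra. }
  destruct (Rle_dec (eta / 4 ^ S n) (Cmod e3)) as [L3|L3].
  { exists (x + w', y). cbn [fst snd]. repeat split; auto; lra. }
  exists (x + w', y + h'). cbn [fst snd]. repeat split; auto; try lra.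
  fold e4. lra. }
assert (B0 : Bad 0%nat (a, c)).
{ unfold Bad. cbn [fst snd pow]. unfold w, h.
  replace (a + (b - a) / 1) with b by field. replace (c + (d - c) / 1) with d by field.
  fold eta. repeat split; lra. }
set (next := fun n (p : {p | Bad n p}) => let s := constructive_indefinite_description _
   (Step n (proj1_sig p) (proj2_sig p)) in
   exist (Bad (S n)) (proj1_sig s) (proj1 (proj2_sig s))).
set (sq := nat_rect (fun n => {p | Bad n p}) (exist _ _ B0) next).
assert (Hsq : forall n, fst (proj1_sig (sq n)) <= fst (proj1_sig (sq (S n))) <=
    fst (proj1_sig (sq n)) + w / 2 ^ S n /\
    snd (proj1_sig (sq n)) <= snd (proj1_sig (sq (S n))) <=
    snd (proj1_sig (sq n)) + h / 2 ^ S n).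
{ intros n. change (sq (S n)) with (next n (sq n)). unfold next. cbn [proj1_sig].
  destruct (constructive_indefinite_description _ _) as [p' [Hp1 Hp2]]. exact Hp2. }
destruct (nested_limit (fun n => fst (proj1_sig (sq n))) w Hw) as [x0 Hx0].
{ intros n; apply Hsq. }
destruct (nested_limit (fun n => snd (proj1_sig (sq n))) h Hh) as [y0 Hy0].
{ intros n; apply Hsq. }
assert (Bsq := fun n => proj2_sig (sq n)). cbv beta in Bsq.
assert (Hin : inrect a b c d (x0, y0)).
{ destruct (Bsq 0%nat) as (K1 & K2 & K3 & K4 & _).
  specialize (Hx0 0%nat). specialize (Hy0 0%nat).
  split; simpl fst; simpl snd; rewrite Rmin_left, Rmax_right; lra. }
(* The bound becomes [2 * eps * ((w + h) / 2 ^ n) ^ 2], less than [eta / 4 ^ n] for this choice; the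
   [+ 1] keeps the denominator nonzero for a degenerate rectangle. *)
destruct (Hf _ Hin) as [l Hl]. apply cderiv_eps with (eps := eta / (4 * (w + h + 1) ^ 2)) in Hl.
2:{ apply Rdiv_lt_0_compat; auto. apply Rmult_lt_0_compat. lra. apply pow_lt; lra. }
apply nearC_iff in Hl. destruct Hl as [del [Hdel Hl]].
destruct (pow_lt_1_zero (/ 2)) with (y := del / (w + h + 1)) as [n Hn].
{ rewrite Rabs_right; lra. }
{ apply Rdiv_lt_0_compat; lra. }
specialize (Hn n (Nat.le_refl n)). rewrite Rabs_right in Hn.
2:{ apply Rle_ge. apply pow_le. lra. }
rewrite pow_inv in Hn.
specialize (Bsq n). specialize (Hx0 n). specialize (Hy0 n). cbv beta in Hx0, Hy0.
destruct (proj1_sig (sq n)) as [x y]. cbn [fst snd] in *.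
destruct Bsq as (K1 & K2 & K3 & K4 & K5). cbn [fst snd] in *.
assert (Hwn' := Hwn w n Hw). assert (Hhn' := Hwn h n Hh).
set (x1 := x + w / 2 ^ n) in *. set (y1 := y + h / 2 ^ n) in *.
(* The affine approximation at the limit point; having a primitive, it can be subtracted without
   changing the integral. *)
set (P := fun z : C => (f (x0, y0) + l * (z - (x0, y0)))%C).
assert (HP : forall z, cderiv P z l).
{ intros z. unfold P. eapply cderiv_eq. apply cderiv_plus. apply cderiv_const.
  apply cderiv_scal. apply cderiv_minus. apply cderiv_id. apply cderiv_const. ring. }
assert (HP0 : bdint P x x1 y y1 = RtoC 0).
{ apply (bdint_primitive (fun z => f (x0, y0) * z + l * / RtoC 2 * ((z - (x0, y0)) * (z - (x0, y0))))%C).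
  - intros z _. eapply cderiv_ccont; apply HP.
  - intros z _. eapply cderiv_eq. apply cderiv_plus. apply cderiv_scal, cderiv_id.
    apply cderiv_scal. apply cderiv_mult; apply cderiv_minus; try apply cderiv_id; apply cderiv_const.
    unfold P. cbv beta. field. }
assert (Hs : forall z, inrect x x1 y y1 z -> inrect a b c d z).
{ intros z Hz. apply (inrect_sub a b c d x x1 y y1); auto;
  rewrite ?Rmin_left, ?Rmax_right by lra; unfold x1, y1 in *; lra. }
assert (Em : bdint (fun z => f z - P z)%C x x1 y y1 = bdint f x x1 y y1).
{ rewrite bdint_minus. rewrite HP0; ring.
  intros z Hz; auto. intros z _. eapply cderiv_ccont; apply HP. }
rewrite <- Em in K5.
assert (Hsmall : (w + h) / 2 ^ n < del).
{ apply Rle_lt_trans with ((w + h + 1) * / 2 ^ n).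
  - apply Rmult_le_compat_r. left; now apply Rinv_0_lt_compat. lra.
  - apply (Rmult_lt_compat_l (w + h + 1)) in Hn; [|lra].
    replace ((w + h + 1) * (del / (w + h + 1))) with del in Hn by (field; lra). exact Hn. }
assert (Hz : forall z, inrect x x1 y y1 z -> Cmod (z - (x0, y0)) <= (w + h) / 2 ^ n).
{ intros z [Z1 Z2]. rewrite Rmin_left, Rmax_right in Z1 by (unfold x1; lra).
  rewrite Rmin_left, Rmax_right in Z2 by (unfold y1; lra).
  eapply Rle_trans. apply Cmod_le_abs. simpl.
  replace ((w + h) / 2 ^ n) with (w / 2 ^ n + h / 2 ^ n) by (field; specialize (Hp n); lra).
  apply Rplus_le_compat; apply Rabs_le; unfold x1, y1 in *; lra. }
assert (B := bdint_bound (fun z => f z - P z)%C x x1 y y1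
  (eta / (4 * (w + h + 1) ^ 2) * ((w + h) / 2 ^ n))).
assert (B1 : Cmod (bdint (fun z => f z - P z)%C x x1 y y1) <=
  2 * (eta / (4 * (w + h + 1) ^ 2) * ((w + h) / 2 ^ n)) * (Rabs (x1 - x) + Rabs (y1 - y))).
{ apply B.
  - intros z Hz'. apply clim_minus. typeclasses eauto. apply Hc; auto.
    eapply cderiv_ccont; apply HP.
  - intros z Hz'. specialize (Hz z Hz').
    assert (G := Hl z (Rle_lt_trans _ _ _ Hz Hsmall)).
    unfold P. replace (f z - (f (x0, y0) + l * (z - (x0, y0))))%C with
      (f z - f (x0, y0) - l * (z - (x0, y0)))%C by ring.
    eapply Rle_trans. apply G. apply Rmult_le_compat_l; auto.
    apply Rlt_le, Rdiv_lt_0_compat; auto. apply Rmult_lt_0_compat. lra. apply pow_lt; lra. }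
replace (x1 - x) with (w / 2 ^ n) in B1 by (unfold x1; ring).
replace (y1 - y) with (h / 2 ^ n) in B1 by (unfold y1; ring).
rewrite !Rabs_right in B1 by (apply Rle_ge; auto).
assert (K6 := Rle_trans _ _ _ K5 B1).
replace (4 ^ n) with (2 ^ n * 2 ^ n) in K6
  by (rewrite <- Rpow_mult_distr; f_equal; ring).
specialize (Hp n). set (q := 2 ^ n) in *. set (s := w + h) in *.
assert (Hs0 : 0 <= s) by (unfold s; lra).
apply (Rmult_le_compat_r (q * q)) in K6; [|nra].
replace (eta / (q * q) * (q * q)) with eta in K6 by (field; lra).
replace (2 * (eta / (4 * (s + 1) ^ 2) * (s / q)) * (w / q + h / q) * (q * q))
  with (eta * (s * s / (2 * ((s + 1) * (s + 1))))) in K6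
  by (unfold s; field; unfold s in *; split; lra).
assert (s * s / (2 * ((s + 1) * (s + 1))) < 1).
{ apply (Rmult_lt_reg_r (2 * ((s + 1) * (s + 1)))). nra.
  unfold Rdiv. rewrite Rmult_assoc, Rinv_l by nra. nra. }
nra.
Qed.

Lemma inrect_swap_x a b c d z : inrect b a c d z -> inrect a b c d z.
Proof. unfold inrect. now rewrite (Rmin_comm b a), (Rmax_comm b a). Qed.
Lemma inrect_swap_y a b c d z : inrect a b d c z -> inrect a b c d z.
Proof. unfold inrect. now rewrite (Rmin_comm d c), (Rmax_comm d c). Qed.

Lemma bdint_swap_x f a b c d : (forall z, inrect a b c d z -> ccont f z) ->
  bdint f b a c d = (- bdint f a b c d)%C.
Proof.
intros Hf. unfold bdint.
rewrite (RI_rint _ _ _ _ (rint_swap _ _ _ _ (RI_hor f a b c d c (Rmin_Rmax_l c d) Hf))).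
rewrite (RI_rint _ _ _ _ (rint_swap _ _ _ _ (RI_hor f a b c d d (Rmin_Rmax_r c d) Hf))).
ring.
Qed.
Lemma bdint_swap_y f a b c d : (forall z, inrect a b c d z -> ccont f z) ->
  bdint f a b d c = (- bdint f a b c d)%C.
Proof.
intros Hf. unfold bdint.
rewrite (RI_rint _ _ _ _ (rint_swap _ _ _ _ (RI_ver f a b c d a (Rmin_Rmax_l a b) Hf))).
rewrite (RI_rint _ _ _ _ (rint_swap _ _ _ _ (RI_ver f a b c d b (Rmin_Rmax_r a b) Hf))).
ring.
Qed.

Lemma goursat_signed f a b c d :
  (forall z, inrect a b c d z -> exists l, cderiv f z l) ->
  bdint f a b c d = RtoC 0.
Proof.
assert (K : forall a b c d, c <= d -> (forall z, inrect a b c d z -> exists l, cderiv f z l) ->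
  bdint f a b c d = RtoC 0).
{ clear. intros a b c d Hcd Hf. destruct (Rle_dec a b) as [L|L].
  - now apply goursat.
  - assert (Hf' : forall z, inrect b a c d z -> exists l, cderiv f z l).
    { intros z Hz. apply Hf. now apply inrect_swap_x. }
    rewrite bdint_swap_x. rewrite goursat; auto. ring. lra.
    intros z Hz. destruct (Hf' z Hz) as [l Hl]. eapply cderiv_ccont; eauto. }
intros Hf. destruct (Rle_dec c d) as [L|L]. now apply K.
assert (Hf' : forall z, inrect a b d c z -> exists l, cderiv f z l).
{ intros z Hz. apply Hf. now apply inrect_swap_y. }
rewrite bdint_swap_y. rewrite K; auto. ring. lra.
intros z Hz. destruct (Hf' z Hz) as [l Hl]. eapply cderiv_ccont; eauto.
Qed.

Lemma bdint_degenerate_x f a c d : bdint f a a c d = RtoC 0.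
Proof.
unfold bdint. rewrite !(RI_rint _ _ _ _ (rint_point _ a)). ring.
Qed.
Lemma bdint_degenerate_y f a b c : bdint f a b c c = RtoC 0.
Proof.
unfold bdint. rewrite !(RI_rint _ _ _ _ (rint_point _ c)). ring.
Qed.

Lemma Cmod_small_0 (z : C) K : (forall e, 0 < e -> Cmod z <= K * e) -> z = RtoC 0.
Proof.
intros H. destruct (Ceq_dec z (RtoC 0)) as [E|E]; auto. exfalso.
apply Cmod_gt_0 in E.
assert (HK : 0 <= Rabs K) by apply Rabs_pos.
assert (K <= Rabs K) by apply RRle_abs.
specialize (H (Cmod z / (2 * (Rabs K + 1))) ltac:(apply Rdiv_lt_0_compat; lra)).
assert (Cmod z / (2 * (Rabs K + 1)) * (Rabs K + 1) = Cmod z / 2) by (field; lra).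
set (t := Cmod z / (2 * (Rabs K + 1))) in *.
assert (0 < t) by (apply Rdiv_lt_0_compat; lra). nra.
Qed.

Lemma between_between w z t : 0 <= t <= 1 -> Rmin w z <= w + t * (z - w) <= Rmax w z.
Proof.
intros Ht. unfold Rmin, Rmax. destruct (Rle_dec w z); nra.
Qed.

(** Only the small square at the exceptional corner [w] contributes. *)
Lemma bdint_corner f (w z : C) :
  (forall p, inrect (fst w) (fst z) (snd w) (snd z) p -> ccont f p) ->
  (forall p, inrect (fst w) (fst z) (snd w) (snd z) p -> p <> w -> exists l, cderiv f p l) ->
  bdint f (fst w) (fst z) (snd w) (snd z) = RtoC 0.
Proof.
destruct w as [w1 w2], z as [z1 z2]. cbn [fst snd]. intros Hc Hd.
destruct (Req_EM_T w1 z1) as [->|E1]. apply bdint_degenerate_x.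
destruct (Req_EM_T w2 z2) as [->|E2]. apply bdint_degenerate_y.
assert (Cw : ccont f (w1, w2)).
{ apply Hc. split; apply Rmin_Rmax_l. }
specialize (Cw 1 ltac:(lra)). apply nearC_iff in Cw. destruct Cw as [del [Hdel Cw]].
set (L := Rabs (z1 - w1) + Rabs (z2 - w2)).
assert (HL : 0 < L).
{ unfold L. assert (0 < Rabs (z1 - w1)) by (apply Rabs_pos_lt; lra).
  assert (0 <= Rabs (z2 - w2)) by apply Rabs_pos. lra. }
set (M := Cmod (f (w1, w2)) + 1).
assert (HM : 0 < M) by (generalize (Cmod_ge_0 (f (w1, w2))); unfold M; lra).
assert (K : forall t, 0 < t <= 1 -> t * L < del ->
  Cmod (bdint f w1 z1 w2 z2) <= 2 * M * L * t).
{ intros t Ht Htd. set (m1 := w1 + t * (z1 - w1)). set (m2 := w2 + t * (z2 - w2)).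
  assert (B1 : Rmin w1 z1 <= m1 <= Rmax w1 z1) by (apply between_between; lra).
  assert (B2 : Rmin w2 z2 <= m2 <= Rmax w2 z2) by (apply between_between; lra).
  assert (N1 : ~ (Rmin m1 z1 <= w1 <= Rmax m1 z1)).
  { unfold m1, Rmin, Rmax. destruct (Rle_dec (w1 + t * (z1 - w1)) z1); intros [? ?]; [assert (w1 < z1)|assert (z1 < w1)]; nra. }
  assert (N2 : ~ (Rmin m2 z2 <= w2 <= Rmax m2 z2)).
  { unfold m2, Rmin, Rmax. destruct (Rle_dec (w2 + t * (z2 - w2)) z2); intros [? ?]; [assert (w2 < z2)|assert (z2 < w2)]; nra. }
  rewrite (bdint_split_x f w1 m1 z1 w2 z2); auto.
  rewrite (goursat_signed f m1 z1 w2 z2).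
  2:{ intros p Hp. apply Hd. revert Hp. apply inrect_sub; auto using Rmin_Rmax_l, Rmin_Rmax_r.
      intros ->. apply N1. apply Hp. }
  assert (S1 : forall p, inrect w1 m1 w2 z2 p -> inrect w1 z1 w2 z2 p).
  { intros p. apply inrect_sub; auto using Rmin_Rmax_l, Rmin_Rmax_r. }
  rewrite (bdint_split_y f w1 m1 w2 m2 z2); auto.
  rewrite (goursat_signed f w1 m1 m2 z2).
  2:{ intros p Hp. apply Hd. apply S1. revert Hp. apply inrect_sub; auto using Rmin_Rmax_l, Rmin_Rmax_r.
      intros ->. apply N2. apply Hp. }
  assert (S2 : forall p, inrect w1 m1 w2 m2 p -> inrect w1 z1 w2 z2 p).
  { intros p. apply inrect_sub; auto using Rmin_Rmax_l, Rmin_Rmax_r. }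
  replace (bdint f w1 m1 w2 m2 + 0 + 0)%C with (bdint f w1 m1 w2 m2) by ring.
  eapply Rle_trans. apply (bdint_bound f w1 m1 w2 m2 M).
  - intros p Hp; auto.
  - intros p [Hp1 Hp2].
    assert (Cmod (f p - f (w1, w2)) < 1).
    { apply Cw. eapply Rle_lt_trans. apply Cmod_le_abs. eapply Rle_lt_trans; [|exact Htd].
      unfold L. rewrite Rmult_plus_distr_l. simpl. apply Rplus_le_compat.
      - rewrite <- (Rabs_right t) at 1 by lra. rewrite <- Rabs_mult.
        revert Hp1. unfold m1, Rmin, Rmax, Rabs.
        destruct (Rle_dec w1 (w1 + t * (z1 - w1))), (Rcase_abs (fst p + - w1)), (Rcase_abs (t * (z1 - w1))); intros; lra.
      - rewrite <- (Rabs_right t) at 1 by lra. rewrite <- Rabs_mult.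
        revert Hp2. unfold m2, Rmin, Rmax, Rabs.
        destruct (Rle_dec w2 (w2 + t * (z2 - w2))), (Rcase_abs (snd p + - w2)), (Rcase_abs (t * (z2 - w2))); intros; lra. }
    assert (T := Cmod_triangle (f p - f (w1, w2)) (f (w1, w2))).
    replace (f p - f (w1, w2) + f (w1, w2))%C with (f p) in T by ring.
    unfold M; lra.
  - right. unfold m1, m2, L.
    replace (w1 + t * (z1 - w1) - w1) with (t * (z1 - w1)) by ring.
    replace (w2 + t * (z2 - w2) - w2) with (t * (z2 - w2)) by ring.
    rewrite !Rabs_mult, (Rabs_right t) by lra. ring. }
apply (Cmod_small_0 _ (2 * M * L)). intros e He.
set (t := Rmin e (Rmin 1 (del / (2 * L)))).
assert (0 < t).
{ unfold t. repeat apply Rmin_case; try lra. apply Rdiv_lt_0_compat; lra. }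
assert (t <= e) by apply Rmin_l.
assert (t <= 1) by (unfold t; rmin).
assert (t <= del / (2 * L)) by (unfold t; rmin).
assert (t * L < del).
{ apply (Rmult_le_compat_r L) in H2; [|lra].
  replace (del / (2 * L) * L) with (del / 2) in H2 by (field; lra). lra. }
eapply Rle_trans. apply (K t); auto. apply Rmult_le_compat_l; auto.
apply Rmult_le_pos; lra.
Qed.

(** Open squares are preferred to discs because they contain the rectangle spanned by any two of
    their points, on which the primitive along axis-parallel paths relies. *)
Definition box (a : C) (s : R) (z : C) : Prop :=
  Rabs (fst z - fst a) < s /\ Rabs (snd z - snd a) < s.

Lemma box_rect a s z w p : box a s z -> box a s w ->
  inrect (fst z) (fst w) (snd z) (snd w) p -> box a s p.
Proof.
intros [A1 A2] [B1 B2] [Q1 Q2].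
apply Rabs_def2 in A1, A2, B1, B2.
revert Q1 Q2. unfold Rmin, Rmax.
destruct (Rle_dec (fst z) (fst w)), (Rle_dec (snd z) (snd w)); intros;
split; apply Rabs_def1; lra.
Qed.

Lemma Rabs_fst_le (z : C) : Rabs (fst z) <= Cmod z.
Proof. apply re_le_Cmod. Qed.
Lemma Rabs_snd_le (z : C) : Rabs (snd z) <= Cmod z.
Proof. eapply Rle_trans; [|apply Rmax_Cmod]. apply Rmax_r. Qed.

Lemma box_disc a s z : Cmod (z - a) < s -> box a s z.
Proof.
intros H. split; eapply Rle_lt_trans; try exact H.
apply (Rabs_fst_le (z - a)). apply (Rabs_snd_le (z - a)).
Qed.
Lemma box_near a s z : box a s z -> nearC z (box a s).
Proof.
intros [H1 H2]. apply nearC_iff.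
exists (Rmin (s - Rabs (fst z - fst a)) (s - Rabs (snd z - snd a))).
split. apply Rmin_case; lra.
intros w Hw. assert (L1 := Rle_lt_trans _ _ _ (Rabs_fst_le (w - z)) Hw).
assert (L2 := Rle_lt_trans _ _ _ (Rabs_snd_le (w - z)) Hw).
assert (M1 := Rmin_l (s - Rabs (fst z - fst a)) (s - Rabs (snd z - snd a))).
assert (M2 := Rmin_r (s - Rabs (fst z - fst a)) (s - Rabs (snd z - snd a))).
simpl in L1, L2. split.
replace (fst w - fst a) with ((fst w + - fst z) + (fst z - fst a)) by ring.
eapply Rle_lt_trans. apply Rabs_triang. lra.
replace (snd w - snd a) with ((snd w + - snd z) + (snd z - snd a)) by ring.
eapply Rle_lt_trans. apply Rabs_triang. lra.
Qed.
Lemma box_center a s : 0 < s -> box a s a.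
Proof. intros H. split; rewrite Rminus_diag, Rabs_R0; auto. Qed.

(** The exceptional point [w] is the base point of the paths, hence a corner of every rectangle
    involved, so [bdint_corner] applies. This lets difference quotients have primitives before they
    are known to be holomorphic. *)
Lemma primitive_box f a s w : box a s w ->
  (forall z, box a s z -> ccont f z) ->
  (forall z, box a s z -> z <> w -> exists l, cderiv f z l) ->
  exists F, forall z, box a s z -> cderiv F z (f z).
Proof.
intros Hw Hc Hd.
set (F := fun z : C => (RI (fun t => f (t, snd w)) (fst w) (fst z)
   + Ci * RI (fun t => f (fst z, t)) (snd w) (snd z))%C).
(* The two ways round the rectangle from [w] to [z] agree; the first form controls vertical
   increments of [F], the second horizontal ones. *)
assert (F2 : forall z, box a s z -> F z = (Ci * RI (fun t => f (fst w, t)) (snd w) (snd z)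
   + RI (fun t => f (t, snd z)) (fst w) (fst z))%C).
{ intros z Hz. unfold F. apply Cminus_eq_0.
  rewrite <- (bdint_corner f w z).
  - unfold bdint. ring.
  - intros p Hp. apply Hc. apply (box_rect a s w z); auto.
  - intros p Hp. apply Hd. apply (box_rect a s w z); auto. }
exists F. intros z Hz. apply cderiv_eps. intros e He.
assert (Cz := Hc z Hz (e / 2) ltac:(lra)).
assert (Bz := box_near a s z Hz).
apply nearC_iff in Cz. destruct Cz as [d1 [Hd1 Cz]].
apply nearC_iff in Bz. destruct Bz as [d2 [Hd2 Bz]].
apply nearC_iff. exists (Rmin (d1 / 2) d2). split. apply Rmin_case; lra.
intros y Hy.
assert (Hy1 : Cmod (y - z) < d1 / 2) by rmin.
assert (Hy2 : Cmod (y - z) < d2) by rmin.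
assert (By := Bz y Hy2).
set (m := (fst z, snd y) : C).
assert (Bm : box a s m).
{ destruct Hz, By. split; simpl; auto. }
assert (D1 : (F y - F m)%C = RI (fun t => f (t, snd y)) (fst z) (fst y)).
{ rewrite !F2; auto. unfold m; cbn [fst snd].
  assert (E : RI (fun t => f (t, snd y)) (fst w) (fst y) =
    (RI (fun t => f (t, snd y)) (fst w) (fst z) + RI (fun t => f (t, snd y)) (fst z) (fst y))%C).
  { apply RI_rint. apply rint_chasles with (fst z).
    - apply RI_hor with (snd y) (snd y). apply Rmin_Rmax_l.
      intros p Hp. apply Hc. apply (box_rect a s (fst w, snd y) m); auto.
      destruct Hw, By. split; simpl; auto.
    - apply RI_hor with (snd y) (snd y). apply Rmin_Rmax_l.
      intros p Hp. apply Hc. apply (box_rect a s m y); auto. }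
  rewrite E. ring. }
assert (D2 : (F m - F z)%C = (Ci * RI (fun t => f (fst z, t)) (snd z) (snd y))%C).
{ unfold F, m; cbn [fst snd].
  assert (E : RI (fun t => f (fst z, t)) (snd w) (snd y) =
    (RI (fun t => f (fst z, t)) (snd w) (snd z) + RI (fun t => f (fst z, t)) (snd z) (snd y))%C).
  { apply RI_rint. apply rint_chasles with (snd z).
    - apply RI_ver with (fst z) (fst z). apply Rmin_Rmax_l.
      intros p Hp. apply Hc. apply (box_rect a s (fst z, snd w) z); auto.
      destruct Hw, Hz. split; simpl; auto.
    - apply RI_ver with (fst z) (fst z). apply Rmin_Rmax_l.
      intros p Hp. apply Hc. apply (box_rect a s z m); auto. }
  rewrite E. ring. }
assert (Hf1 := Rabs_fst_le (y - z)). assert (Hf2 := Rabs_snd_le (y - z)).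
change (fst (y - z)%C) with (fst y - fst z) in Hf1.
change (snd (y - z)%C) with (snd y - snd z) in Hf2.
assert (Near : forall p, Rabs (fst p - fst z) <= Rabs (fst y - fst z) ->
  Rabs (snd p - snd z) <= Rabs (snd y - snd z) -> Cmod (f p - f z) <= e / 2).
{ intros p Q1 Q2. left. apply Cz. eapply Rle_lt_trans. apply Cmod_le_abs.
  change (fst (p - z)%C) with (fst p - fst z). change (snd (p - z)%C) with (snd p - snd z). lra. }
assert (I1 : Cmod (RI (fun t => f (t, snd y)) (fst z) (fst y) - RtoC (fst y - fst z) * f z)%C
   <= Rabs (fst y - fst z) * (e / 2)).
{ apply (rint_bound (fun t => f (t, snd y) - f z)%C).
  2:{ apply rint_minus. 2: apply rint_const.
      apply RI_hor with (snd y) (snd y). apply Rmin_Rmax_l.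
      intros p Hp. apply Hc. apply (box_rect a s m y); auto. }
  intros t Ht. apply Near; simpl. 2: lra.
  revert Ht. unfold Rmin, Rmax, Rabs.
  destruct (Rle_dec (fst z) (fst y)), (Rcase_abs (t - fst z)), (Rcase_abs (fst y - fst z)); intros; lra. }
assert (I2 : Cmod (RI (fun t => f (fst z, t)) (snd z) (snd y) - RtoC (snd y - snd z) * f z)%C
   <= Rabs (snd y - snd z) * (e / 2)).
{ apply (rint_bound (fun t => f (fst z, t) - f z)%C).
  2:{ apply rint_minus. 2: apply rint_const.
      apply RI_ver with (fst z) (fst z). apply Rmin_Rmax_l.
      intros p Hp. apply Hc. apply (box_rect a s z m); auto. }
  intros t Ht. apply Near; simpl. rewrite Rminus_diag, Rabs_R0. apply Rabs_pos.
  revert Ht. unfold Rmin, Rmax, Rabs.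
  destruct (Rle_dec (snd z) (snd y)), (Rcase_abs (t - snd z)), (Rcase_abs (snd y - snd z)); intros; lra. }
set (r1 := RI (fun t => f (t, snd y)) (fst z) (fst y)) in *.
set (r2 := RI (fun t => f (fst z, t)) (snd z) (snd y)) in *.
replace (F y - F z - f z * (y - z))%C with
  ((r1 - RtoC (fst y - fst z) * f z) + Ci * (r2 - RtoC (snd y - snd z) * f z))%C.
- eapply Rle_trans. apply Cmod_triangle. rewrite Cmod_mult, Cmod_Ci. nra.
- replace (F y - F z)%C with ((F y - F m) + (F m - F z))%C by ring. rewrite D1, D2.
  replace (y - z)%C with (RtoC (fst y - fst z) + Ci * RtoC (snd y - snd z))%C
   by (apply injective_projections; simpl; ring). ring.
Qed.

(** * Cauchy's formula and Taylor expansions *)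

Definition cis (t : R) : C := (cos t, sin t).

Lemma Cmod_cis t : Cmod (cis t) = 1.
Proof.
unfold Cmod, cis; simpl. replace (cos t * (cos t * 1) + sin t * (sin t * 1)) with 1.
apply sqrt_1. generalize (sin2_cos2 t). unfold Rsqr. lra.
Qed.
Lemma rderiv_cis t : rderiv cis t (Ci * cis t)%C.
Proof.
eapply rderiv_eq. apply (rderiv_pair cos sin); apply is_derive_Reals.
apply derivable_pt_lim_cos. apply derivable_pt_lim_sin.
unfold cis. apply injective_projections; simpl; ring.
Qed.
Lemma cis_period : cis (2 * PI) = cis 0.
Proof. unfold cis. now rewrite cos_2PI, sin_2PI, cos_0, sin_0. Qed.

Lemma rderiv_circle (a : C) (r t : R) :
  rderiv (fun s => a + RtoC r * cis s)%C t (Ci * (RtoC r * cis t))%C.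
Proof.
eapply rderiv_eq. apply (rderiv_comp cis (fun z => a + RtoC r * z)%C).
apply cderiv_plus. apply cderiv_const. apply cderiv_scal. apply cderiv_id.
apply rderiv_cis. ring.
Qed.
Lemma rcont_circle a r t : rcont (fun s => a + RtoC r * cis s)%C t.
Proof. eapply rderiv_rcont. apply rderiv_circle. Qed.

Lemma circle_ne r t : 0 < r -> (RtoC r * cis t)%C <> RtoC 0.
Proof.
intros Hr. apply Cmod_gt_0. rewrite Cmod_mult, Cmod_cis, Cmod_R, Rabs_right; lra.
Qed.
Lemma Cmod_circle r t : 0 < r -> Cmod (RtoC r * cis t)%C = r.
Proof. intros Hr. rewrite Cmod_mult, Cmod_cis, Cmod_R, Rabs_right; lra. Qed.

Lemma Ci_ne : Ci <> RtoC 0.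
Proof. intros E. apply (f_equal snd) in E. simpl in E. lra. Qed.

(** On the circle [dz = i (z - a) dt], so this is the integral of [h dz] over a closed curve,
    divided by [i]. *)
Lemma circle_primitive F h a r : 0 < r ->
  (forall t, cderiv F (a + RtoC r * cis t)%C (h (a + RtoC r * cis t)%C)) ->
  (forall t, ccont h (a + RtoC r * cis t)%C) ->
  rint (fun t => h (a + RtoC r * cis t) * (RtoC r * cis t))%C 0 (2 * PI) (RtoC 0).
Proof.
intros Hr HF Hh.
apply (rint_ext (fun t => / Ci * (h (a + RtoC r * cis t) * (Ci * (RtoC r * cis t))))%C).
{ intros t _. field. apply Ci_ne. }
replace (RtoC 0) with (/ Ci * (F (a + RtoC r * cis (2 * PI)) - F (a + RtoC r * cis 0)))%C
  by (rewrite cis_period; ring).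
apply rint_scal. apply (rint_FTC (fun t => F (a + RtoC r * cis t)%C)).
- intros t _. apply (rderiv_comp (fun s => a + RtoC r * cis s)%C F). apply HF.
  apply rderiv_circle.
- intros t _. apply clim_mult. typeclasses eauto.
  apply (rcont_comp h). apply Hh. apply rcont_circle.
  apply clim_mult. typeclasses eauto. apply rcont_const.
  apply clim_mult. typeclasses eauto. apply rcont_const.
  eapply rderiv_rcont. apply rderiv_cis.
Qed.

Lemma cderiv_inv_pow (a z : C) (n : nat) : z <> a ->
  cderiv (fun w => (/ (w - a)) ^ S n)%C z (- RtoC (INR (S n)) * (/ (z - a)) ^ S (S n))%C.
Proof.
intros Hz. assert (Hz' : (z - a)%C <> RtoC 0) by now apply Cminus_eq_contra.
eapply cderiv_eq. apply (cderiv_comp (fun w => / (w - a))%C (fun y => y ^ S n)%C).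
apply cderiv_pow. apply cderiv_inv; auto. apply cderiv_minus. apply cderiv_id.
apply cderiv_const. cbn [Cpow]. field. auto.
Qed.

Lemma circle_neq a r t : 0 < r -> (a + RtoC r * cis t)%C <> a.
Proof.
intros Hr E. apply (circle_ne r t Hr).
replace (RtoC r * cis t)%C with (a + RtoC r * cis t - a)%C by ring. rewrite E. ring.
Qed.

Lemma rint_cis_pow r n : 0 < r ->
  rint (fun t => (/ (RtoC r * cis t)) ^ S n)%C 0 (2 * PI) (RtoC 0).
Proof.
intros Hr.
apply (rint_ext (fun t => ((/ (RtoC 0 + RtoC r * cis t - 0)) ^ S (S n)) * (RtoC r * cis t))%C).
{ intros t _. replace (RtoC 0 + RtoC r * cis t - 0)%C with (RtoC r * cis t)%C by ring.
  assert (N := circle_ne r t Hr). set (z := (RtoC r * cis t)%C) in *.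
  cbn [Cpow]. field. auto. }
apply (circle_primitive (fun w => - / RtoC (INR (S n)) * (/ (w - 0)) ^ S n)%C
  (fun w => (/ (w - 0)) ^ S (S n))%C); auto.
- intros t. eapply cderiv_eq. apply cderiv_scal. apply cderiv_inv_pow.
  now apply circle_neq. field. intros E. apply RtoC_inj in E. generalize (pos_INR n).
  rewrite S_INR in E. lra.
- intros t. eapply cderiv_ccont. apply cderiv_inv_pow. now apply circle_neq.
Qed.

Fixpoint csum (f : nat -> C) (N : nat) : C :=
  match N with O => RtoC 0 | S n => (csum f n + f n)%C end.

Lemma rint_csum (F : nat -> R -> C) (L : nat -> C) a b N :
  (forall j, rint (F j) a b (L j)) ->
  rint (fun t => csum (fun j => F j t) N) a b (csum L N).
Proof.
intros H. induction N as [|N IH]; simpl.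
- assert (E : (RtoC (b - a) * RtoC 0)%C = RtoC 0) by ring. 
  assert (K := rint_const (RtoC 0) a b). rewrite E in K. exact K.
- apply rint_plus; auto.
Qed.

Lemma geometric (u z : C) N : z <> RtoC 0 -> z <> u ->
  (z / (z - u))%C = (csum (fun j => u ^ j * (/ z) ^ j) N + u ^ N * (/ z) ^ N * (z / (z - u)))%C.
Proof.
intros Hz Hu. assert (Hzu := Cminus_eq_contra _ _ Hu).
induction N as [|N IH]. simpl. ring.
rewrite IH at 1. cbn [csum Cpow]. field. auto.
Qed.

Lemma circle_far r t u : 0 < r -> Cmod u < r -> r - Cmod u <= Cmod (RtoC r * cis t - u).
Proof.
intros Hr Hu. assert (T := Cmod_triangle (RtoC r * cis t - u) u).
replace (RtoC r * cis t - u + u)%C with (RtoC r * cis t)%C in T by ring.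
rewrite Cmod_circle in T; auto. lra.
Qed.

(** The geometric expansion of the Cauchy kernel is kept finite with an explicit remainder, so that
    no limit is exchanged with an integral. *)
Lemma kernel_expansion (h : R -> C) r u M l (b : nat -> C) N : 0 < r -> Cmod u < r ->
  (forall t, 0 <= t <= 2 * PI -> Cmod (h t) <= M) ->
  rint (fun t => h t * (RtoC r * cis t / (RtoC r * cis t - u)))%C 0 (2 * PI) l ->
  (forall j, rint (fun t => h t * (/ (RtoC r * cis t)) ^ j)%C 0 (2 * PI) (b j)) ->
  Cmod (l - csum (fun j => u ^ j * b j) N)%C <=
    2 * PI * (M * (Cmod u / r) ^ N * (r / (r - Cmod u))).
Proof.
intros Hr Hu HM Hl Hb.
assert (PIp := PI_RGT_0).
replace (2 * PI) with (Rabs (2 * PI - 0)) by (rewrite Rabs_right; lra).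
apply (rint_bound (fun t => h t * (RtoC r * cis t / (RtoC r * cis t - u))
   - csum (fun j => u ^ j * (h t * (/ (RtoC r * cis t)) ^ j)) N)%C).
2:{ apply rint_minus; auto. apply (rint_csum (fun j t => u ^ j * (h t * (/ (RtoC r * cis t)) ^ j))%C).
    intros j. apply rint_scal. auto. }
intros t Ht. rewrite Rmin_left, Rmax_right in Ht by lra. specialize (HM t Ht).
assert (N0 := circle_ne r t Hr). assert (Fr := circle_far r t u Hr Hu).
assert (Hzr := Cmod_circle r t Hr).
set (z := (RtoC r * cis t)%C) in *.
assert (Hzu : (z - u)%C <> RtoC 0) by (apply Cmod_gt_0; lra).
assert (Hzu' : z <> u) by (intros E; apply Hzu; rewrite E; ring).
rewrite (geometric u z N N0 Hzu').
replace (h t * (csum (fun j => u ^ j * (/ z) ^ j) N + u ^ N * (/ z) ^ N * (z / (z - u)))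
  - csum (fun j => u ^ j * (h t * (/ z) ^ j)) N)%C
  with (h t * ((u * / z) ^ N * (z / (z - u))))%C.
2:{ rewrite Cpow_mult_l. generalize (u ^ N * (/ z) ^ N * (z / (z - u)))%C. intros X.
    assert (E : csum (fun j => u ^ j * (h t * (/ z) ^ j))%C N =
      (h t * csum (fun j => u ^ j * (/ z) ^ j) N)%C).
    { clear. induction N as [|N IH]; simpl. ring. rewrite IH. ring. }
    rewrite E. ring. }
rewrite !Cmod_mult, Cmod_pow, Cmod_mult, Cmod_inv, Hzr by auto.
rewrite Cmod_div, Hzr by auto.
rewrite Rmult_assoc. apply Rmult_le_compat; auto using Cmod_ge_0.
apply Rmult_le_pos. apply pow_le. apply Rmult_le_pos. apply Cmod_ge_0.
left; now apply Rinv_0_lt_compat. apply Rmult_le_pos. lra.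
left; apply Rinv_0_lt_compat; lra.
apply Rmult_le_compat_l. apply pow_le. apply Rmult_le_pos. apply Cmod_ge_0.
left; now apply Rinv_0_lt_compat.
apply Rmult_le_compat_l. lra. apply Rinv_le_contravar; lra.
Qed.

Lemma rcont_kernel r u t : 0 < r -> Cmod u < r ->
  rcont (fun t => RtoC r * cis t / (RtoC r * cis t - u))%C t.
Proof.
intros Hr Hu. assert (Fr := circle_far r t u Hr Hu).
assert (rcont (fun t => RtoC r * cis t)%C t).
{ apply clim_mult. typeclasses eauto. apply rcont_const.
  eapply rderiv_rcont. apply rderiv_cis. }
apply clim_div. typeclasses eauto. apply Cmod_gt_0; lra. auto.
apply clim_minus; auto. typeclasses eauto. apply rcont_const.
Qed.

Lemma rcont_inv_pow r j t : 0 < r -> rcont (fun t => (/ (RtoC r * cis t)) ^ j)%C t.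
Proof.
intros Hr. induction j as [|j IH]; simpl. apply rcont_const.
apply clim_mult; auto. typeclasses eauto. apply clim_inv. typeclasses eauto.
now apply circle_ne. apply clim_mult. typeclasses eauto. apply rcont_const.
eapply rderiv_rcont. apply rderiv_cis.
Qed.

Lemma pow_small q K e : 0 <= q < 1 -> 0 < e -> exists N, K * q ^ N < e.
Proof.
intros Hq He. destruct (pow_lt_1_zero q) with (y := e / (Rabs K + 1)) as [N HN].
rewrite Rabs_right; lra. apply Rdiv_lt_0_compat; auto. generalize (Rabs_pos K); lra.
exists N. specialize (HN N (Nat.le_refl N)).
assert (P := pow_le q N (proj1 Hq)). rewrite Rabs_right in HN by lra.
assert (HK := Rabs_pos K). assert (K <= Rabs K) by apply RRle_abs.
apply (Rmult_lt_compat_r (Rabs K + 1)) in HN; [|lra].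
replace (e / (Rabs K + 1) * (Rabs K + 1)) with e in HN by (field; lra). nra.
Qed.

(** Take [h = 1] in the kernel expansion: every term except the constant one integrates to 0, and
    the remainder tends to 0. *)
Lemma kernel_integral r u : 0 < r -> Cmod u < r ->
  rint (fun t => RtoC r * cis t / (RtoC r * cis t - u))%C 0 (2 * PI) (RtoC (2 * PI)).
Proof.
intros Hr Hu. destruct (rint_ex (fun t => RtoC r * cis t / (RtoC r * cis t - u))%C 0 (2 * PI))
  as [l Hl]. { intros t _. now apply rcont_kernel. }
set (b := fun j : nat => match j with O => RtoC (2 * PI) | _ => RtoC 0 end).
assert (HB : forall N, Cmod (l - csum (fun j => u ^ j * b j) N)%C <=
    2 * PI * (1 * (Cmod u / r) ^ N * (r / (r - Cmod u)))).
{ intros N. apply (kernel_expansion (fun _ => RtoC 1)); auto.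
  - intros t _. rewrite Cmod_1. lra.
  - eapply rint_ext; [|exact Hl]. intros; cbv beta; ring.
  - intros [|j]; simpl b.
    + apply (rint_ext (fun _ => RtoC 1)). intros; simpl; ring.
      replace (RtoC (2 * PI)) with (RtoC (2 * PI - 0) * RtoC 1)%C.
      apply rint_const. rewrite Rminus_0_r. ring.
    + eapply rint_ext; [|apply (rint_cis_pow r j Hr)]. intros; cbv beta; ring. }
assert (E : (l - RtoC (2 * PI))%C = RtoC 0).
{ apply (Cmod_small_0 _ 1). intros e He.
  assert (Hq : 0 <= Cmod u / r < 1).
  { split. apply Rmult_le_pos. apply Cmod_ge_0. left; now apply Rinv_0_lt_compat.
    apply (Rmult_lt_reg_r r); auto. unfold Rdiv. rewrite Rmult_assoc, Rinv_l; lra. }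
  destruct (pow_small (Cmod u / r) (2 * PI * (r / (r - Cmod u)) * (Cmod u / r)) e Hq He) as [N HN].
  specialize (HB (S N)).
  replace (csum (fun j => u ^ j * b j)%C (S N)) with (RtoC (2 * PI)) in HB.
  2:{ clear. induction N as [|N IH]. simpl. ring. cbn [csum] in *. rewrite <- IH. simpl b. ring. }
  eapply Rle_trans. apply HB. left. eapply Rle_lt_trans; [|rewrite Rmult_1_l; apply HN].
  right. simpl. ring. }
apply Cminus_eq_0 in E. now rewrite <- E.
Qed.

Lemma circle_in_box a r s t : 0 < r < s -> box a s (a + RtoC r * cis t)%C.
Proof.
intros [Hr Hs]. apply box_disc. replace (a + RtoC r * cis t - a)%C with (RtoC r * cis t)%C by ring.
rewrite Cmod_circle; auto.
Qed.

Definition holo (D : C -> Prop) (f : C -> C) : Prop :=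
  forall z, D z -> exists l, cderiv f z l.

Lemma holo_ccont D f z : holo D f -> D z -> ccont f z.
Proof. intros H Hz. destruct (H z Hz) as [l Hl]. eapply cderiv_ccont; eauto. Qed.

Lemma near_ne (z w : C) : z <> w -> nearC z (fun y => y <> w).
Proof.
intros E. apply nearC_iff. exists (Cmod (z - w)). split.
now apply Cmod_gt_0, Cminus_eq_contra.
intros y Hy ->. replace (w - z)%C with (- (z - w))%C in Hy by ring.
rewrite Cmod_opp in Hy. lra.
Qed.

Lemma quotient_deriv f q w z m : (forall y, f y = (f w + q y * (y - w))%C) -> z <> w ->
  cderiv f z m -> exists l, cderiv q z l.
Proof.
intros Hq E Hm. assert (N : (z - w)%C <> RtoC 0) by now apply Cminus_eq_contra.
eexists. eapply cderiv_ext_near.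
2:{ apply (cderiv_div (fun y => f y - f w)%C (fun y => y - w)%C z); auto.
    apply cderiv_minus. exact Hm. apply cderiv_const.
    apply cderiv_minus. apply cderiv_id. apply cderiv_const. }
generalize (near_ne z w E). apply filter_imp. intros y Hy. rewrite (Hq y). field.
now apply Cminus_eq_contra.
Qed.

(** The difference quotient of [f] at [w] is continuous, and differentiable except at [w]; hence it
    has a primitive and integrates to 0 over the circle, leaving [f w] times the kernel integral. *)
Lemma cauchy_formula f a s r w : holo (box a s) f -> 0 < r < s -> Cmod (w - a) < r ->
  rint (fun t => f (a + RtoC r * cis t) * (RtoC r * cis t / (RtoC r * cis t - (w - a))))%C
    0 (2 * PI) (RtoC (2 * PI) * f w)%C.
Proof.
intros Hf Hr Hw.
assert (Bw : box a s w) by (apply box_disc; lra).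
destruct (Hf w Bw) as [l Hl]. destruct Hl as [q [Hq [Cq Hql]]].
assert (Hd : forall z, box a s z -> z <> w -> exists l, cderiv q z l).
{ intros z Bz E. destruct (Hf z Bz) as [m Hm]. now apply (quotient_deriv f q w z m). }
assert (Hc : forall z, box a s z -> ccont q z).
{ intros z Bz. destruct (Ceq_dec z w) as [->|E]; auto.
  destruct (Hd z Bz E) as [m Hm]. eapply cderiv_ccont; eauto. }
destruct (primitive_box q a s w Bw Hc Hd) as [F HF].
assert (I1 := circle_primitive F q a r (proj1 Hr)
  (fun t => HF _ (circle_in_box a r s t Hr)) (fun t => Hc _ (circle_in_box a r s t Hr))).
assert (I2 := rint_scal (f w) _ _ _ _ (kernel_integral r (w - a) (proj1 Hr) Hw)).
assert (I3 := rint_plus _ _ _ _ _ _ I1 I2). cbv beta in I3.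
replace (RtoC (2 * PI) * f w)%C with (0 + f w * RtoC (2 * PI))%C by ring.
eapply rint_ext; [|exact I3]. intros t _. cbv beta.
rewrite (Hq (a + RtoC r * cis t)%C).
assert (Fr := circle_far r t (w - a) (proj1 Hr) Hw).
assert (N : (RtoC r * cis t - (w - a))%C <> RtoC 0) by (apply Cmod_gt_0; lra).
replace (a + RtoC r * cis t - w)%C with (RtoC r * cis t - (w - a))%C by ring.
field. exact N.
Qed.

(** The coefficients are the Cauchy integrals over the circle. The estimate of [f a] by the values
    on the circle is the case of the coefficient of index 0; it serves the bound on the number of
    zeros. *)
Lemma taylor f a s r : holo (box a s) f -> 0 < r < s ->
  exists (b : nat -> C) (M : R), 0 < M /\ b 0%nat = f a /\
    (forall K, (forall t, 0 <= t <= 2 * PI -> Cmod (f (a + RtoC r * cis t)%C) <= K) ->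
      Cmod (f a) <= K) /\
    forall N w, Cmod (w - a) < r ->
     Cmod (f w - csum (fun j => (w - a) ^ j * b j) N)%C
       <= M * (Cmod (w - a) / r) ^ N * (r / (r - Cmod (w - a))).
Proof.
intros Hf Hr.
assert (Cf : forall t, rcont (fun t => f (a + RtoC r * cis t)%C) t).
{ intros t. apply (rcont_comp f). apply (holo_ccont _ f _ Hf).
  now apply circle_in_box. apply rcont_circle. }
assert (Cj : forall j, exists l,
  rint (fun t => f (a + RtoC r * cis t) * (/ (RtoC r * cis t)) ^ j)%C 0 (2 * PI) l).
{ intros j. apply rint_ex. intros t _. apply clim_mult. typeclasses eauto.
  apply Cf. now apply rcont_inv_pow. }
assert (PIp := PI_RGT_0).
assert (P2 : RtoC (2 * PI) <> RtoC 0) by (apply RtoC_ne; lra).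
set (b := fun j => proj1_sig (constructive_indefinite_description _ (Cj j))).
assert (Hb : forall j, rint (fun t => f (a + RtoC r * cis t) * (/ (RtoC r * cis t)) ^ j)%C
  0 (2 * PI) (b j)).
{ intros j. unfold b. now destruct (constructive_indefinite_description _ _). }
destruct (rcont_bounded (fun t => f (a + RtoC r * cis t)%C) 0 (2 * PI)) as [M [HM0 HM]].
{ intros t _; auto. }
assert (E0 : b 0%nat = (RtoC (2 * PI) * f a)%C).
{ apply (rint_unique _ _ _ _ _ (Hb 0%nat)).
  eapply rint_ext; [|apply (cauchy_formula f a s r a Hf Hr)].
  - intros t _. simpl. assert (N := circle_ne r t (proj1 Hr)).
    set (z := (RtoC r * cis t)%C) in *. replace (z - (a - a))%C with z by ring. field. auto.
  - replace (a - a)%C with (RtoC 0) by ring. rewrite Cmod_0. lra. }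
exists (fun j => b j / RtoC (2 * PI))%C, M. split; auto. split; [|split].
- rewrite E0. field. auto.
- intros K HK. apply (Rmult_le_reg_l (2 * PI)). lra.
  replace (2 * PI * Cmod (f a)) with (Cmod (b 0%nat))
    by (rewrite E0, Cmod_mult, Cmod_R, Rabs_right; lra).
  replace (2 * PI * K) with (Rabs (2 * PI - 0) * K) by (rewrite Rabs_right; lra).
  eapply rint_bound; [|apply (Hb 0%nat)]. intros t Ht.
  rewrite Rmin_left, Rmax_right in Ht by lra. simpl. rewrite Cmult_1_r. auto.
- intros N w Hw.
  assert (E := kernel_expansion (fun t => f (a + RtoC r * cis t)%C)
    r (w - a) M _ b N (proj1 Hr) Hw HM (cauchy_formula f a s r w Hf Hr Hw) Hb).
  replace (f w - csum (fun j => (w - a) ^ j * (b j / RtoC (2 * PI))) N)%C with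
    (/ RtoC (2 * PI) * (RtoC (2 * PI) * f w - csum (fun j => (w - a) ^ j * b j) N))%C.
  + rewrite Cmod_mult, Cmod_inv, Cmod_R, Rabs_right by (auto; lra).
    apply (Rmult_le_reg_l (2 * PI)). lra. rewrite <- Rmult_assoc, Rinv_r, Rmult_1_l by lra.
    exact E.
  + assert (E2 : csum (fun j => (w - a) ^ j * (b j / RtoC (2 * PI)))%C N =
      (/ RtoC (2 * PI) * csum (fun j => (w - a) ^ j * b j) N)%C).
    { clear - P2. induction N as [|N IH]; simpl. ring. rewrite IH. field; auto. }
    rewrite E2. field. auto.
Qed.

(** * Zeros and partial fractions *)

Lemma near_box (D : C -> Prop) a : nearC a D -> exists s, 0 < s /\ forall z, box a s z -> D z.
Proof.
intros H. apply nearC_iff in H. destruct H as [d [Hd H]].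
exists (d / 2). split. lra. intros z [H1 H2]. apply H.
eapply Rle_lt_trans. apply Cmod_le_abs. simpl. fold (fst z - fst a) (snd z - snd a). lra.
Qed.

Lemma holo_sub (D D' : C -> Prop) f : (forall z, D' z -> D z) -> holo D f -> holo D' f.
Proof. intros H K z Hz. auto. Qed.

(** Removable singularity: the difference quotient at [a], completed by the Taylor coefficient
    [b 1], has derivative [b 2] there. Zeros and poles are peeled off with this throughout. *)
Lemma holo_divide D f a : (forall z, D z -> nearC z D) -> holo D f -> D a ->
  exists q, holo D q /\ forall z, f z = (f a + (z - a) * q z)%C.
Proof.
intros HD Hf Ha.
destruct (near_box D a (HD a Ha)) as [s [Hs Hbox]].
destruct (taylor f a s (s / 2)) as [b [M [HM [E0 [_ HT]]]]].
{ eapply holo_sub; eauto. } { lra. }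
set (r := s / 2) in *. assert (Hr : 0 < r) by (unfold r; lra).
symmetry in E0.
set (q := fun z => if Ceq_dec z a then b 1%nat else ((f z - f a) / (z - a))%C).
assert (Hq : forall z, f z = (f a + q z * (z - a))%C).
{ intros z. unfold q. destruct (Ceq_dec z a) as [->|E]. ring. field.
  now apply Cminus_eq_contra. }
exists q. split. 2:{ intros z. rewrite (Hq z). ring. }
intros z Hz. destruct (Ceq_dec z a) as [->|E].
2:{ destruct (Hf z Hz) as [m Hm]. now apply (quotient_deriv f q a z m). }
exists (b 2%nat). apply cderiv_eps. intros e He.
(* For [|w - a| < r / 2] the factor [r / (r - |w - a|)] is at most 2, so the Taylor remainder after
   three terms is at most [K |w - a| ^ 3]. *)
set (K := M / (r * r * r) * 2).
assert (HK : 0 < K).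
{ unfold K. apply Rmult_lt_0_compat; [|lra]. apply Rdiv_lt_0_compat; auto.
  apply Rmult_lt_0_compat; auto. apply Rmult_lt_0_compat; auto. }
apply nearC_iff. exists (Rmin (r / 2) (e / K)). split.
{ apply Rmin_case. lra. now apply Rdiv_lt_0_compat. }
intros w Hw.
assert (W1 : Cmod (w - a) < r / 2) by rmin.
assert (W2 : Cmod (w - a) < e / K) by rmin.
destruct (Ceq_dec w a) as [->|E].
{ replace (q a - q a - b 2%nat * (a - a))%C with (RtoC 0) by ring.
  rewrite Cmod_0. apply Rmult_le_pos. lra. apply Cmod_ge_0. }
assert (N : (w - a)%C <> RtoC 0) by now apply Cminus_eq_contra.
assert (Ew : q w = ((f w - f a) / (w - a))%C) by (unfold q; destruct (Ceq_dec w a); congruence).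
assert (Ea : q a = b 1%nat) by (unfold q; destruct (Ceq_dec a a); congruence).
rewrite Ew, Ea, E0.
set (u := (w - a)%C) in *.
replace ((f w - b 0%nat) / u - b 1%nat - b 2%nat * u)%C with
  ((f w - csum (fun j => u ^ j * b j) 3) / u)%C by (cbn [csum Cpow]; field; auto).
rewrite Cmod_div by auto. apply Cmod_gt_0 in N.
apply (Rmult_le_reg_r (Cmod u)); auto. unfold Rdiv at 1. rewrite Rmult_assoc, Rinv_l by lra.
rewrite Rmult_1_r.
eapply Rle_trans. apply HT. fold u. lra.
fold u. set (v := Cmod u) in *.
assert (A1 : r / (r - v) <= 2).
{ apply (Rmult_le_reg_r (r - v)). lra. unfold Rdiv. rewrite Rmult_assoc, Rinv_l; lra. }
apply Rle_trans with (K * v * v * v).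
- unfold K. replace (M / (r * r * r) * 2 * v * v * v) with (M * (v / r) ^ 3 * 2) by (field; lra).
  apply Rmult_le_compat_l; auto. apply Rmult_le_pos. lra. apply pow_le.
  apply Rmult_le_pos. lra. left; now apply Rinv_0_lt_compat.
- apply Rmult_le_compat_r. lra. apply Rmult_le_compat_r. lra.
  apply (Rmult_lt_compat_l K) in W2; auto.
  replace (K * (e / K)) with e in W2 by (field; lra). lra.
Qed.

Lemma cderiv_unique f z l m : cderiv f z l -> cderiv f z m -> l = m.
Proof.
intros Hl Hm. apply Cminus_eq_0. apply (Cmod_small_0 _ 2). intros e He.
apply cderiv_eps with (eps := e) in Hl; auto. apply cderiv_eps with (eps := e) in Hm; auto.
assert (H := filter_and _ _ Hl Hm). apply nearC_iff in H. destruct H as [d [Hd H]].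
specialize (H (z + RtoC (d / 2))%C).
replace (z + RtoC (d / 2) - z)%C with (RtoC (d / 2)) in H by ring.
rewrite Cmod_R, Rabs_right in H by lra. destruct H as [H1 H2]. lra.
set (D := (f (z + RtoC (d / 2)) - f z)%C) in *.
assert (T := Cmod_triangle (D - m * RtoC (d / 2)) (- (D - l * RtoC (d / 2)))).
rewrite Cmod_opp in T.
replace (D - m * RtoC (d / 2) + - (D - l * RtoC (d / 2)))%C with ((l - m) * RtoC (d / 2))%C in T by ring.
rewrite Cmod_mult, Cmod_R, Rabs_right in T by lra.
apply (Rmult_le_reg_r (d / 2)). lra. lra.
Qed.

Lemma is_series_csum (a : nat -> C) l :
  is_series (K := C_AbsRing) (V := C_NormedModule) a l <->
  forall e, 0 < e -> exists N0, forall N, (N0 <= N)%nat -> Cmod (csum a N - l) < e.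
Proof.
(* [sum_n a n] has [n + 1] terms, [csum a n] has [n]. *)
assert (E : forall n, (sum_n (G := C_NormedModule) a n : C) = csum a (S n)).
{ intros n. induction n as [|n IH].
  rewrite sum_O. simpl. ring. rewrite sum_Sn, IH. reflexivity. }
unfold is_series. split.
- intros H. apply (clim_filterlim eventually (sum_n (G := C_NormedModule) a) l) in H.
  intros e He. destruct (H e He) as [N0 HN]. exists (S N0). intros [|N] HN'. lia.
  rewrite <- E. apply HN. lia.
- intros H. apply (clim_filterlim eventually (sum_n (G := C_NormedModule) a) l).
  intros e He. destruct (H e He) as [N0 HN]. exists N0. intros N HN'. rewrite E. apply HN. lia.
Qed.

Lemma csum_ext f g N : (forall j, (j < N)%nat -> f j = g j) -> csum f N = csum g N.
Proof.
induction N as [|N IH]; intros H; simpl; auto. rewrite IH, (H N); auto.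
Qed.

Lemma is_pseries_csum (b : nat -> C) u l :
  is_pseries (K := C_AbsRing) (V := C_NormedModule) b u l <->
  forall e, 0 < e -> exists N0, forall N, (N0 <= N)%nat ->
    Cmod (csum (fun j => u ^ j * b j)%C N - l) < e.
Proof.
unfold is_pseries. rewrite is_series_csum.
assert (E : forall N, csum (fun k => scal (V := C_NormedModule) (pow_n (K := C_AbsRing) u k) (b k)) N
  = csum (fun j => u ^ j * b j)%C N).
{ intros N. apply csum_ext. intros j _. unfold scal; simpl.
  change (Cmult (pow_n (K := C_AbsRing) u j) (b j) = (u ^ j * b j)%C). reflexivity. }
split; intros H e He; destruct (H e He) as [N0 HN]; exists N0; intros N L; specialize (HN N L).
now rewrite <- E. now rewrite E.
Qed.

Lemma holo_pseries f a s : 0 < s -> holo (box a s) f ->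
  exists b r, 0 < r /\ forall w, Cmod (w - a) < r ->
    is_pseries (K := C_AbsRing) (V := C_NormedModule) b (w - a)%C (f w).
Proof.
intros Hs Hf. destruct (taylor f a s (s / 2) Hf) as [b [M [HM [_ [_ HT]]]]]. lra.
exists b, (s / 2). split. lra. intros w Hw. apply is_pseries_csum. intros e He.
set (r := s / 2) in *. assert (Hr : 0 < r) by (unfold r; lra).
assert (Hq : 0 <= Cmod (w - a) / r < 1).
{ split. apply Rmult_le_pos. apply Cmod_ge_0. left; now apply Rinv_0_lt_compat.
  apply (Rmult_lt_reg_r r); auto. unfold Rdiv. rewrite Rmult_assoc, Rinv_l; lra. }
destruct (pow_small (Cmod (w - a) / r) (M * (r / (r - Cmod (w - a)))) e Hq He) as [N0 HN0].
exists N0. intros N HN. rewrite <- Cmod_opp. rewrite Copp_minus_distr.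
eapply Rle_lt_trans. apply HT; auto. eapply Rle_lt_trans; [|exact HN0].
replace (M * (Cmod (w - a) / r) ^ N * (r / (r - Cmod (w - a)))) with
 (M * (r / (r - Cmod (w - a))) * (Cmod (w - a) / r) ^ N) by ring.
apply Rmult_le_compat_l.
- apply Rmult_le_pos. lra. apply Rmult_le_pos. lra. left; apply Rinv_0_lt_compat; lra.
- replace N with (N0 + (N - N0))%nat by lia. rewrite pow_add.
  rewrite <- (Rmult_1_r ((Cmod (w - a) / r) ^ N0)) at 2.
  apply Rmult_le_compat_l. apply pow_le; lra. rewrite <- (pow1 (N - N0)).
  apply pow_incr. lra.
Qed.

(** Zeros are repeated in the list, so that [count_occ] is the multiplicity. *)
Definition lprod (l : list C) (z : C) : C := fold_right (fun a p => (z - a) * p)%C (RtoC 1) l.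
Definition lsum (f : C -> C) (l : list C) : C := fold_right (fun a p => f a + p)%C (RtoC 0) l.

Definition everywhere : C -> Prop := fun _ => True.
Lemma everywhere_open z : everywhere z -> nearC z everywhere.
Proof. intros _. now apply filter_forall. Qed.

Lemma lprod_0 l z : lprod l z = RtoC 0 <-> In z l.
Proof.
induction l as [|a l IH]; simpl.
- split. intros E. apply RtoC_inj in E. lra. tauto.
- split.
  + intros E. destruct (Ceq_dec (z - a) (RtoC 0)) as [E1|E1].
    left. symmetry. now apply Cminus_eq_0.
    right. apply IH. destruct (Ceq_dec (lprod l z) (RtoC 0)) as [E2|E2]; auto.
    exfalso. now apply (Cmult_neq_0 _ _ E1 E2).
  + intros [->|H]. ring. apply IH in H. rewrite H. ring.
Qed.

Lemma cderiv_lprod l z : exists d, cderiv (lprod l) z d.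
Proof.
induction l as [|a l [d IH]]; simpl.
- exists (RtoC 0). apply cderiv_const.
- eexists. apply (cderiv_mult (fun z => z - a)%C (lprod l)).
  apply cderiv_minus. apply cderiv_id. apply cderiv_const. exact IH.
Qed.

Lemma ccont_rcont_circle f r : holo everywhere f ->
  forall t, rcont (fun t => f (RtoC 0 + RtoC r * cis t)%C) t.
Proof.
intros Hf t. apply (rcont_comp f). apply (holo_ccont _ f _ Hf). exact I. apply rcont_circle.
Qed.

(** Jensen: a function with many zeros near [0] is small at [0] compared with
    its size on a larger circle. *)
Lemma zeros_bound g rho : 0 < rho -> holo everywhere g -> g (RtoC 0) <> RtoC 0 ->
  exists N0, forall l h, (forall a, In a l -> Cmod a <= rho) -> holo everywhere h ->
    (forall z, g z = (lprod l z * h z)%C) -> (length l <= N0)%nat.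
Proof.
intros Hrho Hg Hg0. apply Cmod_gt_0 in Hg0.
(* On the circle of radius [3 * rho] each factor is at least [2 * rho], while at 0 it is at most
   [rho]: every zero costs [g 0] a factor 1/2. [N0] is the number beyond which this contradicts the
   value of [g 0]. *)
destruct (rcont_bounded (fun t => g (RtoC 0 + RtoC (3 * rho) * cis t)%C) 0 (2 * PI)) as [M [HM0 HM]].
{ intros t _. now apply ccont_rcont_circle. }
destruct (pow_small (/ 2) M (Cmod (g (RtoC 0)))) as [N0 HN0]; [lra|auto|].
exists N0. intros l h Hl Hh Hgh.
destruct (Compare_dec.le_lt_dec (length l) N0) as [L|L]; auto. exfalso.
destruct (taylor h (RtoC 0) (4 * rho) (3 * rho)) as [_ [_ [_ [_ [Hb _]]]]].
{ eapply holo_sub; [|exact Hh]. intros; exact I. } { lra. }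
set (n := length l) in *.
assert (Hbig : forall t, (2 * rho) ^ n <= Cmod (lprod l (RtoC 0 + RtoC (3 * rho) * cis t)%C)).
{ intros t. set (z := (RtoC 0 + RtoC (3 * rho) * cis t)%C).
  assert (Hz : Cmod z = 3 * rho).
  { unfold z. rewrite Cplus_0_l. apply Cmod_circle. lra. }
  unfold n. clear - Hl Hz Hrho. induction l as [|a l IH]; simpl. rewrite Cmod_1; lra.
  rewrite Cmod_mult. apply Rmult_le_compat. lra. apply pow_le; lra.
  2:{ apply IH. intros; apply Hl; now right. }
  assert (Ha := Hl a (or_introl eq_refl)). assert (T := Cmod_triangle (z - a) a).
  replace (z - a + a)%C with z in T by ring. lra. }
assert (Hsmall : Cmod (lprod l (RtoC 0)) <= rho ^ n).
{ unfold n. clear - Hl Hrho. induction l as [|a l IH]; simpl. rewrite Cmod_1; lra.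
  rewrite Cmod_mult. apply Rmult_le_compat; try apply Cmod_ge_0.
  replace (0 - a)%C with (- a)%C by ring. rewrite Cmod_opp. apply Hl; now left.
  apply IH. intros; apply Hl; now right. }
assert (Pn : 0 < (2 * rho) ^ n) by (apply pow_lt; lra).
assert (Hh0 : Cmod (h (RtoC 0)) <= M / (2 * rho) ^ n).
{ apply Hb. intros t Ht. specialize (HM t Ht). cbv beta in HM.
  rewrite Hgh, Cmod_mult in HM. specialize (Hbig t).
  set (A := Cmod (lprod l (RtoC 0 + RtoC (3 * rho) * cis t)%C)) in *.
  set (B := Cmod (h (RtoC 0 + RtoC (3 * rho) * cis t)%C)) in *.
  apply (Rmult_le_reg_r ((2 * rho) ^ n)); auto.
  unfold Rdiv. rewrite Rmult_assoc, Rinv_l by lra. nra. }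
rewrite Hgh, Cmod_mult in HN0, Hg0.
assert (Q : Cmod (lprod l (RtoC 0)) * Cmod (h (RtoC 0)) <= rho ^ n * (M / (2 * rho) ^ n)).
{ apply Rmult_le_compat; auto; apply Cmod_ge_0. }
replace (rho ^ n * (M / (2 * rho) ^ n)) with (M * (/ 2) ^ n) in Q.
2:{ rewrite Rpow_mult_distr, pow_inv. field. split; apply pow_nonzero; lra. }
replace n with (N0 + (n - N0))%nat in Q by lia. rewrite pow_add in Q.
assert ((/ 2) ^ (n - N0) <= 1).
{ rewrite <- (pow1 (n - N0)). apply pow_incr. lra. }
assert (0 < M * (/ 2) ^ N0) by (apply Rmult_lt_0_compat; auto; apply pow_lt; lra).
nra.
Qed.

(** Zeros are divided out one at a time; the bound on their number makes this stop. *)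
Lemma factor_zeros g rho : 0 < rho -> holo everywhere g -> g (RtoC 0) <> RtoC 0 ->
  exists l h, (forall a, In a l <-> Cmod a <= rho /\ g a = RtoC 0) /\ holo everywhere h /\
    (forall z, g z = (lprod l z * h z)%C) /\ (forall z, Cmod z <= rho -> h z <> RtoC 0).
Proof.
intros Hrho Hg Hg0. destruct (zeros_bound g rho Hrho Hg Hg0) as [N0 HN0].
(* [k] bounds the number of factors that can still be extracted. *)
assert (K : forall k l h, (N0 - length l <= k)%nat -> (forall a, In a l -> Cmod a <= rho) ->
  holo everywhere h -> (forall z, g z = (lprod l z * h z)%C) ->
  exists l h, (forall a, In a l -> Cmod a <= rho) /\ holo everywhere h /\
    (forall z, g z = (lprod l z * h z)%C) /\ (forall z, Cmod z <= rho -> h z <> RtoC 0)).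
{ induction k as [|k IH]; intros l h Hk Hl Hh Hgh.
  all: destruct (excluded_middle_informative (exists z, Cmod z <= rho /\ h z = RtoC 0)) as [[a [Ha1 Ha2]]|NE];
    [|exists l, h; repeat split; auto; intros z Hz E; apply NE; now exists z].
  all: destruct (holo_divide everywhere h a everywhere_open Hh I) as [q [Hq Hhq]].
  all: assert (Hgq : forall z, g z = (lprod (a :: l) z * q z)%C)
    by (intros z; rewrite Hgh, Hhq, Ha2; simpl; ring).
  all: assert (Hl' : forall b, In b (a :: l) -> Cmod b <= rho) by (intros b [<-|Hb]; auto).
  all: assert (Len := HN0 (a :: l) q Hl' Hq Hgq); simpl in Len.
  lia.
  apply (IH (a :: l) q); auto. simpl. lia. }
destruct (K N0 nil g) as [l [h [H1 [H2 [H3 H4]]]]].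
- lia.
- intros a [].
- exact Hg.
- intros z. simpl. ring.
- exists l, h. split; [|auto]. intros a. split.
  + intros Ha. split; auto. rewrite H3. apply lprod_0 in Ha. rewrite Ha. ring.
  + intros [Ha1 Ha2]. apply lprod_0. rewrite H3 in Ha2.
    destruct (Ceq_dec (lprod l a) (RtoC 0)) as [E|E]; auto.
    exfalso. apply (Cmult_neq_0 _ _ E (H4 a Ha1)). exact Ha2.
Qed.

Lemma lprod_split a l z : lprod l z =
  ((z - a) ^ count_occ Ceq_dec l a * lprod (filter (fun b => if Ceq_dec b a then false else true) l) z)%C.
Proof.
induction l as [|b l IH]; simpl. ring.
destruct (Ceq_dec b a) as [->|E]; simpl; rewrite IH; ring.
Qed.

Lemma lsum_ext f g l : (forall a, In a l -> f a = g a) -> lsum f l = lsum g l.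
Proof.
induction l as [|a l IH]; intros H; simpl; auto. rewrite IH, (H a); auto.
now left. intros; apply H; now right.
Qed.

Lemma holo_minus D f g : holo D f -> holo D g -> holo D (fun z => f z - g z)%C.
Proof.
intros Hf Hg z Hz. destruct (Hf z Hz) as [a Ha], (Hg z Hz) as [b Hb].
eexists. apply cderiv_minus; eauto.
Qed.
Lemma holo_mult D f g : holo D f -> holo D g -> holo D (fun z => f z * g z)%C.
Proof.
intros Hf Hg z Hz. destruct (Hf z Hz) as [a Ha], (Hg z Hz) as [b Hb].
eexists. apply cderiv_mult; eauto.
Qed.
Lemma holo_div D f g : (forall z, D z -> g z <> RtoC 0) -> holo D f -> holo D g ->
  holo D (fun z => f z / g z)%C.
Proof.
intros Hn Hf Hg z Hz. destruct (Hf z Hz) as [a Ha], (Hg z Hz) as [b Hb].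
eexists. apply cderiv_div; eauto.
Qed.
Lemma holo_const D c : holo D (fun _ => c).
Proof. intros z _. eexists. apply cderiv_const. Qed.
Lemma holo_lprod D l : holo D (lprod l).
Proof. intros z _. apply cderiv_lprod. Qed.

Lemma holo_primitive a s f : 0 < s -> holo (box a s) f ->
  exists F, forall z, box a s z -> cderiv F z (f z).
Proof.
intros Hs Hf. apply (primitive_box f a s a). now apply box_center.
intros z Hz. now apply (holo_ccont _ f z Hf). intros z Hz _. auto.
Qed.

(** Removing one factor [z - a] leaves a single power of [1 / (z - a)] and a quotient with the
    shorter list. The power has a primitive if [a] occurs again in the list; otherwise its exponent
    is 1 and it is kept as a simple fraction. Thus only repeated points create singularities in
    [F]. *)
Lemma partial_fractions o s : 0 < s -> forall l, (forall a, In a l -> box o s a) ->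
  forall H, holo (box o s) H ->
  exists (c : C -> C) (F : C -> C),
    (forall z, box o s z -> ~ In z l ->
      cderiv F z (H z / lprod l z - lsum (fun a => c a / (z - a)) (nodup Ceq_dec l))%C) /\
    (forall z, box o s z -> (count_occ Ceq_dec l z <= 1)%nat -> ccont F z).
Proof.
intros Hs l. induction l as [|a l IH]; intros Hl H HH.
- destruct (holo_primitive o s H Hs HH) as [F HF].
  exists (fun _ => RtoC 0), F. split.
  + intros z Hz _. simpl. eapply cderiv_eq. apply HF; auto. field.
  + intros z Hz _. eapply cderiv_ccont. apply HF; auto.
- assert (Ba : box o s a) by (apply Hl; now left).
  set (P := filter (fun b => if Ceq_dec b a then false else true) l).
  remember (count_occ Ceq_dec l a) as m eqn:Em.
  assert (HP : forall z, lprod l z = ((z - a) ^ m * lprod P z)%C) by (intros; subst m; apply lprod_split).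
  assert (HPa : lprod P a <> RtoC 0).
  { intros E. apply lprod_0 in E. apply filter_In in E. destruct E as [_ E].
    destruct (Ceq_dec a a); congruence. }
  (* With this constant [H - c0 * lprod P] vanishes at [a], so a factor [z - a] cancels. *)
  set (c0 := (H a / lprod P a)%C).
  destruct (holo_divide (box o s) (fun z => H z - c0 * lprod P z)%C a) as [H1 [HH1 E1]]; auto.
  { apply box_near. }
  { apply holo_minus; auto. apply holo_mult. apply holo_const. apply holo_lprod. }
  cbv beta in E1. replace (H a - c0 * lprod P a)%C with (RtoC 0) in E1 by (unfold c0; field; auto).
  destruct (IH (fun b Hb => Hl b (or_intror Hb)) H1 HH1) as [c [F [HF1 HF2]]].
  assert (Key : forall z, ~ In z (a :: l) -> (H z / lprod (a :: l) z =
    c0 * (/ (z - a)) ^ S m + H1 z / lprod l z)%C).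
  { intros z Hz. assert (Na : (z - a)%C <> RtoC 0).
    { intros E. apply Hz. left. symmetry. now apply Cminus_eq_0. }
    assert (Nl : lprod l z <> RtoC 0) by (intros E; apply lprod_0 in E; apply Hz; now right).
    simpl lprod. rewrite HP in *.
    assert (Nm : ((z - a) ^ m)%C <> RtoC 0).
    { intros E. apply Nl. rewrite E. ring. }
    assert (NP : lprod P z <> RtoC 0).
    { intros E. apply Nl. rewrite E. ring. }
    assert (EH : H z = (c0 * lprod P z + (z - a) * H1 z)%C).
    { replace (H z) with ((H z - c0 * lprod P z) + c0 * lprod P z)%C by ring.
      rewrite E1. ring. }
    rewrite EH. rewrite Cpow_inv. cbn [Cpow]. field. auto. auto. }
  destruct (in_dec Ceq_dec a l) as [Ia|Ia].
  + assert (Hm : (1 <= m)%nat) by (apply (count_occ_In Ceq_dec) in Ia; lia).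
    destruct m as [|m']. lia.
    exists c, (fun z => F z - c0 / RtoC (INR (S m')) * (/ (z - a)) ^ S m')%C. split.
    * intros z Hz Nz. eapply cderiv_eq. apply cderiv_minus. apply HF1; auto.
      intros K; apply Nz; now right. apply cderiv_scal. apply cderiv_inv_pow.
      intros ->. apply Nz; now left. rewrite Key by auto.
      simpl nodup. destruct (in_dec Ceq_dec a l); [|tauto].
      field. split. apply lprod_0 in Ia. intros E. apply Nz. right. now apply lprod_0.
      intros E. apply RtoC_inj in E. generalize (pos_INR m'). rewrite S_INR in E. lra.
    * intros z Hz Cz. simpl in Cz.
      destruct (Ceq_dec a z) as [->|E].
      { apply (count_occ_In Ceq_dec) in Ia. lia. }
      apply clim_minus. typeclasses eauto. apply HF2; auto.
      apply clim_mult. typeclasses eauto. apply ccont_const.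
      eapply cderiv_ccont. apply cderiv_inv_pow. auto.
  + assert (Hm : m = 0%nat) by (subst m; now apply count_occ_not_In).
    exists (fun z => if Ceq_dec z a then c0 else c z), F. split.
    * intros z Hz Nz. eapply cderiv_eq. apply HF1; auto. intros K; apply Nz; now right.
      rewrite Key by auto. rewrite Hm. simpl nodup.
      destruct (in_dec Ceq_dec a l); [tauto|]. simpl lsum.
      destruct (Ceq_dec a a) as [_|?]; [|congruence].
      rewrite (lsum_ext (fun a0 => (if Ceq_dec a0 a then c0 else c a0) / (z - a0))%C
        (fun a0 => c a0 / (z - a0))%C).
      2:{ intros b Hb. destruct (Ceq_dec b a) as [->|?]; auto. apply nodup_In in Hb. tauto. }
      simpl. unfold Cdiv. ring.
    * intros z Hz Cz. apply HF2; auto. simpl in Cz. destruct (Ceq_dec a z); lia.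
Qed.

(** * Residues *)

Notation pser b u l := (is_pseries (K := C_AbsRing) (V := C_NormedModule) b u l).

Lemma pser_terms_bounded (b : nat -> C) (u l : C) : pser b u l ->
  exists M, 0 < M /\ forall j, Cmod (u ^ j * b j)%C <= M.
Proof.
rewrite is_pseries_csum. intros H. destruct (H 1 ltac:(lra)) as [N0 HN].
set (a := fun j => (u ^ j * b j)%C) in *.
assert (K : forall N, exists M, 0 < M /\ forall j, (j < N)%nat -> Cmod (a j) <= M).
{ induction N as [|N [M [HM IH]]]. exists 1. split. lra. intros; lia.
  exists (M + Cmod (a N)). generalize (Cmod_ge_0 (a N)). split. lra.
  intros j Hj. destruct (Nat.eq_dec j N) as [->|E]. lra. assert (j < N)%nat by lia.
  specialize (IH j H1). lra. }
destruct (K N0) as [M [HM HK]]. exists (M + 2). split. lra. intros j.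
destruct (Compare_dec.le_lt_dec N0 j) as [L|L].
- assert (H1 := HN j L). assert (H2 := HN (S j) ltac:(lia)). cbn [csum] in H2.
  assert (T := Cmod_triangle (csum a j + a j - l) (- (csum a j - l))).
  rewrite Cmod_opp in T.
  replace (csum a j + a j - l + - (csum a j - l))%C with (a j) in T by ring.
  change (u ^ j * b j)%C with (a j). lra.
- specialize (HK j L). change (u ^ j * b j)%C with (a j). lra.
Qed.

(** Convergence at [u0] bounds the terms there, which gives geometric domination by powers of 1/2 on
    the half disc, uniformly in [u]. *)
Lemma pser_remainder (b : nat -> C) (u0 l0 : C) k : u0 <> RtoC 0 -> pser b u0 l0 ->
  exists K, 0 < K /\ forall u l, Cmod u <= Cmod u0 / 2 -> pser b u l ->
    Cmod (l - csum (fun j => u ^ j * b j) k)%C <= K * Cmod u ^ k.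
Proof.
intros Hu0 H0. destruct (pser_terms_bounded b u0 l0 H0) as [M [HM HB]].
apply Cmod_gt_0 in Hu0. set (r := Cmod u0) in *.
exists (2 * M / r ^ k). split.
{ apply Rdiv_lt_0_compat. lra. now apply pow_lt. }
intros u l Hu Hl. rewrite is_pseries_csum in Hl.
set (a := fun j => (u ^ j * b j)%C) in *.
set (q := Cmod u / r).
assert (Hq : 0 <= q <= / 2).
{ split. apply Rmult_le_pos. apply Cmod_ge_0. left; now apply Rinv_0_lt_compat.
  apply (Rmult_le_reg_r r); auto. unfold q, Rdiv. rewrite Rmult_assoc, Rinv_l; lra. }
assert (Ha : forall j, Cmod (a j) <= M * q ^ j).
{ intros j. specialize (HB j). unfold a. rewrite Cmod_mult, Cmod_pow in *. fold r in HB.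
  replace (Cmod u) with (q * r) by (unfold q; field; lra).
  rewrite Rpow_mult_distr. assert (0 <= q ^ j) by now apply pow_le. nra. }
assert (Hs : forall i, Cmod (csum a (k + i) - csum a k)%C <= 2 * M * q ^ k * (1 - (/ 2) ^ i)).
{ induction i as [|i IH].
  - rewrite Nat.add_0_r. replace (csum a k - csum a k)%C with (RtoC 0) by ring. rewrite Cmod_0.
    simpl. lra.
  - rewrite Nat.add_succ_r. cbn [csum].
    replace (csum a (k + i) + a (k + i)%nat - csum a k)%C
      with ((csum a (k + i) - csum a k) + a (k + i)%nat)%C by ring.
    eapply Rle_trans. apply Cmod_triangle. specialize (Ha (k + i)%nat).
    rewrite pow_add in Ha.
    assert (q ^ i <= (/ 2) ^ i) by (apply pow_incr; lra).
    assert (0 <= q ^ k) by now apply pow_le.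
    assert (M * (q ^ k * q ^ i) <= M * q ^ k * (/ 2) ^ i).
    { rewrite Rmult_assoc. apply Rmult_le_compat_l. lra. now apply Rmult_le_compat_l. }
    simpl. lra. }
apply Rnot_lt_le. intros L.
replace (2 * M / r ^ k * Cmod u ^ k) with (2 * M * q ^ k) in L.
2:{ unfold q, Rdiv. rewrite Rpow_mult_distr, pow_inv. ring. }
set (X := Cmod (l - csum a k)%C) in *.
destruct (Hl (X - 2 * M * q ^ k)) as [N0 HN]. lra.
specialize (HN (k + N0)%nat ltac:(lia)). specialize (Hs N0).
assert (T := Cmod_triangle (- (csum a (k + N0) - l)) (csum a (k + N0) - csum a k)).
rewrite Cmod_opp in T.
replace (- (csum a (k + N0) - l) + (csum a (k + N0) - csum a k))%C with (l - csum a k)%C in T by ring.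
fold X in T. assert (0 <= (/ 2) ^ N0) by (apply pow_le; lra).
assert (0 <= 2 * M * q ^ k) by (apply Rmult_le_pos; [lra|now apply pow_le]). nra.
Qed.

Lemma csum_shift (f : nat -> C) N : csum f (S N) = (f 0%nat + csum (fun j => f (S j)) N)%C.
Proof.
induction N as [|N IH]. simpl. ring.
change (csum f (S (S N))) with (csum f (S N) + f (S N))%C. rewrite IH. simpl. ring.
Qed.

Lemma csum_scal (c : C) f N : csum (fun j => c * f j)%C N = (c * csum f N)%C.
Proof. induction N as [|N IH]; simpl. ring. rewrite IH. ring. Qed.

Lemma pser_shift (b : nat -> C) (u l : C) : u <> RtoC 0 -> pser b u (b 0%nat + u * l)%C ->
  pser (fun j => b (S j)) u l.
Proof.
intros Hu. rewrite !is_pseries_csum. intros H e He.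
apply Cmod_gt_0 in Hu.
destruct (H (Cmod u * e)) as [N0 HN]. now apply Rmult_lt_0_compat.
exists N0. intros N HN'. specialize (HN (S N) ltac:(lia)). rewrite csum_shift in HN.
rewrite (csum_ext (fun j => u ^ S j * b (S j))%C (fun j => u * (u ^ j * b (S j)))%C) in HN
  by (intros; simpl; ring).
rewrite csum_scal in HN.
replace (u ^ 0 * b 0%nat + u * csum (fun j => u ^ j * b (S j)) N - (b 0%nat + u * l))%C
  with (u * (csum (fun j => u ^ j * b (S j)) N - l))%C in HN by (simpl; ring).
rewrite Cmod_mult in HN. apply (Rmult_lt_reg_l (Cmod u)); auto.
Qed.

Lemma box_exists_ne a s : 0 < s -> exists w, box a s w /\ w <> a.
Proof.
intros Hs. exists (a + RtoC (s / 2))%C. split.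
- apply box_disc. replace (a + RtoC (s / 2) - a)%C with (RtoC (s / 2)) by ring.
  rewrite Cmod_R, Rabs_right; lra.
- intros E. assert (E2 : RtoC (s / 2) = RtoC 0).
  { replace (RtoC (s / 2)) with (a + RtoC (s / 2) - a)%C by ring. rewrite E. ring. }
  apply RtoC_inj in E2. lra.
Qed.

Lemma pser_value_at_center (b : nat -> C) (B : C -> C) (a : C) s : 0 < s -> ccont B a ->
  (forall w, box a s w -> w <> a -> pser b (w - a)%C (B w)) -> B a = b 0%nat.
Proof.
intros Hs CB Hb.
destruct (box_exists_ne a s Hs) as [w0 [Bw0 Nw0]].
  destruct (pser_remainder b (w0 - a)%C (B w0) 1) as [K [HK HR]].
  now apply Cminus_eq_contra. now apply Hb.
  assert (N0 : 0 < Cmod (w0 - a)) by now apply Cmod_gt_0, Cminus_eq_contra.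
  apply Cminus_eq_0. apply (Cmod_small_0 _ (1 + K)). intros e He.
  specialize (CB e He). apply nearC_iff in CB. destruct CB as [d [Hd CB]].
  set (t := Rmin (Rmin (d / 2) (s / 2)) (Rmin e (Cmod (w0 - a) / 2))).
  assert (Ht : 0 < t) by (unfold t; repeat apply Rmin_case; lra).
  assert (T1 : t <= d / 2) by (unfold t; rmin).
  assert (T2 : t <= s / 2) by (unfold t; rmin).
  assert (T3 : t <= e) by (unfold t; rmin).
  assert (T4 : t <= Cmod (w0 - a) / 2) by (unfold t; rmin).
  set (w := (a + RtoC t)%C).
  assert (Ew : (w - a)%C = RtoC t) by (unfold w; ring).
  assert (Mw : Cmod (w - a) = t) by (rewrite Ew, Cmod_R, Rabs_right; lra).
  assert (Nw : w <> a).
  { intros E. rewrite E in Mw. replace (a - a)%C with (RtoC 0) in Mw by ring.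
    rewrite Cmod_0 in Mw. lra. }
  assert (Bw : box a s w) by (apply box_disc; lra).
  assert (R1 := HR (w - a)%C (B w) ltac:(lra) (Hb w Bw Nw)).
  assert (R2 := CB w ltac:(lra)).
  replace (csum (fun j => (w - a) ^ j * b j) 1)%C with (b 0%nat) in R1 by (simpl; ring).
  rewrite Mw, pow_1 in R1.
  assert (T := Cmod_triangle (- (B w - B a)) (B w - b 0%nat)).
  rewrite Cmod_opp in T.
  replace (- (B w - B a) + (B w - b 0%nat))%C with (B a - b 0%nat)%C in T by ring. nra.
Qed.

(** The principal part is peeled off one coefficient at a time. *)
Lemma laurent_primitive m : forall (b : nat -> C) (B : C -> C) (a : C) s, 0 < s -> holo (box a s) B ->
  (forall w, box a s w -> w <> a -> pser b (w - a)%C (B w)) ->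
  exists F, forall w, box a s w -> w <> a ->
    cderiv F w (B w / (w - a) ^ S m - b m / (w - a))%C.
Proof.
induction m as [|m IH]; intros b B a s Hs HB Hb.
all: destruct (holo_divide (box a s) B a (box_near a s) HB (box_center a s Hs)) as [q [Hq Eq]].
all: assert (E0 : B a = b 0%nat)
  by (apply (pser_value_at_center b B a s); auto;
      apply (holo_ccont _ B a HB (box_center a s Hs))).
- destruct (holo_primitive a s q Hs Hq) as [F HF]. exists F.
  intros w Bw Nw. assert (N := Cminus_eq_contra _ _ Nw).
  eapply cderiv_eq. apply HF; auto. rewrite Eq, E0. simpl. field. auto.
- destruct (IH (fun j => b (S j)) q a s Hs Hq) as [F HF].
  { intros w Bw Nw. apply pser_shift. now apply Cminus_eq_contra.
    rewrite <- E0, <- Eq. auto. }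
  exists (fun w => F w - b 0%nat / RtoC (INR (S m)) * (/ (w - a)) ^ S m)%C.
  intros w Bw Nw. assert (N := Cminus_eq_contra _ _ Nw).
  eapply cderiv_eq. apply cderiv_minus. apply HF; auto.
  apply cderiv_scal. apply cderiv_inv_pow; auto.
  rewrite (Eq w), E0. rewrite Cpow_inv by auto.
  assert (Nm : ((w - a) ^ m)%C <> RtoC 0) by now apply Cpow_nz.
  cbn [Cpow]. field. split; auto. split; auto.
  intros E. apply RtoC_inj in E. generalize (pos_INR m). rewrite S_INR in E. lra.
Qed.

(** Integrating over a circle would give [2 PI k = 0]. *)
Lemma no_primitive_of_inverse F a s k : 0 < s ->
  (forall w, box a s w -> w <> a -> cderiv F w (k / (w - a))%C) -> k = RtoC 0.
Proof.
intros Hs HF.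
assert (Hr : 0 < s / 2 < s) by lra.
assert (I := circle_primitive F (fun w => k / (w - a))%C a (s / 2) (proj1 Hr)).
assert (I1 : rint (fun t => k) 0 (2 * PI) (RtoC 0)).
{ eapply rint_ext; [|apply I].
  - intros t _. cbv beta.
    replace (a + RtoC (s / 2) * cis t - a)%C with (RtoC (s / 2) * cis t)%C by ring.
    assert (N := circle_ne (s / 2) t (proj1 Hr)).
    set (z := (RtoC (s / 2) * cis t)%C) in *. field; auto.
  - intros t. apply HF. now apply circle_in_box. apply circle_neq; lra.
  - intros t. apply clim_div. typeclasses eauto.
    apply Cminus_eq_contra, circle_neq; lra. apply ccont_const.
    apply clim_minus. typeclasses eauto. apply ccont_id. apply ccont_const. }
assert (E := rint_unique _ _ _ _ _ I1 (rint_const k 0 (2 * PI))).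
destruct (Ceq_dec k (RtoC 0)) as [Ek|Ek]; auto. exfalso.
revert E. apply not_eq_sym. apply Cmult_neq_0; auto.
intros E. apply RtoC_inj in E. generalize PI_RGT_0. lra.
Qed.

(** A residue is recognised through primitives: [f - c / (w - a)] has one around [a] for a single
    value of [c]. This turns partial fractions directly into values of residues. *)
Lemma residue_eq f a c c' F s : 0 < s -> is_residue f a c ->
  (forall w, box a s w -> w <> a -> exists l, cderiv f w l) ->
  (forall w, box a s w -> w <> a -> cderiv F w (f w - c' / (w - a))%C) -> c = c'.
Proof.
intros Hs [m [b [r [Hr [Hb <-]]]]] Hf HF.
set (s' := Rmin s (r / 2)).
assert (Hs' : 0 < s') by (unfold s'; apply Rmin_case; lra).
assert (S1 : s' <= s) by apply Rmin_l. assert (S2 : s' <= r / 2) by apply Rmin_r.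
assert (BB : forall w, box a s' w -> box a s w).
{ intros w [H1 H2]. split; lra. }
assert (Hp : forall w, box a s' w -> w <> a -> pser b (w - a)%C ((w - a) ^ S m * f w)%C).
{ intros w [H1 H2] Nw. apply Hb. split. now apply Cmod_gt_0, Cminus_eq_contra.
  eapply Rle_lt_trans. apply Cmod_le_abs. simpl. fold (fst w - fst a) (snd w - snd a). lra. }
(* [(w - a) ^ (m + 1) * f] continued across [a] by its series; the remainder of order 2 gives its
   derivative [b 1] at [a]. *)
set (B := fun w => if Ceq_dec w a then b 0%nat else ((w - a) ^ S m * f w)%C).
assert (EB : forall w, w <> a -> B w = ((w - a) ^ S m * f w)%C).
{ intros w Nw. unfold B. destruct (Ceq_dec w a); congruence. }
assert (EBa : B a = b 0%nat) by (unfold B; destruct (Ceq_dec a a); congruence).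
assert (HB : holo (box a s') B).
{ intros w Bw. destruct (Ceq_dec w a) as [->|Nw].
  - destruct (box_exists_ne a s' Hs') as [w0 [Bw0 Nw0]].
    destruct (pser_remainder b (w0 - a)%C _ 2 (Cminus_eq_contra _ _ Nw0) (Hp w0 Bw0 Nw0)) as [K [HK HR]].
    assert (N0 : 0 < Cmod (w0 - a)) by now apply Cmod_gt_0, Cminus_eq_contra.
    exists (b 1%nat). apply cderiv_eps. intros e He. apply nearC_iff.
    exists (Rmin (Rmin s' (Cmod (w0 - a) / 2)) (e / K)).
    split. { repeat apply Rmin_case; try lra. now apply Rdiv_lt_0_compat. }
    intros w Hw.
    assert (W1 : Cmod (w - a) < s').
    { rmin. }
    assert (W2 : Cmod (w - a) < Cmod (w0 - a) / 2).
    { rmin. }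
    assert (W3 : Cmod (w - a) < e / K).
    { rmin. }
    destruct (Ceq_dec w a) as [->|Nw].
    { replace (B a - B a - b 1%nat * (a - a))%C with (RtoC 0) by ring.
      rewrite Cmod_0. apply Rmult_le_pos. lra. apply Cmod_ge_0. }
    specialize (HR (w - a)%C _ ltac:(lra) (Hp w (box_disc _ _ _ W1) Nw)).
    rewrite (EB w Nw), EBa.
    replace ((w - a) ^ S m * f w - b 0%nat - b 1%nat * (w - a))%C with
     ((w - a) ^ S m * f w - csum (fun j => (w - a) ^ j * b j) 2)%C by (simpl csum; cbn [Cpow]; ring).
    eapply Rle_trans. apply HR. simpl. rewrite Rmult_1_r, <- Rmult_assoc.
    apply Rmult_le_compat_r. apply Cmod_ge_0.
    apply (Rmult_lt_compat_l K) in W3; auto.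
    replace (K * (e / K)) with e in W3 by (field; lra). lra.
  - destruct (Hf w (BB w Bw) Nw) as [l Hl]. eexists.
    eapply cderiv_ext_near.
    2:{ apply (cderiv_mult (fun w => (w - a) ^ S m)%C f); [|exact Hl].
        apply (cderiv_comp (fun w => w - a)%C (fun y => y ^ S m)%C). apply cderiv_pow.
        apply cderiv_minus. apply cderiv_id. apply cderiv_const. }
    generalize (near_ne w a Nw). apply filter_imp. intros y Hy. now rewrite EB. }
destruct (laurent_primitive m b B a s' Hs' HB) as [F1 HF1].
{ intros w Bw Nw. rewrite EB by auto. auto. }
apply Cminus_eq_0. apply (no_primitive_of_inverse (fun w => F w - F1 w)%C a s'); auto.
intros w Bw Nw. eapply cderiv_eq. apply cderiv_minus. apply HF; auto. apply HF1; auto.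
rewrite EB by auto. assert (N := Cminus_eq_contra _ _ Nw).
assert (Nm : ((w - a) ^ m)%C <> RtoC 0) by now apply Cpow_nz.
cbn [Cpow]. field. auto.
Qed.

(** * The exponential and the principal logarithm *)

Lemma Cexp_plus a b : Cexp (a + b)%C = (Cexp a * Cexp b)%C.
Proof.
unfold Cexp. destruct a as [x y], b as [x' y']. simpl.
rewrite exp_plus, cos_plus, sin_plus.
apply injective_projections; simpl; ring.
Qed.
Lemma Cexp_0 : Cexp (RtoC 0) = RtoC 1.
Proof. unfold Cexp. simpl. rewrite exp_0, cos_0, sin_0. apply injective_projections; simpl; ring. Qed.
Lemma Cmod_Cexp z : Cmod (Cexp z) = exp (Re z).
Proof.
unfold Cexp. replace (exp (Re z) * cos (Im z), exp (Re z) * sin (Im z)) with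
  (RtoC (exp (Re z)) * cis (Im z))%C
  by (unfold cis; apply injective_projections; simpl; ring).
rewrite Cmod_mult, Cmod_cis, Cmod_R, Rabs_right, Rmult_1_r; auto.
apply Rle_ge, Rlt_le, exp_pos.
Qed.
Lemma Cexp_ne z : Cexp z <> RtoC 0.
Proof. apply Cmod_gt_0. rewrite Cmod_Cexp. apply exp_pos. Qed.
Lemma Cexp_opp z : Cexp (- z)%C = (/ Cexp z)%C.
Proof.
assert (E : (Cexp (- z) * Cexp z)%C = RtoC 1).
{ rewrite <- Cexp_plus. replace (- z + z)%C with (RtoC 0) by ring. apply Cexp_0. }
assert (N := Cexp_ne z).
replace (Cexp (- z)) with (Cexp (- z) * Cexp z * / Cexp z)%C by (field; auto).
rewrite E. field. auto.
Qed.
Lemma Cexp_RtoC x : Cexp (RtoC x) = RtoC (exp x).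
Proof. unfold Cexp; simpl. rewrite cos_0, sin_0. apply injective_projections; simpl; ring. Qed.
Lemma Cexp_mult_nat n z : Cexp (RtoC (INR n) * z)%C = (Cexp z ^ n)%C.
Proof.
induction n as [|n IH].
- simpl. replace (RtoC 0 * z)%C with (RtoC 0) by ring. apply Cexp_0.
- rewrite S_INR, RtoC_plus. replace ((RtoC (INR n) + 1) * z)%C with (z + RtoC (INR n) * z)%C by ring.
  rewrite Cexp_plus, IH. reflexivity.
Qed.

Lemma is_derive_eps (f : R -> R) (x l e : R) : is_derive f x l -> 0 < e ->
  exists d, 0 < d /\ forall h, Rabs h < d -> Rabs (f (x + h) - f x - l * h) <= e * Rabs h.
Proof.
intros [_ H] He.
assert (Hz : is_filter_lim (nearR x) x) by (intros P HP; exact HP).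
specialize (H x Hz (mkposreal e He)). apply nearR_iff in H. destruct H as [d [Hd H]].
exists d. split; auto. intros h Hh. specialize (H (x + h)).
replace (x + h - x) with h in H by ring. specialize (H Hh).
assert (E : f (x + h) - f x - l * h =
  minus (minus (f (x + h)) (f x)) (scal (minus (x + h) x) l)).
{ unfold minus, plus, opp, scal; simpl; unfold mult; simpl. ring. }
rewrite E. replace (Rabs h) with (norm (minus (x + h) x)). exact H.
unfold norm; simpl; unfold abs; simpl. f_equal.
unfold minus, plus, opp; simpl. ring.
Qed.

Lemma cderiv_Cexp_0 : cderiv Cexp (RtoC 0) (RtoC 1).
Proof.
apply cderiv_eps. intros e He.
(* The errors add up to at most [8 * t * r] with [r = |w|], which [t <= e / 10] absorbs. *)
set (t := Rmin (e / 10) (1 / 10)).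
assert (Ht : 0 < t) by (unfold t; apply Rmin_case; lra).
assert (T1 : t <= e / 10) by apply Rmin_l. assert (T2 : t <= 1 / 10) by apply Rmin_r. clearbody t.
destruct (is_derive_eps exp 0 1 t) as [d1 [Hd1 H1]]; auto.
{ apply is_derive_Reals. generalize (derivable_pt_lim_exp 0). now rewrite exp_0. }
destruct (is_derive_eps cos 0 0 t) as [d2 [Hd2 H2]]; auto.
{ apply is_derive_Reals. generalize (derivable_pt_lim_cos 0). now rewrite sin_0, Ropp_0. }
destruct (is_derive_eps sin 0 1 t) as [d3 [Hd3 H3]]; auto.
{ apply is_derive_Reals. generalize (derivable_pt_lim_sin 0). now rewrite cos_0. }
apply nearC_iff. exists (Rmin (Rmin d1 d2) (Rmin d3 t)).
split. { repeat apply Rmin_case; auto. }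
intros w Hw. replace (w - 0)%C with w in * by ring.
assert (W1 : Cmod w < d1) by rmin.
assert (W2 : Cmod w < d2) by rmin.
assert (W3 : Cmod w < d3) by rmin.
assert (W4 : Cmod w < t) by rmin.
assert (F1 := Rabs_fst_le w). assert (F2 := Rabs_snd_le w).
destruct w as [u v]. set (r := Cmod (u, v)) in *. cbn [fst snd] in F1, F2.
specialize (H1 u ltac:(lra)). specialize (H2 v ltac:(lra)). specialize (H3 v ltac:(lra)).
rewrite Rplus_0_l in H1, H2, H3. rewrite exp_0 in H1. rewrite cos_0 in H2. rewrite sin_0 in H3.
rewrite Cexp_0. eapply Rle_trans. apply Cmod_le_abs. simpl.
set (E := exp u - 1 - 1 * u) in *. set (c := cos v - 1 - 0 * v) in *. set (s := sin v - 0 - 1 * v) in *.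
assert (Hr : 0 <= r) by apply Cmod_ge_0.
assert (S' : Rabs s <= t * r) by (eapply Rle_trans; [exact H3|apply Rmult_le_compat_l; lra]).
replace (exp u * cos v + - (1) + - (1 * u - 0 * v)) with (E * cos v + (1 + u) * c)
  by (unfold E, c; ring).
replace (exp u * sin v + - 0 + - (1 * v + 0 * u)) with ((E + u) * sin v + s)
  by (unfold E, s; ring).
assert (Q1 : Rabs (E * cos v + (1 + u) * c) <= t * r + 2 * (t * r)).
{ eapply Rle_trans. apply Rabs_triang. rewrite !Rabs_mult.
  assert (Rabs (cos v) <= 1) by (apply Rabs_le; generalize (COS_bound v); lra).
  assert (Rabs (1 + u) <= 2) by (apply Rabs_le; apply Rabs_le_between in F1; lra).
  assert (0 <= Rabs E) by apply Rabs_pos. assert (0 <= Rabs c) by apply Rabs_pos.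
  apply Rplus_le_compat; nra. }
assert (Q2 : Rabs ((E + u) * sin v + s) <= (2 * r) * (2 * r) + t * r).
{ eapply Rle_trans. apply Rabs_triang. rewrite !Rabs_mult. apply Rplus_le_compat; auto.
  apply Rmult_le_compat; try apply Rabs_pos.
  - eapply Rle_trans. apply Rabs_triang. nra.
  - replace (sin v) with (s + v) by (unfold s; ring). eapply Rle_trans. apply Rabs_triang. nra. }
assert (r * r <= t * r) by (apply Rmult_le_compat_r; lra).
assert (t * r <= e / 10 * r) by (apply Rmult_le_compat_r; lra). assert (0 <= e * r) by (apply Rmult_le_pos; lra). lra.
Qed.

Lemma cderiv_Cexp z : cderiv Cexp z (Cexp z).
Proof.
apply (cderiv_ext (fun w => Cexp z * Cexp (w - z))%C).
{ intros w. rewrite <- Cexp_plus. f_equal. ring. }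
eapply cderiv_eq. apply cderiv_scal. apply (cderiv_comp (fun w => w - z)%C Cexp).
replace (z - z)%C with (RtoC 0) by ring. apply cderiv_Cexp_0.
apply cderiv_minus. apply cderiv_id. apply cderiv_const. ring.
Qed.

Lemma cderiv_inverse f g z d : nearC z (fun w => f (g w) = w) -> ccont g z ->
  cderiv f (g z) d -> d <> RtoC 0 -> cderiv g z (/ d)%C.
Proof.
intros Hfg Hg [q [Hq [Cq <-]]] Hd.
assert (L : clim (nearC z) (fun w => q (g w)) (q (g z))) by (apply (clim_comp _ g q); auto).
assert (Nz : nearC z (fun w => q (g w) <> RtoC 0)).
{ apply (clim_near (nearC z) (fun w => q (g w)) (q (g z)) (fun y => y <> RtoC 0) L).
  now apply near_ne. }
apply (cderiv_ext_near (fun w => g z + / q (g w) * (w - z))%C).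
- assert (E0 := locally_singleton _ _ Hfg). cbv beta in E0.
  generalize Nz. generalize Hfg. apply filter_imp2; [typeclasses eauto|].
  intros w E N. rewrite <- E at 2. rewrite <- E0 at 2. rewrite (Hq (g w)). field. auto.
- exists (fun w => / q (g w))%C. split; [|split]; auto.
  intros w. ring. apply clim_inv; auto. typeclasses eauto.
Qed.

Lemma clim_real_comp {T} F {FF : Filter F} (phi : R -> R) (u : T -> R) c :
  continuity_pt phi c -> clim F (fun w => RtoC (u w)) (RtoC c) ->
  clim F (fun w => RtoC (phi (u w))) (RtoC (phi c)).
Proof.
intros Hphi Hu e He. apply continuity_pt_locally with (eps := mkposreal e He) in Hphi.
apply nearR_iff in Hphi. destruct Hphi as [d [Hd Hphi]].
generalize (Hu d Hd). apply filter_imp. intros w Hw.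
rewrite <- RtoC_minus, Cmod_R in *. now apply Hphi.
Qed.
Lemma clim_pair {T} F {FF : Filter F} (u v : T -> R) a b :
  clim F (fun w => RtoC (u w)) (RtoC a) -> clim F (fun w => RtoC (v w)) (RtoC b) ->
  clim F (fun w => (u w, v w)) (a, b).
Proof.
intros Hu Hv. apply (clim_ext F (fun w => RtoC (u w) + Ci * RtoC (v w))%C).
intros w. apply injective_projections; simpl; ring.
apply clim_eq with (RtoC a + Ci * RtoC b)%C.
apply clim_plus; auto. apply clim_mult; auto. now apply clim_const.
apply injective_projections; simpl; ring.
Qed.
Lemma clim_Re {T} F {FF : Filter F} (f : T -> C) c :
  clim F f c -> clim F (fun w => RtoC (Re (f w))) (RtoC (Re c)).
Proof.
intros H e He. generalize (H e He). apply filter_imp. intros w Hw.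
eapply Rle_lt_trans; [|exact Hw]. rewrite <- RtoC_minus, Cmod_R. apply (Rabs_fst_le (f w - c)).
Qed.
Lemma clim_Im {T} F {FF : Filter F} (f : T -> C) c :
  clim F f c -> clim F (fun w => RtoC (Im (f w))) (RtoC (Im c)).
Proof.
intros H e He. generalize (H e He). apply filter_imp. intros w Hw.
eapply Rle_lt_trans; [|exact Hw]. rewrite <- RtoC_minus, Cmod_R. apply (Rabs_snd_le (f w - c)).
Qed.
Lemma Cmod_diff a b : Rabs (Cmod a - Cmod b) <= Cmod (a - b).
Proof.
assert (T1 := Cmod_triangle (a - b) b). assert (T2 := Cmod_triangle (b - a) a).
replace (a - b + b)%C with a in T1 by ring. replace (b - a + a)%C with b in T2 by ring.
rewrite <- Copp_minus_distr, Cmod_opp in T2. apply Rabs_le. lra.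
Qed.
Lemma clim_Cmod {T} F {FF : Filter F} (f : T -> C) c :
  clim F f c -> clim F (fun w => RtoC (Cmod (f w))) (RtoC (Cmod c)).
Proof.
intros H e He. generalize (H e He). apply filter_imp. intros w Hw.
eapply Rle_lt_trans; [|exact Hw]. rewrite <- RtoC_minus, Cmod_R. apply Cmod_diff.
Qed.

(** Off the cut [(-oo, 0]]. *)
Definition slit (z : C) : Prop := 0 < Cmod z + Re z.

(** [Arg z] is twice the angle of [Cmod z + z]. *)
Definition Log (z : C) : C := (ln (Cmod z), 2 * atan (Im z / (Cmod z + Re z))).

Lemma slit_ne z : slit z -> z <> RtoC 0.
Proof. intros H ->. unfold slit in H. rewrite Cmod_0 in H. simpl in H. lra. Qed.

Lemma slit_criterion z : (Im z = 0 -> 0 < Re z) -> slit z.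
Proof.
intros H. unfold slit. destruct (Req_EM_T (Im z) 0) as [E|E].
- specialize (H E). generalize (Cmod_ge_0 z). lra.
- assert (E2 := Cmod2_alt z). assert (0 < Im z ^ 2) by (apply pow2_gt_0; auto).
  assert (P := Cmod_ge_0 z). apply Rnot_le_lt. intros L.
  assert (0 <= (- Re z - Cmod z) * (- Re z + Cmod z)) by (apply Rmult_le_pos; lra). nra.
Qed.

Lemma Cexp_Log z : slit z -> Cexp (Log z) = z.
Proof.
intros H. assert (Nz := slit_ne z H). apply Cmod_gt_0 in Nz. unfold slit in H.
assert (E2 := Cmod2_alt z). unfold Log, Cexp. cbn [Re Im fst snd].
rewrite exp_ln by auto.
set (r := Cmod z) in *. set (s := Im z / (r + Re z)).
rewrite cos_2a_cos, sin_2a.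
assert (Ec : cos (atan s) = / sqrt (1 + s²)) by (rewrite cos_atan; unfold Rdiv; ring).
assert (Es : sin (atan s) = s / sqrt (1 + s²)) by apply sin_atan.
assert (Hp : 0 < 1 + s²) by (generalize (Rle_0_sqr s); lra).
assert (Hq : 0 < sqrt (1 + s²)) by now apply sqrt_lt_R0.
assert (Hqq : sqrt (1 + s²) * sqrt (1 + s²) = 1 + s²) by (apply sqrt_sqrt; lra).
rewrite Es, Ec.
assert (Es2 : 1 + s² = 2 * r / (r + Re z)).
{ transitivity (((r + Re z) ^ 2 + Im z ^ 2) / (r + Re z) ^ 2).
  unfold s, Rsqr. field. lra.
  replace ((r + Re z) ^ 2 + Im z ^ 2) with (2 * r * (r + Re z)) by nra. field. lra. }
set (k := sqrt (1 + s²)) in *.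
apply injective_projections; simpl.
- replace (r * (2 * / k * / k - 1)) with (r * (2 / (k * k) - 1)) by (field; lra).
  rewrite Hqq, Es2. change (fst z) with (Re z). field. lra.
- replace (r * (2 * (s / k) * / k)) with (r * (2 * s / (k * k))) by (field; lra).
  rewrite Hqq, Es2. unfold s. change (snd z) with (Im z). field. lra.
Qed.

Lemma ccont_Log z : slit z -> ccont Log z.
Proof.
intros H. assert (Nz := slit_ne z H). apply Cmod_gt_0 in Nz. unfold slit in H.
assert (Ci0 := ccont_id z). unfold ccont in *.
assert (CM := clim_Cmod (nearC z) _ _ Ci0).
assert (CR := clim_Re (nearC z) _ _ Ci0). assert (CI := clim_Im (nearC z) _ _ Ci0).
apply (clim_pair (nearC z)).
- apply (clim_real_comp (nearC z) ln Cmod); auto.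
  apply derivable_continuous_pt. exists (/ Cmod z). now apply derivable_pt_lim_ln.
- apply (clim_real_comp (nearC z) (fun x => 2 * atan x) (fun w => Im w / (Cmod w + Re w))).
  apply continuity_pt_mult. now apply continuity_pt_const.
  apply derivable_continuous_pt. apply derivable_pt_atan.
  apply (clim_ext_near (nearC z) (fun w => RtoC (Im w) / (RtoC (Cmod w) + RtoC (Re w)))%C).
  + assert (K := clim_plus (nearC z) _ _ _ _ CM CR).
    assert (N : (RtoC (Cmod z) + RtoC (Re z))%C <> RtoC 0).
    { rewrite <- RtoC_plus. intros E. apply RtoC_inj in E. lra. }
    generalize (clim_near (nearC z) _ _ (fun y => y <> RtoC 0) K (near_ne _ _ N)).
    apply filter_imp. intros w Hw. rewrite RtoC_div, RtoC_plus; auto.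
    intros E. apply Hw. rewrite <- RtoC_plus. now rewrite E.
  + rewrite RtoC_div, RtoC_plus by lra.
    apply clim_div; auto. typeclasses eauto.
    rewrite <- RtoC_plus. intros E. apply RtoC_inj in E. lra.
    apply clim_plus; auto. typeclasses eauto.
Qed.

Lemma slit_near z : slit z -> nearC z slit.
Proof.
intros H. unfold slit in *.
assert (K := clim_plus (nearC z) _ _ _ _ (clim_Cmod (nearC z) _ _ (ccont_id z))
  (clim_Re (nearC z) _ _ (ccont_id z))).
generalize (K (Cmod z + Re z) H). apply filter_imp. intros w Hw.
rewrite <- !RtoC_plus, <- RtoC_minus, Cmod_R in Hw. apply Rabs_def2 in Hw. lra.
Qed.

Lemma cderiv_Log z : slit z -> cderiv Log z (/ z)%C.
Proof.
intros H. assert (Nz := slit_ne z H).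
apply (cderiv_inverse Cexp Log z z); auto.
- generalize (slit_near z H). apply filter_imp. intros w. apply Cexp_Log.
- now apply ccont_Log.
- eapply cderiv_eq. apply cderiv_Cexp. now apply Cexp_Log.
Qed.

Lemma Log_scale t z : 0 < t -> z <> RtoC 0 -> Log (RtoC t * z)%C = (RtoC (ln t) + Log z)%C.
Proof.
intros Ht Hz. apply Cmod_gt_0 in Hz. unfold Log.
rewrite Cmod_mult, Cmod_R, Rabs_right, ln_mult by lra.
apply injective_projections; simpl. ring.
replace (t * snd z + 0 * fst z) with (t * snd z) by ring.
replace (t * Cmod z + (t * fst z - 0 * snd z)) with (t * (Cmod z + fst z)) by ring.
rewrite Rplus_0_l. do 2 f_equal.
(* On the cut both quotients are divisions by zero, hence both 0, and the identity persists. *)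
destruct (Req_EM_T (Cmod z + fst z) 0) as [E|E].
unfold Im, Re; rewrite E, Rmult_0_r. unfold Rdiv. rewrite Rinv_0; ring.
unfold Im, Re. field. lra.
Qed.

(** For [w = 0], [1] and [1/2], three primitives of
    [i u / (u - 1)], [u = e^(i (theta - al))], with different cuts: below
    [al], above [al], and both.  Across one period they grow by [2 pi i w]. *)
Definition pole_log (w : R) (al th : C) : C :=
  (RtoC w * (Ci * (th - al) + Log (1 - / Cexp (Ci * (th - al)))) +
   RtoC (1 - w) * Log (1 - Cexp (Ci * (th - al))))%C.

Lemma cderiv_expi al th : cderiv (fun t => Cexp (Ci * (t - al)))%C th
  (Ci * Cexp (Ci * (th - al)))%C.
Proof.
eapply cderiv_eq. apply (cderiv_comp (fun t => Ci * (t - al))%C Cexp). apply cderiv_Cexp.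
apply cderiv_scal, cderiv_minus. apply cderiv_id. apply cderiv_const. ring.
Qed.

(** Both bracketed functions have the same derivative and their weights add up to 1; a logarithm
    with weight 0 may sit on its cut. *)
Lemma pole_log_deriv w al th : Cexp (Ci * (th - al))%C <> RtoC 1 ->
  (w <> 0 -> slit (1 - / Cexp (Ci * (th - al)))%C) ->
  (w <> 1 -> slit (1 - Cexp (Ci * (th - al)))%C) ->
  cderiv (pole_log w al) th
    (Ci * Cexp (Ci * (th - al)) / (Cexp (Ci * (th - al)) - 1))%C.
Proof.
intros Nu H0 H1.
assert (Nu' := Cminus_eq_contra _ _ Nu). assert (N0 := Cexp_ne (Ci * (th - al))%C).
assert (A : w <> 1 -> cderiv (fun t => Log (1 - Cexp (Ci * (t - al))))%C th
   (Ci * Cexp (Ci * (th - al)) / (Cexp (Ci * (th - al)) - 1))%C).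
{ intros Hw. eapply cderiv_eq.
  apply (cderiv_comp (fun t => 1 - Cexp (Ci * (t - al)))%C Log). apply cderiv_Log; auto.
  apply cderiv_minus. apply cderiv_const. apply cderiv_expi.
  set (u := Cexp (Ci * (th - al))%C) in *. field. split; auto.
  intros E. apply Nu'. replace (u - 1)%C with (- (1 - u))%C by ring. rewrite E. ring. }
assert (B : w <> 0 -> cderiv (fun t => Ci * (t - al) + Log (1 - / Cexp (Ci * (t - al))))%C th
   (Ci * Cexp (Ci * (th - al)) / (Cexp (Ci * (th - al)) - 1))%C).
{ intros Hw. eapply cderiv_eq. apply cderiv_plus.
  apply cderiv_scal, cderiv_minus. apply cderiv_id. apply cderiv_const.
  apply (cderiv_comp (fun t => 1 - / Cexp (Ci * (t - al)))%C Log). apply cderiv_Log; auto.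
  apply cderiv_minus. apply cderiv_const. apply cderiv_inv; auto. apply cderiv_expi.
  set (u := Cexp (Ci * (th - al))%C) in *.
  replace (1 - / u)%C with ((u - 1) / u)%C by (field; auto). field. auto. }
destruct (Req_EM_T w 0) as [->|W0].
{ apply (cderiv_ext (fun t => Log (1 - Cexp (Ci * (t - al))))%C).
  intros t. unfold pole_log. rewrite Rminus_0_r. ring. apply A. lra. }
destruct (Req_EM_T w 1) as [->|W1].
{ apply (cderiv_ext (fun t => Ci * (t - al) + Log (1 - / Cexp (Ci * (t - al))))%C).
  intros t. unfold pole_log. rewrite Rminus_diag. ring. apply B. lra. }
unfold pole_log. eapply cderiv_eq. apply cderiv_plus; apply cderiv_scal; auto.
rewrite RtoC_minus. ring.
Qed.

Lemma expi_coords al th : Cexp (Ci * (th - al))%C =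
  (exp (Im al - Im th) * cos (Re th - Re al), exp (Im al - Im th) * sin (Re th - Re al)).
Proof.
unfold Cexp. destruct al as [a b], th as [x y]. simpl.
replace (0 * (x + - a) - 1 * (y + - b)) with (b - y) by ring.
replace (0 * (y + - b) + 1 * (x + - a)) with (x - a) by ring. reflexivity.
Qed.

(** [1 - u] meets the cut only for real [u >= 1], where [|u| = exp (Im al - Im th)]: that is for
    [th] straight below [al], at [al] itself, or at a translate of these by the period. *)
Lemma slit_one_minus_expi al th : (cos (Re th - Re al) = 1 -> Im al < Im th) ->
  slit (1 - Cexp (Ci * (th - al)))%C.
Proof.
intros H. apply slit_criterion. rewrite expi_coords. simpl.
assert (P := exp_pos (Im al - Im th)). set (e := exp (Im al - Im th)) in *.
set (x := Re th - Re al) in *. intros E.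
assert (S0 : sin x = 0) by nra.
assert (E2 := sin2_cos2 x). unfold Rsqr in E2. rewrite S0 in E2.
assert (C1 : cos x = 1 \/ cos x = -1).
{ assert (K : (cos x - 1) * (cos x + 1) = 0) by lra.
  apply Rmult_integral in K. destruct K; [left|right]; lra. }
destruct C1 as [C1|C1]; rewrite C1.
- specialize (H C1). assert (e < 1); [|lra]. unfold e. rewrite <- exp_0. apply exp_increasing. lra.
- lra.
Qed.

Lemma slit_one_minus_inv_expi al th : (cos (Re th - Re al) = 1 -> Im th < Im al) ->
  slit (1 - / Cexp (Ci * (th - al)))%C.
Proof.
intros H. rewrite <- Cexp_opp. replace (- (Ci * (th - al)))%C with (Ci * (al - th))%C by ring.
apply slit_one_minus_expi. intros E. apply H. rewrite <- E.
replace (Re th - Re al) with (- (Re al - Re th)) by ring. apply cos_neg.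
Qed.

Lemma Cexp_period z : Cexp (z + Ci * RtoC (2 * PI))%C = Cexp z.
Proof.
rewrite Cexp_plus. replace (Cexp (Ci * RtoC (2 * PI))) with (RtoC 1). ring.
unfold Cexp. simpl. replace (0 * (2 * PI) - 1 * 0) with 0 by ring.
replace (0 * 0 + 1 * (2 * PI)) with (2 * PI) by ring.
rewrite exp_0, cos_2PI, sin_2PI. apply injective_projections; simpl; ring.
Qed.

Lemma pole_log_period w al th :
  pole_log w al (th + RtoC (2 * PI))%C = (pole_log w al th + RtoC w * (Ci * RtoC (2 * PI)))%C.
Proof.
unfold pole_log.
replace (Ci * (th + RtoC (2 * PI) - al))%C with (Ci * (th - al) + Ci * RtoC (2 * PI))%C by ring.
rewrite Cexp_period. ring.
Qed.

(** * One-sided approach to a pole on the path *)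

Lemma at_right_iff (P : R -> Prop) :
  at_right 0 P <-> exists d, 0 < d /\ forall e, 0 < e < d -> P e.
Proof.
unfold at_right, within. rewrite nearR_iff. split.
- intros [d [Hd H]]. exists d. split; auto. intros e He. apply H; [|lra].
  rewrite Rminus_0_r, Rabs_right; lra.
- intros [d [Hd H]]. exists d. split; auto. intros e He P0. apply H.
  rewrite Rminus_0_r in He. apply Rabs_def2 in He. lra.
Qed.

Lemma clim_right f q : rcont f q -> clim (at_right 0) (fun e => f (q + e)) (f q).
Proof.
intros H e He. specialize (H e He). apply nearR_iff in H. destruct H as [d [Hd H]].
apply at_right_iff. exists d. split; auto. intros t Ht. apply H.
replace (q + t - q) with t by ring. rewrite Rabs_right; lra.
Qed.
Lemma clim_left f q : rcont f q -> clim (at_right 0) (fun e => f (q - e)) (f q).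
Proof.
intros H e He. specialize (H e He). apply nearR_iff in H. destruct H as [d [Hd H]].
apply at_right_iff. exists d. split; auto. intros t Ht. apply H.
replace (q - t - q) with (- t) by ring. rewrite Rabs_Ropp, Rabs_right; lra.
Qed.

Lemma slit_Im z : Im z <> 0 -> slit z.
Proof. intros H. apply slit_criterion. tauto. Qed.

(** The jump of the symmetric primitive across a pole lying on the path
    vanishes: both logarithms scale by the same [ln e], and the directions
    [k], [- k] are exchanged. *)
Lemma pole_log_symmetric (gam : R -> C) q d : rderiv gam q d -> Re d <> 0 ->
  clim (at_right 0) (fun e => pole_log (1 / 2) (gam q) (gam (q + e)%R) -
     pole_log (1 / 2) (gam q) (gam (q - e)%R))%C (RtoC 0).
Proof.
intros Hg Hd. set (al := gam q). set (u := fun s => Cexp (Ci * (gam s - al))%C).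
assert (Cg := rderiv_rcont _ _ _ Hg).
assert (Hu : rderiv u q (Ci * d)%C).
{ eapply rderiv_eq. apply (rderiv_comp gam (fun t => Cexp (Ci * (t - al)))%C).
  apply cderiv_expi. exact Hg. fold al. replace (Ci * (al - al))%C with (RtoC 0) by ring.
  rewrite Cexp_0. ring. }
assert (Cu := rderiv_rcont _ _ _ Hu).
assert (Eu : u q = RtoC 1).
{ unfold u. fold al. replace (Ci * (al - al))%C with (RtoC 0) by ring. apply Cexp_0. }
destruct Hu as [k [Hk [Ck Ek]]]. rewrite Eu in Hk.
set (kap := (Ci * d)%C) in *.
(* A path with nonvertical tangent gives a nonreal [kap], so that [Log] is continuous at both [kap]
   and [- kap]. *)
assert (Ik : Im kap <> 0).
{ unfold kap. simpl. replace (0 * snd d + 1 * fst d) with (fst d) by ring. exact Hd. }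
assert (S1 : slit kap) by now apply slit_Im.
assert (S2 : slit (- kap)%C).
{ apply slit_Im. change (Im (- kap)%C) with (- Im kap). lra. }
assert (Nk := slit_ne _ S1).
assert (Kr := clim_right k q Ck). assert (Kl := clim_left k q Ck).
assert (Ur := clim_right u q Cu). assert (Ul := clim_left u q Cu).
assert (Gr := clim_right gam q Cg). assert (Gl := clim_left gam q Cg).
rewrite Ek in Kr, Kl. rewrite Eu in Ur, Ul. fold al in Gr, Gl.
(* The four occurrences of [ln e] have cancelled, and in the limit the four logarithms cancel in
   pairs. *)
set (lim := (RtoC (1 / 2) * (Ci * (al - al) + (Log (kap / 1) + Log (- kap) - Log kap - Log (- kap / 1))))%C).
apply clim_eq with lim.
2:{ unfold lim. replace (kap / 1)%C with kap by field. replace (- kap / 1)%C with (- kap)%C by field. ring. }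
apply (clim_ext_near (at_right 0) (fun e => RtoC (1 / 2) * (Ci * (gam (q + e)%R - gam (q - e)%R) +
  (Log (k (q + e)%R / u (q + e)%R) + Log (- k (q + e)%R) - Log (k (q - e)%R) - Log (- k (q - e)%R / u (q - e)%R))))%C).
- assert (N1 := clim_near _ _ _ _ Kr (near_ne _ _ Nk)).
  assert (N2 := clim_near _ _ _ _ Kl (near_ne _ _ Nk)).
  assert (N3 : at_right 0 (fun e => 0 < e)).
  { apply at_right_iff. exists 1. split. lra. intros; lra. }
  generalize (filter_and _ _ N1 (filter_and _ _ N2 N3)). apply filter_imp.
  intros e (E1 & E2 & E3).
  change (k (q + e)%R <> RtoC 0) in E1. change (k (q - e)%R <> RtoC 0) in E2.
  assert (Hr := Hk (q + e)%R). assert (Hl := Hk (q - e)%R).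
  replace (q + e - q) with e in Hr by ring. replace (q - e - q) with (- e) in Hl by ring.
  assert (Nur : u (q + e)%R <> RtoC 0) by apply Cexp_ne.
  assert (Nul : u (q - e)%R <> RtoC 0) by apply Cexp_ne.
  assert (NN : forall z, z <> RtoC 0 -> (- z)%C <> RtoC 0).
  { intros z Hz E. apply Hz. replace z with (- - z)%C by ring. rewrite E. ring. }
  assert (L1 : Log (1 - u (q + e)%R)%C = (RtoC (ln e) + Log (- k (q + e)%R))%C).
  { rewrite <- Log_scale; auto. f_equal. rewrite Hr. ring. }
  assert (L2 : Log (1 - / u (q + e)%R)%C = (RtoC (ln e) + Log (k (q + e)%R / u (q + e)%R))%C).
  { rewrite <- Log_scale; auto. f_equal.
    replace (1 - / u (q + e)%R)%C with ((u (q + e)%R - 1) / u (q + e)%R)%C by (field; auto).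
    replace (u (q + e)%R - 1)%C with (k (q + e)%R * RtoC e)%C by (rewrite Hr; ring). field. auto.
    intros E. apply E1. replace (k (q + e)%R) with (k (q + e)%R / u (q + e)%R * u (q + e)%R)%C by (field; auto).
    rewrite E. ring. }
  assert (L3 : Log (1 - u (q - e)%R)%C = (RtoC (ln e) + Log (k (q - e)%R))%C).
  { rewrite <- Log_scale; auto. f_equal. rewrite Hl. rewrite RtoC_opp. ring. }
  assert (L4 : Log (1 - / u (q - e)%R)%C = (RtoC (ln e) + Log (- k (q - e)%R / u (q - e)%R))%C).
  { rewrite <- Log_scale; auto. f_equal.
    replace (1 - / u (q - e)%R)%C with ((u (q - e)%R - 1) / u (q - e)%R)%C by (field; auto).
    replace (u (q - e)%R - 1)%C with (- k (q - e)%R * RtoC e)%C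
      by (rewrite Hl, RtoC_opp; ring). field. auto.
    intros E. apply (NN _ E2). replace (- k (q - e)%R)%C with (- k (q - e)%R / u (q - e)%R * u (q - e)%R)%C by (field; auto).
    rewrite E. ring. }
  unfold pole_log. fold (u (q + e)%R) (u (q - e)%R). rewrite L1, L2, L3, L4.
  replace (1 - 1 / 2) with (1 / 2) by field. ring.
- unfold lim. apply clim_mult. typeclasses eauto. apply clim_const. typeclasses eauto.
  apply clim_plus. typeclasses eauto.
  apply clim_mult. typeclasses eauto. apply clim_const. typeclasses eauto.
  apply clim_minus; auto. typeclasses eauto.
  assert (N1 : RtoC 1 <> RtoC 0) by (apply RtoC_ne; lra).
  assert (M1 : (kap / 1)%C = kap) by field. assert (M2 : (- kap / 1)%C = (- kap)%C) by field.
  apply clim_minus. typeclasses eauto.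
  apply clim_minus. typeclasses eauto.
  apply clim_plus. typeclasses eauto.
  + apply (clim_comp (at_right 0) (fun e => k (q + e)%R / u (q + e)%R)%C Log).
    apply clim_div; auto; typeclasses eauto. rewrite M1. now apply ccont_Log.
  + apply (clim_comp (at_right 0) (fun e => - k (q + e)%R)%C Log).
    apply clim_opp; auto; typeclasses eauto. now apply ccont_Log.
  + apply (clim_comp (at_right 0) (fun e => k (q - e)%R)%C Log); auto. now apply ccont_Log.
  + apply (clim_comp (at_right 0) (fun e => - k (q - e)%R / u (q - e)%R)%C Log).
    apply clim_div; auto; try typeclasses eauto. apply clim_opp; auto; typeclasses eauto.
    rewrite M2. now apply ccont_Log.
Qed.

(** * The steepest descent curve *)

Definition sinc (x : R) : R := if Req_EM_T x 0 then 1 else sin x / x.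
(** The real value of [e^(i theta) - i theta] at the point [graph x], where
    [e^(- Im theta) = 1 / sinc x]. *)
Definition phi (x : R) : R := cos x / sinc x + ln (sinc x).
Definition graph (x : R) : C := (x, ln (sinc x)).

Lemma sinc_ne x : x <> 0 -> sinc x = sin x / x.
Proof. intros H. unfold sinc. destruct (Req_EM_T x 0); tauto. Qed.
Lemma sinc_0 : sinc 0 = 1.
Proof. unfold sinc. destruct (Req_EM_T 0 0); tauto. Qed.
Lemma sinc_even x : sinc (- x) = sinc x.
Proof.
destruct (Req_EM_T x 0) as [->|H]. now rewrite Ropp_0.
rewrite !sinc_ne by lra. rewrite sin_neg. field. auto.
Qed.
Lemma sinc_pos x : - PI < x < PI -> 0 < sinc x.
Proof.
intros H. assert (K : forall y, 0 < y < PI -> 0 < sinc y).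
{ intros y Hy. rewrite sinc_ne by lra. apply Rdiv_lt_0_compat; [apply sin_gt_0|]; lra. }
destruct (Rtotal_order x 0) as [L|[->|L]].
- rewrite <- sinc_even. apply K. lra.
- rewrite sinc_0. lra.
- apply K. lra.
Qed.
Lemma phi_even x : phi (- x) = phi x.
Proof. unfold phi. now rewrite sinc_even, cos_neg. Qed.
Lemma phi_0 : phi 0 = 1.
Proof. unfold phi. rewrite sinc_0, cos_0, ln_1. field. Qed.

Lemma sinc_continuous x : continuity_pt sinc x.
Proof.
destruct (Req_EM_T x 0) as [->|H].
- apply continuity_pt_locally. intros e. rewrite sinc_0.
  destruct (is_derive_eps sin 0 1 (e / 2)) as [d [Hd K]].
  { apply is_derive_Reals. generalize (derivable_pt_lim_sin 0). now rewrite cos_0. }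
  { destruct e; simpl; lra. }
  apply nearR_iff. exists d. split; auto. intros s Hs. rewrite Rminus_0_r in Hs.
  specialize (K s Hs). rewrite Rplus_0_l, sin_0 in K.
  destruct (Req_EM_T s 0) as [->|N]. rewrite sinc_0, Rminus_diag, Rabs_R0. apply cond_pos.
  rewrite sinc_ne by auto.
  assert (P := Rabs_pos_lt s N).
  replace (sin s / s - 1) with ((sin s - 0 - 1 * s) / s) by (field; auto).
  unfold Rdiv. rewrite Rabs_mult, Rabs_inv.
  apply (Rmult_lt_reg_r (Rabs s)); auto. rewrite Rmult_assoc, Rinv_l by lra.
  rewrite Rmult_1_r. destruct e as [e He]; simpl in *. nra.
- apply (continuity_pt_ext_loc (fun y => sin y / y)).
  + apply nearR_iff. exists (Rabs x). split. now apply Rabs_pos_lt.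
    intros s Hs. rewrite sinc_ne; auto. intros ->.
    rewrite <- Rabs_Ropp in Hs. replace (- (0 - x)) with x in Hs by ring. lra.
  + apply continuity_pt_div; auto. apply derivable_continuous_pt, derivable_pt_sin.
    apply derivable_continuous_pt, derivable_pt_id.
Qed.

Lemma ln_sinc_continuous x : - PI < x < PI -> continuity_pt (fun y => ln (sinc y)) x.
Proof.
intros H. apply (continuity_pt_comp sinc ln). apply sinc_continuous.
apply derivable_continuous_pt. exists (/ sinc x). apply derivable_pt_lim_ln. now apply sinc_pos.
Qed.

Lemma phi_continuous x : - PI < x < PI -> continuity_pt phi x.
Proof.
intros H. apply continuity_pt_plus. apply continuity_pt_div.
apply derivable_continuous_pt, derivable_pt_cos. apply sinc_continuous.
generalize (sinc_pos x H); lra. now apply ln_sinc_continuous.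
Qed.

Lemma derivable_pt_lim_ext_loc f g x l :
  (exists d, 0 < d /\ forall y, Rabs (y - x) < d -> f y = g y) ->
  derivable_pt_lim f x l -> derivable_pt_lim g x l.
Proof.
intros H Hf. apply is_derive_Reals. apply is_derive_Reals in Hf.
eapply is_derive_ext_loc; [|exact Hf]. apply nearR_iff. exact H.
Qed.

Lemma derivable_pt_lim_eq f x l l' : derivable_pt_lim f x l -> l = l' -> derivable_pt_lim f x l'.
Proof. now intros H <-. Qed.

Lemma ln_sinc_deriv x : 0 < x < PI ->
  derivable_pt_lim (fun y => ln (sinc y)) x ((x * cos x - sin x) / (x * sin x)).
Proof.
intros H. assert (Sx : 0 < sin x) by (apply sin_gt_0; lra).
apply (derivable_pt_lim_ext_loc (fun y => ln (sin y / y))).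
{ exists x. split. lra. intros y Hy. rewrite sinc_ne; auto. intros ->.
  rewrite <- Rabs_Ropp, Rabs_right in Hy; lra. }
eapply derivable_pt_lim_eq.
apply (derivable_pt_lim_comp (fun y => sin y / y) ln).
apply derivable_pt_lim_div. apply derivable_pt_lim_sin. apply derivable_pt_lim_id. unfold id; lra.
apply derivable_pt_lim_ln. apply Rdiv_lt_0_compat; lra.
unfold id, Rsqr. field. lra.
Qed.

(** [sin^2 + cos^2 = 1] brings the derivative to minus a sum of even powers over a positive
    quantity, which shows its sign. *)
Lemma phi_deriv x : 0 < x < PI -> derivable_pt_lim phi x
  (- (((x - sin x * cos x) ^ 2 + sin x ^ 4) / (x * sin x ^ 2))).
Proof.
intros H. assert (Sx : 0 < sin x) by (apply sin_gt_0; lra).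
apply (derivable_pt_lim_ext_loc (fun y => cos y * y / sin y + ln (sinc y))).
{ exists x. split. lra. intros y Hy. unfold phi. f_equal. rewrite sinc_ne.
  unfold Rdiv. rewrite Rinv_mult, Rinv_inv. ring. intros ->.
  rewrite <- Rabs_Ropp, Rabs_right in Hy; lra. }
eapply derivable_pt_lim_eq.
apply derivable_pt_lim_plus.
apply (derivable_pt_lim_div (fun y => cos y * y) sin).
apply (derivable_pt_lim_mult cos id). apply derivable_pt_lim_cos. apply derivable_pt_lim_id.
apply derivable_pt_lim_sin. lra.
now apply ln_sinc_deriv.
unfold id, Rsqr. assert (E := sin2_cos2 x). unfold Rsqr in E.
set (s := sin x) in *. set (c := cos x) in *.
transitivity (- ((x ^ 2 * (s * s + c * c) - 2 * x * s * c + s * s) / (x * s ^ 2))). field; lra.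
replace ((x - s * c) ^ 2 + s ^ 4) with (x ^ 2 - 2 * x * s * c + s * s * (s * s + c * c)) by ring.
rewrite E. field. lra.
Qed.

Lemma phi_decr x y : 0 < x -> x < y -> y < PI -> phi y < phi x.
Proof.
intros Hx Hxy Hy.
destruct (MVT_cor2 phi (fun x => - (((x - sin x * cos x) ^ 2 + sin x ^ 4) / (x * sin x ^ 2))) x y Hxy)
  as [c [Hc1 Hc2]].
{ intros c Hc. apply phi_deriv. lra. }
assert (Sc : 0 < sin c) by (apply sin_gt_0; lra).
assert (0 < ((c - sin c * cos c) ^ 2 + sin c ^ 4) / (c * sin c ^ 2)).
{ apply Rdiv_lt_0_compat. assert (0 < sin c ^ 4) by now apply pow_lt.
  assert (0 <= (c - sin c * cos c) ^ 2) by apply pow2_ge_0. lra.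
  apply Rmult_lt_0_compat. lra. now apply pow_lt. }
nra.
Qed.

(** Monotonicity is known on the open interval only; continuity at 0 gives [phi (x / 2) <= 1], and
    the step from [x / 2] to [x] makes it strict. *)
Lemma phi_lt_1 x : 0 < x < PI -> phi x < 1.
Proof.
intros H. assert (K : phi (x / 2) <= 1).
{ apply Rnot_lt_le. intros L.
  assert (C0 := phi_continuous 0 ltac:(lra)).
  assert (He : 0 < phi (x / 2) - 1) by lra.
  apply continuity_pt_locally with (eps := mkposreal _ He) in C0.
  apply nearR_iff in C0. destruct C0 as [d [Hd C0]].
  set (t := Rmin (d / 2) (x / 4)).
  assert (0 < t) by (unfold t; apply Rmin_case; lra).
  assert (t <= d / 2) by apply Rmin_l. assert (t <= x / 4) by apply Rmin_r.
  specialize (C0 t). rewrite Rminus_0_r, Rabs_right in C0 by lra.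
  specialize (C0 ltac:(lra)). rewrite phi_0 in C0. simpl in C0. apply Rabs_def2 in C0.
  assert (P := phi_decr t (x / 2) ltac:(lra) ltac:(lra) ltac:(lra)). lra. }
assert (P := phi_decr (x / 2) x ltac:(lra) ltac:(lra) ltac:(lra)). lra.
Qed.

Lemma xcos_lt_sin x : 0 < x < PI -> x * cos x < sin x.
Proof.
intros H.
destruct (MVT_cor2 (fun y => id y * cos y - sin y) (fun y => - (y * sin y)) 0 x (proj1 H))
  as [c [Hc1 Hc2]].
{ intros c Hc. eapply derivable_pt_lim_eq. apply derivable_pt_lim_minus.
  apply derivable_pt_lim_mult. apply derivable_pt_lim_id. apply derivable_pt_lim_cos.
  apply derivable_pt_lim_sin. unfold id. ring. }
assert (Sc : 0 < sin c) by (apply sin_gt_0; lra). unfold id in Hc1.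
rewrite sin_0 in Hc1. assert (0 < c * sin c * x) by (repeat apply Rmult_lt_0_compat; lra). lra.
Qed.

Lemma ln_sinc_decr x y : 0 <= x -> x < y -> y < PI -> ln (sinc y) < ln (sinc x).
Proof.
assert (K : forall x y, 0 < x -> x < y -> y < PI -> ln (sinc y) < ln (sinc x)).
{ clear x y. intros x y Hx Hxy Hy.
  destruct (MVT_cor2 (fun y => ln (sinc y)) (fun x => (x * cos x - sin x) / (x * sin x)) x y Hxy)
    as [c [Hc1 Hc2]].
  { intros c Hc. apply ln_sinc_deriv. lra. }
  assert (Sc : 0 < sin c) by (apply sin_gt_0; lra).
  assert (Hc := xcos_lt_sin c ltac:(lra)).
  assert (0 < (sin c - c * cos c) / (c * sin c)).
  { apply Rdiv_lt_0_compat. lra. apply Rmult_lt_0_compat; lra. }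
  replace ((c * cos c - sin c) / (c * sin c)) with (- ((sin c - c * cos c) / (c * sin c))) in Hc1
    by (field; lra). nra. }
intros [Hx|<-] Hxy Hy. now apply K.
rewrite sinc_0, ln_1. rewrite <- ln_1. apply ln_increasing. apply sinc_pos; lra.
rewrite sinc_ne by lra. apply (Rmult_lt_reg_r y); auto. unfold Rdiv.
rewrite Rmult_assoc, Rinv_l by lra. generalize (sin_lt_x y Hxy). lra.
Qed.

Lemma phi_unbounded M : exists b, 0 < b < PI /\ phi b < M.
Proof.
(* [d <= 1] gives [cos d >= 1/2] and [PI - d > 2], so the quotient in [phi (PI - d)] exceeds
   [1 / d], hence [|M| + 1]. *)
set (d := Rmin 1 (/ (Rabs M + 1))). assert (AM := Rabs_pos M).
assert (HM : - Rabs M <= M) by (generalize (Rle_abs (- M)); rewrite Rabs_Ropp; lra).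
assert (Hd : 0 < d) by (unfold d; apply Rmin_case; [lra|apply Rinv_0_lt_compat; lra]).
assert (D1 : d <= 1) by apply Rmin_l. assert (D2 : d <= / (Rabs M + 1)) by apply Rmin_r.
assert (P3 : 3 < PI) by (generalize PI2_3_2; unfold PI2; lra).
exists (PI - d). split. lra.
assert (Sd : 0 < sin d) by (apply sin_gt_0; lra).
assert (Sd' := sin_lt_x d Hd).
assert (Cd : / 2 <= cos d).
{ replace (/ 2) with (cos (PI / 3)) by (rewrite cos_PI3; field).
  apply cos_decr_1; lra. }
assert (E : phi (PI - d) = - ((PI - d) * cos d / sin d) + ln (sinc (PI - d))).
{ unfold phi. f_equal. rewrite sinc_ne by lra.
  rewrite cos_minus, sin_minus, cos_PI, sin_PI. field. repeat split; lra. }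
assert (L : ln (sinc (PI - d)) < 0).
{ replace 0 with (ln (sinc 0)) by (rewrite sinc_0; apply ln_1). apply ln_sinc_decr; lra. }
assert (Q : Rabs M + 1 <= (PI - d) * cos d / sin d).
{ apply Rle_trans with (1 / d).
  - unfold Rdiv. rewrite Rmult_1_l. rewrite <- (Rinv_inv (Rabs M + 1)).
    apply Rinv_le_contravar; auto.
  - apply (Rmult_le_reg_r (d * sin d)). now apply Rmult_lt_0_compat.
    replace (1 / d * (d * sin d)) with (sin d) by (field; lra).
    replace ((PI - d) * cos d / sin d * (d * sin d)) with ((PI - d) * cos d * d) by (field; lra).
    assert (1 <= (PI - d) * cos d) by nra. nra. }
lra.
Qed.

Lemma phi_inverse tau : 0 < tau -> exists x, 0 < x < PI /\ phi x = 1 - tau ^ 2.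
Proof.
intros Ht. assert (T2 : 0 < tau ^ 2) by now apply pow_lt.
destruct (phi_unbounded (1 - tau ^ 2)) as [b [Hb1 Hb2]].
destruct (Ranalysis5.IVT_interv (fun x => 1 - tau ^ 2 - phi x) 0 b) as [x [Hx1 Hx2]].
- intros a Ha. apply continuity_pt_minus. now apply continuity_pt_const.
  apply phi_continuous. lra.
- lra.
- rewrite phi_0. lra.
- lra.
- exists x. split; [|lra]. split; [|lra]. destruct Hx1 as [[L|<-] _]; auto.
  rewrite phi_0 in Hx2. lra.
Qed.

Lemma phi_inj x y : 0 <= x < PI -> 0 <= y < PI -> phi x = phi y -> x = y.
Proof.
assert (K : forall x y, 0 <= x < PI -> 0 <= y < PI -> x < y -> phi y < phi x).
{ clear. intros x y [[Hx|<-] Hx'] Hy L. apply phi_decr; lra. rewrite phi_0. apply phi_lt_1. lra. }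
intros Hx Hy E. destruct (Rtotal_order x y) as [L|[L|L]]; auto;
  [specialize (K x y)|specialize (K y x)]; lra.
Qed.

Lemma exp_opp_ln y : 0 < y -> exp (- ln y) = / y.
Proof. intros H. rewrite exp_Ropp, exp_ln; auto. Qed.

Lemma graph_equation x : - PI < x < PI ->
  (Cexp (Ci * graph x) - Ci * graph x)%C = RtoC (phi x).
Proof.
intros H. assert (S := sinc_pos x H). unfold Cexp, graph, phi. simpl.
replace (0 * x - 1 * ln (sinc x)) with (- ln (sinc x)) by ring.
replace (0 * ln (sinc x) + 1 * x) with x by ring. rewrite exp_opp_ln by auto.
apply injective_projections; simpl. field. lra.
destruct (Req_EM_T x 0) as [->|N]. rewrite sin_0. ring.
rewrite sinc_ne in * by auto. field. split; auto.
intros E. rewrite E in S. unfold Rdiv in S. lra.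
Qed.

(** The imaginary part of the equation forces [e^y = sinc a], so any solution lies on the graph; the
    real part then reads [phi a = 1 - tau^2], and injectivity of [phi] makes the description in
    [curve_pos] unique. *)
Lemma curve_pos_graph tau : 0 < tau ->
  exists x, 0 < x < PI /\ phi x = 1 - tau ^ 2 /\ curve_pos tau = graph x.
Proof.
intros Ht. destruct (phi_inverse tau Ht) as [x [Hx Ex]].
exists x. repeat split; try lra. unfold curve_pos.
apply (iota_unique (V := C_CompleteNormedModule)).
- intros [a y]. simpl. intros (Ha & Hy & E).
  assert (E1 := f_equal fst E). assert (E2 := f_equal snd E). simpl in E1, E2. clear E.
  replace (0 * a - 1 * y) with (- y) in * by ring. replace (0 * y + 1 * a) with a in * by ring.
  assert (Ey : sinc a = exp y).
  { rewrite sinc_ne by lra. apply (Rmult_eq_reg_r (a * exp (- y))).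
    2:{ generalize (exp_pos (- y)). nra. }
    replace (sin a / a * (a * exp (- y))) with (exp (- y) * sin a) by (field; lra).
    replace (exp y * (a * exp (- y))) with (a * exp (y + - y)) by (rewrite exp_plus; ring).
    rewrite Rplus_opp_r, exp_0. lra. }
  assert (Ly : y = ln (sinc a)) by (rewrite Ey; symmetry; apply ln_exp).
  assert (a = x).
  { apply phi_inj; try lra. rewrite Ex. unfold phi. rewrite <- Ly, Ey.
    replace (cos a / exp y) with (exp (- y) * cos a) by (rewrite exp_Ropp; field; apply Rgt_not_eq, exp_pos).
    lra. }
  subst a. unfold graph. now rewrite <- Ly.
- split; [exact Hx|]. split.
  + simpl. rewrite <- ln_1, <- sinc_0. apply ln_sinc_decr; lra.
  + rewrite graph_equation by lra. now rewrite Ex.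
Qed.

Lemma graph_opp x : (- Cconj (graph x))%C = graph (- x).
Proof. unfold graph. rewrite sinc_even. apply injective_projections; simpl; ring. Qed.

Lemma curve_graph tau : exists x, curve tau = graph x /\ - PI < x < PI /\ phi x = 1 - tau ^ 2 /\
  (0 < tau -> 0 < x) /\ (tau < 0 -> x < 0) /\ (tau = 0 -> x = 0).
Proof.
assert (P := PI_RGT_0). unfold curve.
destruct (Rlt_dec 0 tau) as [L|L]; [|destruct (Rlt_dec tau 0) as [L'|L']].
- destruct (curve_pos_graph tau L) as [x (H1 & H2 & H3)]. exists x. repeat split; auto; lra.
- destruct (curve_pos_graph (- tau)) as [x (H1 & H2 & H3)]. lra.
  exists (- x). rewrite H3, graph_opp, phi_even, H2. repeat split; try lra.
- assert (tau = 0) by lra. subst. exists 0. unfold graph. rewrite sinc_0, ln_1, phi_0.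
  repeat split; try lra; auto; try ring.
Qed.

Lemma curve_spec tau : curve tau = graph (Re (curve tau)) /\ - PI < Re (curve tau) < PI /\
  phi (Re (curve tau)) = 1 - tau ^ 2 /\ (0 < tau -> 0 < Re (curve tau)) /\
  (tau < 0 -> Re (curve tau) < 0) /\ (tau = 0 -> Re (curve tau) = 0).
Proof. destruct (curve_graph tau) as [x [E H]]. rewrite E. now split. Qed.

Lemma curve_equation tau : (Cexp (Ci * curve tau) - Ci * curve tau)%C = RtoC (1 - tau ^ 2).
Proof.
destruct (curve_spec tau) as (E & H1 & H2 & _). rewrite <- H2. rewrite E at 1 2.
now apply graph_equation.
Qed.

Lemma curve_re_incr s t : s < t -> Re (curve s) < Re (curve t).
Proof.
intros L. destruct (curve_spec s) as (_ & A1 & A2 & A3 & A4 & A5).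
destruct (curve_spec t) as (_ & B1 & B2 & B3 & B4 & B5).
set (x := Re (curve s)) in *. set (y := Re (curve t)) in *.
destruct (Rle_dec 0 s) as [S0|S0].
- assert (0 <= x) by (destruct S0 as [S0|S0]; [left; auto|right; symmetry; auto]).
  apply Rnot_le_lt. intros [K|K]; [|rewrite K in B2].
  + assert (phi x < phi y) by (apply phi_decr; lra). nra.
  + nra.
- assert (x < 0) by (apply A4; lra).
  destruct (Rle_dec 0 t) as [T0|T0].
  + assert (0 <= y) by (destruct T0 as [T0|T0]; [left; auto|right; symmetry; auto]). lra.
  + assert (y < 0) by (apply B4; lra).
    rewrite <- phi_even in A2, B2.
    apply Rnot_le_lt. intros [K|K]; [|rewrite K in B2].
    * assert (phi (- y) < phi (- x)) by (apply phi_decr; lra). nra.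
    * nra.
Qed.

Lemma curve_re_inj s t : Re (curve s) = Re (curve t) -> s = t.
Proof.
intros E. destruct (Rtotal_order s t) as [L|[L|L]]; auto; apply curve_re_incr in L; lra.
Qed.

Lemma curve_surj x : - PI < x < PI -> exists tau, Re (curve tau) = x.
Proof.
intros Hx.
assert (K : forall x, 0 < x < PI -> exists tau, 0 < tau /\ phi x = 1 - tau ^ 2).
{ intros y Hy. exists (sqrt (1 - phi y)). assert (L := phi_lt_1 y Hy). split.
  apply sqrt_lt_R0; lra. rewrite pow2_sqrt; lra. }
destruct (Rtotal_order x 0) as [L|[->|L]].
- destruct (K (- x)) as [tau [Ht E]]. lra. exists (- tau).
  destruct (curve_spec (- tau)) as (_ & A1 & A2 & A3 & A4 & A5).
  assert (- Re (curve (- tau)) = - x); [|lra]. apply phi_inj; try lra. rewrite phi_even, A2, E. ring.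
- exists 0. now apply (curve_spec 0).
- destruct (K x) as [tau [Ht E]]. lra. exists tau.
  destruct (curve_spec tau) as (_ & A1 & A2 & A3 & A4 & A5).
  apply phi_inj; try lra.
Qed.

Lemma curve_opp tau : curve (- tau) = (- Cconj (curve tau))%C.
Proof.
destruct (curve_spec tau) as (E & A1 & A2 & A3 & A4 & A5).
destruct (curve_spec (- tau)) as (E' & B1 & B2 & B3 & B4 & B5).
rewrite E', E, graph_opp. f_equal.
destruct (Rtotal_order tau 0) as [L|[->|L]].
- specialize (A4 L). specialize (B3 ltac:(lra)). apply phi_inj; try lra.
  rewrite phi_even, A2, B2. ring.
- rewrite Ropp_0 in *. rewrite (A5 eq_refl). ring.
- specialize (A3 L). specialize (B4 ltac:(lra)).
  assert (- Re (curve (- tau)) = Re (curve tau)); [|lra]. apply phi_inj; try lra.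
  rewrite phi_even, A2, B2. ring.
Qed.

(** A strictly increasing map onto an interval is continuous: parameters with prescribed abscissae
    on either side of [x] enclose the required neighbourhood. *)
Lemma curve_re_continuous tau : continuity_pt (fun t => Re (curve t)) tau.
Proof.
apply continuity_pt_locally. intros [e He]. simpl.
destruct (curve_spec tau) as (_ & A1 & _). set (x := Re (curve tau)) in *.
destruct (curve_surj (Rmax (x - e / 2) ((x - PI) / 2))) as [t1 H1].
{ split; [|apply Rmax_lub_lt; lra].
  apply Rlt_le_trans with ((x - PI) / 2). lra. apply Rmax_r. }
destruct (curve_surj (Rmin (x + e / 2) ((x + PI) / 2))) as [t2 H2].
{ split; [apply Rmin_glb_lt; lra|].
  apply Rle_lt_trans with ((x + PI) / 2). apply Rmin_r. lra. }
assert (L1 : Re (curve t1) < x) by (rewrite H1; apply Rmax_lub_lt; lra).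
assert (L2 : x < Re (curve t2)) by (rewrite H2; apply Rmin_glb_lt; lra).
assert (M1 : x - e < Re (curve t1)).
{ rewrite H1. apply Rlt_le_trans with (x - e / 2). lra. apply Rmax_l. }
assert (M2 : Re (curve t2) < x + e).
{ rewrite H2. apply Rle_lt_trans with (x + e / 2). apply Rmin_l. lra. }
assert (T1 : t1 < tau).
{ apply Rnot_le_lt. intros [K|K]. apply curve_re_incr in K. unfold x in L1; lra.
  subst t1. unfold x in L1. lra. }
assert (T2 : tau < t2).
{ apply Rnot_le_lt. intros [K|K]. apply curve_re_incr in K. unfold x in L2; lra.
  subst t2. unfold x in L2. lra. }
apply nearR_iff. exists (Rmin (tau - t1) (t2 - tau)). split. apply Rmin_case; lra.
intros s Hs. assert (R1 := Rmin_l (tau - t1) (t2 - tau)). assert (R2 := Rmin_r (tau - t1) (t2 - tau)).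
apply Rabs_def2 in Hs.
assert (Q1 := curve_re_incr t1 s ltac:(lra)). assert (Q2 := curve_re_incr s t2 ltac:(lra)).
apply Rabs_def1; fold x; lra.
Qed.

Lemma curve_rcont tau : rcont curve tau.
Proof.
unfold rcont. apply (clim_ext (nearR tau) (fun t => graph (Re (curve t)))).
{ intros t. symmetry. apply curve_spec. }
destruct (curve_spec tau) as (E & A1 & _). rewrite E.
assert (H : clim (nearR tau) (fun t => RtoC (Re (curve t))) (RtoC (Re (curve tau)))).
{ apply (clim_real_comp (nearR tau) (fun t => Re (curve t)) (fun t => t)).
  apply curve_re_continuous. apply clim_RtoC_id. }
apply (clim_pair (nearR tau)); auto.
apply (clim_real_comp (nearR tau) (fun x => ln (sinc x)) (fun t => Re (curve t))); auto.
now apply ln_sinc_continuous.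
Qed.

(** * Derivative of the curve, including the saddle point *)

Lemma Cexp_second_order : exists E2, holo everywhere E2 /\ E2 (RtoC 0) = RtoC (1 / 2) /\
  forall w, Cexp w = (1 + w + w * w * E2 w)%C.
Proof.
destruct (holo_divide everywhere Cexp (RtoC 0) everywhere_open) as [E1 [H1 K1]].
{ intros z _. eexists. apply cderiv_Cexp. } { exact I. }
destruct (holo_divide everywhere E1 (RtoC 0) everywhere_open H1 I) as [E2 [H2 K2]].
assert (E10 : E1 (RtoC 0) = RtoC 1).
{ apply (cderiv_unique Cexp (RtoC 0)); [|apply cderiv_Cexp_0].
  exists E1. split; [|split]; auto. intros w. rewrite K1 at 1. ring.
  now apply (holo_ccont everywhere). }
assert (Ex : forall w, Cexp w = (1 + w + w * w * E2 w)%C).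
{ intros w. rewrite K1, K2, E10, Cexp_0. ring. }
exists E2. split; auto. split; auto.
(* The value 1/2 comes from [exp (2 w) = exp w ^ 2]: comparing terms of second order gives
   [4 e = 1 + 2 e] for [e = E2 0], once continuity extends the identity to [w = 0]. *)
assert (L : forall w, w <> RtoC 0 -> (4 * E2 (2 * w))%C = (1 + 2 * E2 w + w * (2 * E2 w + w * (E2 w * E2 w)))%C).
{ intros w Hw. assert (D : Cexp (w + w)%C = (Cexp w * Cexp w)%C) by apply Cexp_plus.
  rewrite !Ex in D. replace (w + w)%C with (2 * w)%C in D by ring.
  apply Cminus_eq_0.
  replace (4 * E2 (2 * w) - (1 + 2 * E2 w + w * (2 * E2 w + w * (E2 w * E2 w))))%C with
   (((1 + 2 * w + 2 * w * (2 * w) * E2 (2 * w)) - (1 + w + w * w * E2 w) * (1 + w + w * w * E2 w)) / (w * w))%C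
   by (field; auto).
  rewrite D. field. auto. }
set (h := fun t : R => (4 * E2 (2 * RtoC t) - (1 + 2 * E2 (RtoC t) +
  RtoC t * (2 * E2 (RtoC t) + RtoC t * (E2 (RtoC t) * E2 (RtoC t)))))%C).
assert (C2 : rcont (fun t => E2 (RtoC t)) 0).
{ apply (rcont_comp E2). now apply (holo_ccont everywhere). apply clim_RtoC_id. }
assert (C3 : rcont (fun t => E2 (2 * RtoC t)%C) 0).
{ apply (rcont_comp E2 (fun t => 2 * RtoC t)%C). now apply (holo_ccont everywhere).
  apply clim_mult. typeclasses eauto. apply rcont_const. apply clim_RtoC_id. }
assert (Ch : rcont h 0).
{ unfold h. apply clim_minus; [typeclasses eauto| |].
  { apply clim_mult; [typeclasses eauto|apply rcont_const|exact C3]. }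
  apply clim_plus; [typeclasses eauto| |].
  { apply clim_plus; [typeclasses eauto|apply rcont_const|].
    apply clim_mult; [typeclasses eauto|apply rcont_const|exact C2]. }
  apply clim_mult; [typeclasses eauto|apply clim_RtoC_id|].
  apply clim_plus; [typeclasses eauto| |].
  { apply clim_mult; [typeclasses eauto|apply rcont_const|exact C2]. }
  apply clim_mult; [typeclasses eauto|apply clim_RtoC_id|].
  apply clim_mult; [typeclasses eauto|exact C2|exact C2]. }
apply clim_right in Ch.
assert (Z : h 0 = RtoC 0).
{ apply (clim_unique (at_right 0) (fun e => h (0 + e))); auto.
  apply (clim_ext_near (at_right 0) (fun _ => RtoC 0)).
  - apply at_right_iff. exists 1. split. lra. intros e He. unfold h. cbv beta.
    rewrite Rplus_0_l. rewrite (L (RtoC e)). ring. intros Q. apply RtoC_inj in Q. lra.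
  - apply clim_const. typeclasses eauto. }
unfold h in Z. replace (2 * RtoC 0)%C with (RtoC 0) in Z by ring.
set (e := E2 (RtoC 0)) in *.
rewrite RtoC_div by lra.
replace e with (((4 * e - (1 + 2 * e + 0 * (2 * e + 0 * (e * e)))) + 1) / 2)%C by field.
rewrite Z. field.
Qed.

Lemma rderiv_ext_near f g z l : nearR z (fun w => f w = g w) ->
  rderiv f z l -> rderiv g z l.
Proof.
rewrite !rderiv_eps. intros H K e He. assert (E := locally_singleton _ _ H). cbv beta in E.
generalize (K e He). generalize H. apply filter_imp2; [typeclasses eauto|].
intros w -> L. now rewrite <- E.
Qed.

Lemma near_neR (z w : R) : z <> w -> nearR z (fun y => y <> w).
Proof.
intros E. apply nearR_iff. exists (Rabs (z - w)). split. apply Rabs_pos_lt; lra.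
intros y Hy ->. rewrite <- Rabs_Ropp in Hy. replace (- (w - z)) with (z - w) in Hy by ring. lra.
Qed.

Lemma expi_coords0 th : Cexp (Ci * th)%C = (exp (- Im th) * cos (Re th), exp (- Im th) * sin (Re th)).
Proof.
unfold Cexp. simpl. replace (0 * fst th - 1 * snd th) with (- Im th) by (unfold Im; ring).
replace (0 * snd th + 1 * fst th) with (Re th) by (unfold Re; ring). reflexivity.
Qed.

Lemma curve_re_0 tau : Re (curve tau) = 0 -> tau = 0.
Proof.
intros E. destruct (curve_spec tau) as (_ & _ & _ & A3 & A4 & _).
destruct (Rtotal_order tau 0) as [L|[L|L]]; auto. specialize (A4 L); lra. specialize (A3 L); lra.
Qed.

Lemma curve_0 : curve 0 = RtoC 0.
Proof.
destruct (curve_spec 0) as (E & _ & _ & _ & _ & A5). rewrite E, A5 by auto.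
unfold graph. now rewrite sinc_0, ln_1.
Qed.

Lemma sin_0_strip x : - PI < x < PI -> sin x = 0 -> x = 0.
Proof.
intros H E. destruct (Rtotal_order x 0) as [L|[L|L]]; auto; exfalso.
assert (0 < sin (- x)) by (apply sin_gt_0; lra). rewrite sin_neg in H0. lra.
assert (0 < sin x) by (apply sin_gt_0; lra). lra.
Qed.

Lemma expi_curve_ne tau : tau <> 0 -> (Cexp (Ci * curve tau) - 1)%C <> RtoC 0.
Proof.
intros Ht E. apply Ht, curve_re_0. apply sin_0_strip. apply curve_spec.
apply Cminus_eq_0 in E. rewrite expi_coords0 in E. apply (f_equal snd) in E. simpl in E.
generalize (exp_pos (- Im (curve tau))). nra.
Qed.

(** From the derivative of [e^(i theta) - i theta = 1 - tau^2]; at [0] the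
    formula degenerates to [0 / 0] and its limit is used. *)
Definition dcurve (tau : R) : C :=
  if Req_EM_T tau 0 then RtoC (sqrt 2)
  else (2 * Ci * RtoC tau / (Cexp (Ci * curve tau) - 1))%C.

Lemma cderiv_expi0 th : cderiv (fun t => Cexp (Ci * t))%C th (Ci * Cexp (Ci * th))%C.
Proof.
eapply cderiv_eq. apply (cderiv_comp (fun t => Ci * t)%C Cexp). apply cderiv_Cexp.
apply cderiv_scal, cderiv_id. ring.
Qed.

(** Implicit differentiation: the increment of [1 - tau^2] equals a difference quotient [q] times
    the increment of the curve, and away from the saddle point [q] has a nonzero limit. *)
Lemma curve_rderiv_ne tau : tau <> 0 -> rderiv curve tau (dcurve tau).
Proof.
intros Ht. assert (N := expi_curve_ne tau Ht).
assert (NG : (Ci * (Cexp (Ci * curve tau) - 1))%C <> RtoC 0).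
{ apply Cmult_neq_0; auto. apply Ci_ne. }
assert (HG : cderiv (fun t => Cexp (Ci * t) - Ci * t)%C (curve tau) (Ci * (Cexp (Ci * curve tau) - 1))%C).
{ eapply cderiv_eq. apply cderiv_minus. apply cderiv_expi0. apply cderiv_scal, cderiv_id. ring. }
destruct HG as [q [Hq [Cq Eq]]].
assert (L : clim (nearR tau) (fun s => q (curve s)) (q (curve tau))).
{ apply (clim_comp (nearR tau) curve q); auto. apply curve_rcont. }
assert (Nz : nearR tau (fun s => q (curve s) <> RtoC 0)).
{ apply (clim_near (nearR tau) _ _ (fun y => y <> RtoC 0) L). apply near_ne. now rewrite Eq. }
apply (rderiv_ext_near (fun s => curve tau + - RtoC (s + tau) / q (curve s) * RtoC (s - tau))%C).
- generalize Nz. apply filter_imp. intros s Hs. specialize (Hq (curve s)).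
  rewrite !curve_equation in Hq.
  assert (E : (q (curve s) * (curve s - curve tau))%C = (- RtoC (s + tau) * RtoC (s - tau))%C).
  { replace (q (curve s) * (curve s - curve tau))%C with
     (RtoC (1 - tau ^ 2) + q (curve s) * (curve s - curve tau) - RtoC (1 - tau ^ 2))%C by ring.
    rewrite <- Hq. rewrite <- RtoC_opp, <- RtoC_mult, <- RtoC_minus. f_equal. ring. }
  replace (- RtoC (s + tau) / q (curve s) * RtoC (s - tau))%C with
    ((- RtoC (s + tau) * RtoC (s - tau)) / q (curve s))%C by (field; auto).
  rewrite <- E. field. auto.
- exists (fun s => - RtoC (s + tau) / q (curve s))%C. split; [|split].
  + intros s. rewrite Rminus_diag. ring.
  + apply clim_div; auto. typeclasses eauto. now rewrite Eq.
    apply clim_opp. typeclasses eauto.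
    apply (clim_ext (nearR tau) (fun s => RtoC s + RtoC tau)%C). intros; now rewrite RtoC_plus.
    rewrite RtoC_plus. apply clim_plus. typeclasses eauto. apply clim_RtoC_id. apply rcont_const.
  + rewrite Eq. unfold dcurve. destruct (Req_EM_T tau 0); [tauto|].
    rewrite RtoC_plus.
    transitivity (2 * (Ci * Ci) * RtoC tau / (Ci * (Cexp (Ci * curve tau) - 1)))%C.
    * rewrite Ci_sqr. field. split; auto. apply Ci_ne.
    * field. split; auto. apply Ci_ne.
Qed.

(** At the saddle point the derivative of [e^(i theta) - i theta] vanishes; the expansion to second
    order turns the curve equation into [t^2 = theta^2 * E2 (i theta)]. *)
Lemma curve_rderiv_0_aux : exists E2, holo everywhere E2 /\ E2 (RtoC 0) = RtoC (1 / 2) /\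
  (forall t, Cexp (Ci * curve t)%C = (1 + Ci * curve t - curve t * curve t * E2 (Ci * curve t))%C) /\
  (forall t, (RtoC t * RtoC t)%C = (curve t * curve t * E2 (Ci * curve t))%C).
Proof.
destruct Cexp_second_order as [E2 [H1 [H2 H3]]]. exists E2. split; auto. split; auto.
assert (A : forall t, Cexp (Ci * curve t)%C = (1 + Ci * curve t - curve t * curve t * E2 (Ci * curve t))%C).
{ intros t. rewrite H3.
  replace (Ci * curve t * (Ci * curve t))%C with ((Ci * Ci) * (curve t * curve t))%C by ring.
  rewrite Ci_sqr. ring. }
split; auto. intros t. assert (E := curve_equation t). rewrite A in E.
rewrite RtoC_minus in E. simpl in E. rewrite Rmult_1_r, RtoC_mult in E.
replace (RtoC t * RtoC t)%C with (1 - (1 - RtoC t * RtoC t))%C by ring. rewrite <- E. ring.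
Qed.

(** The quotient [m = theta / t] satisfies [m^2 = 1 / E2 (i theta)], which tends to 2. Its real part
    is positive, so [|m + sqrt 2| >= 1], and [|m - sqrt 2|] is controlled by [|m^2 - 2|]. *)
Lemma curve_quotient : rcont (fun t => if Req_EM_T t 0 then RtoC (sqrt 2) else (curve t / RtoC t)%C) 0.
Proof.
destruct curve_rderiv_0_aux as [E2 [H1 [H2 [H3 H4]]]].
intros e He. destruct (Req_EM_T 0 0) as [_|]; [|tauto].
assert (L : clim (nearR 0) (fun t => E2 (Ci * curve t)%C) (RtoC (1 / 2))).
{ rewrite <- H2. replace (RtoC 0) with (Ci * curve 0)%C by (rewrite curve_0; ring).
  apply (clim_comp (nearR 0) (fun t => Ci * curve t)%C E2).
  apply clim_mult. typeclasses eauto. apply rcont_const. apply curve_rcont.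
  now apply (holo_ccont everywhere). }
assert (N2 : RtoC (1 / 2) <> RtoC 0) by (apply RtoC_ne; lra).
assert (L2 := clim_inv (nearR 0) _ _ N2 L).
assert (Nz := clim_near (nearR 0) _ _ _ L (near_ne _ _ N2)).
generalize (filter_and _ _ Nz (L2 e He)). apply filter_imp. intros t [Ht Hte].
assert (S2 : 1 <= sqrt 2) by (rewrite <- sqrt_1; apply sqrt_le_1_alt; lra).
destruct (Req_EM_T t 0) as [->|Nt].
{ replace (sqrt 2 - sqrt 2)%C with (RtoC 0) by ring. now rewrite Cmod_0. }
assert (Nt' : RtoC t <> RtoC 0) by (apply RtoC_ne; lra).
change (E2 (Ci * curve t)%C <> RtoC 0) in Ht.
set (m := (curve t / RtoC t)%C).
assert (Em : ((m - RtoC (sqrt 2)) * (m + RtoC (sqrt 2)))%C = (/ E2 (Ci * curve t) - / RtoC (1 / 2))%C).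
{ replace ((m - RtoC (sqrt 2)) * (m + RtoC (sqrt 2)))%C with (m * m - RtoC (sqrt 2) * RtoC (sqrt 2))%C by ring.
  rewrite <- RtoC_mult, sqrt_sqrt by lra.
  replace (/ RtoC (1 / 2))%C with (RtoC 2) by (rewrite <- RtoC_inv by lra; f_equal; field).
  f_equal. unfold m.
  replace (curve t / RtoC t * (curve t / RtoC t))%C with
    (curve t * curve t * E2 (Ci * curve t) / (RtoC t * RtoC t) * / E2 (Ci * curve t))%C by (field; auto).
  rewrite <- H4. field. auto. }
assert (Rm : 0 < Re m).
{ unfold m. replace (curve t / RtoC t)%C with (RtoC (/ t) * curve t)%C by (rewrite RtoC_inv by auto; field; auto).
  simpl. rewrite Rmult_0_l, Rminus_0_r.
  destruct (curve_spec t) as (_ & _ & _ & A3 & A4 & _). unfold Re in A3, A4.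
  destruct (Rtotal_order t 0) as [T|[T|T]]; [|lra|].
  - assert (/ t < 0) by now apply Rinv_lt_0_compat. specialize (A4 T). rewrite <- Rmult_opp_opp. apply Rmult_lt_0_compat; lra.
  - assert (0 < / t) by now apply Rinv_0_lt_compat. specialize (A3 T). now apply Rmult_lt_0_compat. }
assert (B : 1 <= Cmod (m + RtoC (sqrt 2))).
{ eapply Rle_trans; [|apply (re_le_Cmod)]. eapply Rle_trans; [|apply Rle_abs].
  change (Re (m + RtoC (sqrt 2))%C) with (Re m + sqrt 2). lra. }
rewrite <- Em, Cmod_mult in Hte. assert (0 <= Cmod (m - RtoC (sqrt 2))) by apply Cmod_ge_0. nra.
Qed.

Lemma curve_rderiv tau : rderiv curve tau (dcurve tau).
Proof.
destruct (Req_EM_T tau 0) as [->|Ht]; [|now apply curve_rderiv_ne].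
exists (fun t => if Req_EM_T t 0 then RtoC (sqrt 2) else (curve t / RtoC t)%C).
split; [|split].
- intros s. rewrite curve_0, Rminus_0_r. destruct (Req_EM_T s 0) as [->|Ns].
  rewrite curve_0. ring. field. intros E. apply RtoC_inj in E. lra.
- apply curve_quotient.
- unfold dcurve. destruct (Req_EM_T 0 0); tauto.
Qed.

Lemma dcurve_rcont tau : rcont dcurve tau.
Proof.
destruct (Req_EM_T tau 0) as [->|Ht].
- destruct curve_rderiv_0_aux as [E2 [H1 [H2 [H3 H4]]]].
  assert (Q := curve_quotient). unfold rcont in *.
  destruct (Req_EM_T 0 0) as [_|]; [|tauto].
  set (q := fun t => if Req_EM_T t 0 then RtoC (sqrt 2) else (curve t / RtoC t)%C) in *.
  assert (L : clim (nearR 0) (fun t => E2 (Ci * curve t)%C) (RtoC (1 / 2))).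
  { rewrite <- H2. replace (RtoC 0) with (Ci * curve 0)%C by (rewrite curve_0; ring).
    apply (clim_comp (nearR 0) (fun t => Ci * curve t)%C E2).
    apply clim_mult. typeclasses eauto. apply rcont_const. apply curve_rcont.
    now apply (holo_ccont everywhere). }
  assert (S2 : sqrt 2 * sqrt 2 = 2) by (apply sqrt_sqrt; lra).
  assert (S2p : 0 < sqrt 2) by (apply sqrt_lt_R0; lra).
  assert (NS : RtoC (sqrt 2) <> RtoC 0) by (apply RtoC_ne; lra).
  (* Since [e^(i theta) - 1 = i theta (1 + i theta E2)], the formula for the derivative becomes
     [2 / (q (1 + i theta E2))], which has no singularity at 0. *)
  assert (D0 : dcurve 0 = (RtoC 2 / (RtoC (sqrt 2) * (1 + Ci * curve 0 * RtoC (1 / 2))))%C).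
  { rewrite curve_0. unfold dcurve. destruct (Req_EM_T 0 0); [|tauto].
    rewrite <- S2 at 2. rewrite RtoC_mult. field. auto. }
  rewrite D0.
  apply (clim_ext_near (nearR 0) (fun t => RtoC 2 / (q t * (1 + Ci * curve t * E2 (Ci * curve t))))%C).
  + apply filter_forall. intros t. unfold q, dcurve. destruct (Req_EM_T t 0) as [->|Nt].
    * rewrite curve_0. replace (1 + Ci * 0 * E2 (Ci * 0))%C with (RtoC 1) by ring.
      rewrite <- S2 at 1. rewrite RtoC_mult. field. auto.
    * assert (Nt' : RtoC t <> RtoC 0) by (apply RtoC_ne; lra).
      assert (N := expi_curve_ne t Nt). rewrite H3 in N |- *.
      assert (Nc : curve t <> RtoC 0).
      { intros E. apply N. rewrite E. ring. }
      assert (EE : (1 + Ci * curve t - curve t * curve t * E2 (Ci * curve t) - 1)%C =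
        (Ci * curve t * (1 + Ci * curve t * E2 (Ci * curve t)))%C).
      {
        replace (Ci * curve t * (1 + Ci * curve t * E2 (Ci * curve t)))%C with
          (Ci * curve t + (Ci * Ci) * (curve t * curve t * E2 (Ci * curve t)))%C by ring.
        rewrite Ci_sqr; ring. }
      rewrite EE in N |- *.
      assert (N1 : (1 + Ci * curve t * E2 (Ci * curve t))%C <> RtoC 0).
      { intros E. apply N. rewrite E. ring. }
      field. repeat split; auto. apply Ci_ne.
  + apply clim_div; [typeclasses eauto| |apply clim_const; typeclasses eauto|].
    * apply Cmult_neq_0; auto. rewrite curve_0.
      replace (1 + Ci * 0 * RtoC (1 / 2))%C with (RtoC 1) by ring.
      intros E; apply RtoC_inj in E; lra.
    * apply clim_mult; [typeclasses eauto|exact Q|].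
      apply clim_plus; [typeclasses eauto|apply rcont_const|].
      apply clim_mult; [typeclasses eauto| |exact L].
      apply clim_mult; [typeclasses eauto|apply rcont_const|apply curve_rcont].
- unfold rcont.
  assert (N := expi_curve_ne tau Ht).
  assert (D0 : dcurve tau = (2 * Ci * RtoC tau / (Cexp (Ci * curve tau) - 1))%C).
  { unfold dcurve. destruct (Req_EM_T tau 0); tauto. }
  rewrite D0.
  apply (clim_ext_near (nearR tau) (fun t => 2 * Ci * RtoC t / (Cexp (Ci * curve t) - 1))%C).
  + generalize (near_neR tau 0 Ht). apply filter_imp. intros t Nt.
    unfold dcurve. destruct (Req_EM_T t 0); tauto.
  + apply clim_div; [typeclasses eauto|exact N| |].
    * apply clim_mult; [typeclasses eauto|apply rcont_const|apply clim_RtoC_id].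
    * apply clim_minus; [typeclasses eauto| |apply rcont_const].
      apply (clim_comp (nearR tau) curve (fun w => Cexp (Ci * w)%C)). apply curve_rcont.
      eapply cderiv_ccont. apply cderiv_expi0.
Qed.

Lemma curve'_dcurve tau : curve' tau = dcurve tau.
Proof.
assert (H := curve_rderiv tau). unfold curve'.
transitivity (fst (dcurve tau), snd (dcurve tau)); [|now destruct (dcurve tau)].
f_equal; apply is_derive_unique.
apply (rderiv_fst curve); exact H. apply (rderiv_snd curve); exact H.
Qed.

(** As [e^(i theta) - i theta] is real, [D = e^(i theta) - 1] has imaginary part [Re theta], and the
    derivative [2 i tau / D] has real part [2 tau Re theta / |D|^2], where [tau] and [Re theta]
    share their sign. Poles on the curve are thereby crossed in a nonvertical direction. *)
Lemma dcurve_re tau : 0 < Re (dcurve tau).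
Proof.
unfold dcurve. destruct (Req_EM_T tau 0) as [->|Ht].
- simpl. apply sqrt_lt_R0; lra.
- assert (N := expi_curve_ne tau Ht).
  set (D := (Cexp (Ci * curve tau) - 1)%C) in *.
  assert (ND := proj1 (Cmod_gt_0 D) N). assert (D2 := Cmod2_alt D).
  assert (ID : Im D = Re (curve tau)).
  { assert (E := curve_equation tau). apply (f_equal Im) in E.
    unfold D. rewrite expi_coords0. rewrite expi_coords0 in E. simpl in *.
    change (fst (curve tau)) with (Re (curve tau)) in E. lra. }
  assert (E : (2 * Ci * RtoC tau / D)%C = (RtoC (2 * tau / (Re D ^ 2 + Im D ^ 2)) * (Im D, Re D))%C).
  { rewrite <- D2. assert (Nm : RtoC (Cmod D ^ 2) <> RtoC 0).
    { intros Q. apply RtoC_inj in Q. assert (0 < Cmod D ^ 2) by now apply pow_lt. lra. }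
    apply Ceq_minus. apply Ceq_minus.
    replace (2 * Ci * RtoC tau / D)%C with (RtoC (2 * tau) * (Ci * Cconj D) / (D * Cconj D))%C.
    2:{ rewrite RtoC_mult. field. split; auto. intros Q. apply (f_equal Cmod) in Q.
        rewrite Cmod_conj, Cmod_0 in Q. lra. }
    rewrite <- Cmod2_conj. rewrite RtoC_div. 2:{ assert (0 < Cmod D ^ 2) by now apply pow_lt. lra. }
    replace (Ci * Cconj D)%C with (Im D, Re D). field. auto.
    apply injective_projections; simpl; unfold Re, Im; ring. }
  assert (RR : forall c z, Re (RtoC c * z)%C = c * Re z) by (intros; simpl; unfold Re; ring).
  rewrite E, RR. change (Re (Im D, Re D)) with (Im D). rewrite ID.
  destruct (curve_spec tau) as (_ & _ & _ & A3 & A4 & _).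
  assert (P : 0 < Re D ^ 2 + Re (curve tau) ^ 2).
  { rewrite <- ID, <- D2. now apply pow_lt. }
  set (K := Re D ^ 2 + Re (curve tau) ^ 2) in *.
  assert (PK : 0 < / K) by now apply Rinv_0_lt_compat.
  replace (2 * tau / K * Re (curve tau)) with (2 * / K * (tau * Re (curve tau))) by (unfold Rdiv; ring).
  apply Rmult_lt_0_compat. lra.
  destruct (Rtotal_order tau 0) as [T|[T|T]]; [|lra|].
  + specialize (A4 T). rewrite <- Rmult_opp_opp. apply Rmult_lt_0_compat; lra.
  + specialize (A3 T). now apply Rmult_lt_0_compat.
Qed.

(** * Heights along the curve *)

Lemma curve_im tau : Im (curve tau) = ln (sinc (Re (curve tau))).
Proof. destruct (curve_spec tau) as (E & _). now rewrite E at 1. Qed.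

Lemma curve_im_decr s t : 0 <= s -> s < t -> Im (curve t) < Im (curve s).
Proof.
intros Hs L. rewrite !curve_im. apply ln_sinc_decr; [|now apply curve_re_incr|apply curve_spec].
destruct (curve_spec s) as (_ & _ & _ & A3 & _ & A5). destruct Hs as [Hs|Hs].
left; auto. right; symmetry; auto.
Qed.

Lemma curve_im_unbounded M : exists T0, 0 < T0 /\ forall T, T0 <= T -> Im (curve T) < M.
Proof.
(* [sinc (PI - d) = sin d / (PI - d) < d <= exp M]. *)
set (d := Rmin 1 (exp M)).
assert (Hd : 0 < d) by (unfold d; apply Rmin_case; [lra|apply exp_pos]).
assert (D1 : d <= 1) by apply Rmin_l. assert (D2 : d <= exp M) by apply Rmin_r.
assert (P3 : 3 < PI) by (generalize PI2_3_2; unfold PI2; lra).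
destruct (curve_surj (PI - d)) as [T0 HT]. lra.
assert (T0p : 0 < T0).
{ apply Rnot_le_lt. intros [L|L].
  - destruct (curve_spec T0) as (_ & _ & _ & _ & A4 & _). specialize (A4 L). lra.
  - destruct (curve_spec T0) as (_ & _ & _ & _ & _ & A5). specialize (A5 L). lra. }
assert (B : Im (curve T0) < M).
{ rewrite curve_im, HT, sinc_ne by lra.
  replace (sin (PI - d)) with (sin d) by (rewrite sin_minus, sin_PI, cos_PI; ring).
  rewrite <- (ln_exp M). apply ln_increasing.
  apply Rdiv_lt_0_compat; [apply sin_gt_0; lra|lra].
  apply (Rmult_lt_reg_r (PI - d)). lra. unfold Rdiv. rewrite Rmult_assoc, Rinv_l, Rmult_1_r by lra.
  generalize (sin_lt_x d Hd). nra. }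
exists T0. split; auto. intros T [L|<-]; auto.
assert (Q := curve_im_decr T0 T ltac:(lra) L). lra.
Qed.

Lemma X_at_curve T : 0 < T -> X_at (Im (curve T)) = Re (curve T).
Proof.
intros HT. destruct (curve_spec T) as (_ & A1 & _ & A3 & _). specialize (A3 HT).
assert (S := sinc_pos _ A1).
unfold X_at. apply (iota_unique (V := R_CompleteNormedModule)).
- intros y [Hy E]. rewrite curve_im, exp_ln in E by auto.
  rewrite <- sinc_ne in E by lra.
  destruct (Rtotal_order y (Re (curve T))) as [L|[L|L]]; auto.
  + apply ln_sinc_decr in L; try lra. rewrite E in L. lra.
  + apply ln_sinc_decr in L; try lra. rewrite E in L. lra.
- split. lra. rewrite curve_im, exp_ln by auto. rewrite sinc_ne; lra.
Qed.

Lemma on_curve_iff w : on_curve w <-> - PI < Re w < PI /\ Im w = ln (sinc (Re w)).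
Proof.
unfold on_curve. unfold sinc. destruct (Req_EM_T (Re w) 0); [rewrite ln_1|]; reflexivity.
Qed.

Lemma psi_eq w : Re w <> PI -> psi w = Finite (Im w - ln (sinc (Re w))).
Proof.
intros H. unfold psi, sinc. destruct (Req_EM_T (Re w) PI); [tauto|].
destruct (Req_EM_T (Re w) 0); auto. rewrite ln_1, Rminus_0_r. reflexivity.
Qed.

(** * Principal values *)

Notation poleR h q := (is_pole (U := R_UniformSpace) h q).

Lemma is_PV_eps h a b l : is_PV h a b l <-> forall e, 0 < e -> exists d, 0 < d /\
  forall eps, 0 < eps < d -> exists I, rint (excise h eps) a b I /\ Cmod (I - l) < e.
Proof.
unfold is_PV, filterlimi, filtermapi, filter_le. split.
- intros H e He. specialize (H (fun y => Cmod (y - l) < e)).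
  apply at_right_iff. apply H. apply nearC_iff. exists e. split; auto.
- intros H P HP. apply nearC_iff in HP. destruct HP as [e [He HP]].
  apply at_right_iff. destruct (H e He) as [d [Hd K]]. exists d. split; auto.
  intros eps Heps. destruct (K eps Heps) as [I [H1 H2]]. exists I. split; auto.
Qed.

Lemma PV_chasles h a c b l m : is_PV h a c l -> is_PV h c b m -> is_PV h a b (l + m)%C.
Proof.
rewrite !is_PV_eps. intros H1 H2 e He.
destruct (H1 (e / 2) ltac:(lra)) as [d1 [D1 K1]].
destruct (H2 (e / 2) ltac:(lra)) as [d2 [D2 K2]].
exists (Rmin d1 d2). split. apply Rmin_case; auto.
intros eps He'. assert (Rmin d1 d2 <= d1) by apply Rmin_l. assert (Rmin d1 d2 <= d2) by apply Rmin_r.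
destruct (K1 eps ltac:(lra)) as [I1 [A1 B1]]. destruct (K2 eps ltac:(lra)) as [I2 [A2 B2]].
exists (I1 + I2)%C. split. eapply rint_chasles; eauto.
replace (I1 + I2 - (l + m))%C with ((I1 - l) + (I2 - m))%C by ring.
eapply Rle_lt_trans. apply Cmod_triangle. lra.
Qed.

Lemma excise_far h eps t : (forall q, poleR h q -> eps <= Rabs (t - q)) -> excise h eps t = h t.
Proof.
intros H. unfold excise. destruct (excluded_middle_informative _) as [[q [Hq L]]|]; auto.
specialize (H q Hq). lra.
Qed.

(** A pole slightly outside [[s, t]] would still remove a piece near the end of the interval; the
    margin [d] prevents this for small [eps]. *)
Lemma PV_regular h W s t d : s <= t -> 0 < d ->
  (forall q, poleR h q -> ~ (s - d < q < t + d)) ->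
  (forall x, s <= x <= t -> rderiv W x (h x) /\ rcont h x) ->
  is_PV h s t (W t - W s)%C.
Proof.
intros Hst Hd Hp HW. apply is_PV_eps. intros e He. exists d. split; auto.
intros eps Heps. exists (W t - W s)%C. split.
- apply (rint_ext h).
  + intros x Hx. rewrite Rmin_left, Rmax_right in Hx by lra. symmetry. apply excise_far.
    intros q Hq. specialize (Hp q Hq). apply Rnot_lt_le. intros L. apply Hp.
    apply Rabs_def2 in L. lra.
  + apply rint_FTC; intros x Hx; rewrite Rmin_left, Rmax_right in Hx by lra; now apply HW.
- replace (W t - W s - (W t - W s))%C with (RtoC 0) by ring. rewrite Cmod_0. lra.
Qed.

(** After removal of [(q - eps, q + eps)] the integral differs from [W t - W s] by the symmetric
    jump of [W] alone. *)
Lemma PV_pole h W s q t d : s < q < t -> 0 < d -> poleR h q ->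
  (forall p, poleR h p -> s - d < p < t + d -> p = q) ->
  (forall x, s <= x <= t -> x <> q -> rderiv W x (h x) /\ rcont h x) ->
  clim (at_right 0) (fun e => W (q + e)%R - W (q - e)%R)%C (RtoC 0) ->
  is_PV h s t (W t - W s)%C.
Proof.
intros Hst Hd Hq Hp HW Hj. apply is_PV_eps. intros e He.
specialize (Hj e He). apply at_right_iff in Hj. destruct Hj as [d' [Hd' Hj]].
exists (Rmin (Rmin d d') (Rmin (q - s) (t - q))). split. { repeat apply Rmin_case; lra. }
intros eps Heps.
assert (E1 : eps < d) by rmin.
assert (E2 : eps < d') by rmin.
assert (E3 : eps < q - s) by rmin.
assert (E4 : eps < t - q) by rmin.
assert (Far : forall x, s <= x <= t -> eps <= Rabs (x - q) -> excise h eps x = h x).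
{ intros x Hx Hxq. apply excise_far. intros p Pp. destruct (Req_EM_T p q) as [->|N]; auto.
  apply Rnot_lt_le. intros L. apply N. apply Hp; auto. apply Rabs_def2 in L. lra. }
exists ((W (q - eps)%R - W s) + (RtoC (q + eps - (q - eps)) * RtoC 0) + (W t - W (q + eps)%R))%C. split.
- apply rint_chasles with (q + eps). apply rint_chasles with (q - eps).
  + apply (rint_ext h).
    * intros x Hx. rewrite Rmin_left, Rmax_right in Hx by lra. symmetry. apply Far. lra.
      rewrite Rabs_left; lra.
    * apply rint_FTC; intros x Hx; rewrite Rmin_left, Rmax_right in Hx by lra; apply HW; lra.
  + apply (rint_ext (fun _ => RtoC 0)). 2: apply rint_const.
    intros x Hx. rewrite Rmin_left, Rmax_right in Hx by lra. unfold excise.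
    destruct (excluded_middle_informative _) as [_|N]; auto.
    exfalso. apply N. exists q. split; auto. apply Rabs_def1; lra.
  + apply (rint_ext h).
    * intros x Hx. rewrite Rmin_left, Rmax_right in Hx by lra. symmetry. apply Far. lra.
      rewrite Rabs_right; lra.
    * apply rint_FTC; intros x Hx; rewrite Rmin_left, Rmax_right in Hx by lra; apply HW; lra.
- specialize (Hj eps ltac:(lra)). rewrite <- Cmod_opp.
  match goal with |- Cmod ?z < _ => replace z with (W (q + eps)%R - W (q - eps)%R - 0)%C by ring end.
  exact Hj.
Qed.

Definition regular_at (h W : R -> C) (x : R) : Prop :=
  ~ poleR h x /\ rderiv W x (h x) /\ rcont h x.

(** Principal values are additive, and any two nearby non-poles enclose at
    most one pole, so the supremum argument below passes from local to global. *)
Lemma PV_global h W a b : a < b -> ~ poleR h a -> ~ poleR h b ->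
  (forall p, a <= p <= b -> exists d, 0 < d /\
     (forall x, Rabs (x - p) < d -> x <> p -> regular_at h W x) /\
     (regular_at h W p \/
      (poleR h p /\ clim (at_right 0) (fun e => W (p + e)%R - W (p - e)%R)%C (RtoC 0)))) ->
  is_PV h a b (W b - W a)%C.
Proof.
intros Hab Na Nb H.
assert (Loc : forall p, a <= p <= b -> exists d, 0 < d /\
  (forall x, Rabs (x - p) < d -> x <> p -> ~ poleR h x) /\
  forall s t, p - d < s -> s <= t -> t < p + d -> ~ poleR h s -> ~ poleR h t ->
    is_PV h s t (W t - W s)%C).
{ intros p Hp. destruct (H p Hp) as [d [Hd [H1 H2]]]. exists (d / 2). split. lra. split.
  { intros x Hx Nx. apply H1; auto. lra. }
  intros s t Hs Hst Ht Ns Nt.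
  assert (R1 : forall x, s - d / 2 < x < t + d / 2 -> x <> p -> regular_at h W x).
  { intros x Hx Nx. apply H1; auto. apply Rabs_def1; lra. }
  destruct H2 as [H2|[H2 H3]].
  - assert (R2 : forall x, s - d / 2 < x < t + d / 2 -> regular_at h W x).
    { intros x Hx. destruct (Req_EM_T x p) as [->|N]; auto. }
    apply (PV_regular h W s t (d / 2)); auto. lra.
    intros q Hq Hq'. now apply (R2 q Hq'). intros x Hx. apply R2. lra.
  - assert (s <> p) by congruence. assert (t <> p) by congruence.
    destruct (Rlt_dec p s) as [L|L]; [|destruct (Rlt_dec t p) as [L'|L']].
    + assert (R2 : forall x, s - Rmin (s - p) (d / 2) < x < t + Rmin (s - p) (d / 2) -> regular_at h W x).
      { assert (M1 := Rmin_l (s - p) (d / 2)). assert (M2 := Rmin_r (s - p) (d / 2)).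
        intros x Hx. apply R1; lra. }
      assert (0 < Rmin (s - p) (d / 2)) by (apply Rmin_case; lra).
      apply (PV_regular h W s t (Rmin (s - p) (d / 2))); auto.
      intros q Hq Hq'. now apply (R2 q Hq'). intros x Hx. apply R2. lra.
    + assert (R2 : forall x, s - Rmin (p - t) (d / 2) < x < t + Rmin (p - t) (d / 2) -> regular_at h W x).
      { assert (M1 := Rmin_l (p - t) (d / 2)). assert (M2 := Rmin_r (p - t) (d / 2)).
        intros x Hx. apply R1; lra. }
      assert (0 < Rmin (p - t) (d / 2)) by (apply Rmin_case; lra).
      apply (PV_regular h W s t (Rmin (p - t) (d / 2))); auto.
      intros q Hq Hq'. now apply (R2 q Hq'). intros x Hx. apply R2. lra.
    + apply (PV_pole h W s p t (d / 2)); auto; try lra.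
      * intros q Hq Hq'. destruct (Req_EM_T q p) as [|N]; auto. exfalso.
        now apply (R1 q Hq').
      * intros x Hx Nx. apply R1; auto. lra. }
(* The non-poles reached by the formula. Its supremum [c] need not belong to it and may be a pole;
   around [c] the local statement goes from a point of [S] before [c] to a non-pole after it. *)
set (S := fun t => a <= t <= b /\ ~ poleR h t /\ is_PV h a t (W t - W a)%C).
assert (Sa : S a).
{ split; [lra|]. split; auto. destruct (Loc a) as [d [Hd [_ L]]]. lra. apply L; auto; lra. }
destruct (completeness S) as [c [Hc1 Hc2]].
{ exists b. intros t [Ht _]. lra. } { now exists a. }
assert (Hac : a <= c) by now apply Hc1.
assert (Hcb : c <= b) by (apply Hc2; intros t [Ht _]; lra).
destruct (Loc c (conj Hac Hcb)) as [d [Hd [L1 L2]]].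
assert (Ex : exists s, S s /\ c - d < s).
{ apply NNPP. intros N. assert (c <= c - d); [|lra]. apply Hc2. intros s Hs.
  apply Rnot_lt_le. intros L. apply N. now exists s. }
destruct Ex as [s [[Hs [Ns Ps]] Hsd]].
assert (Hsc : s <= c) by (apply Hc1; split; auto).
assert (Ext : forall t, c <= t <= b -> t < c + d -> ~ poleR h t -> S t).
{ intros t Ht Htd Nt. split; [lra|]. split; auto.
  replace (W t - W a)%C with ((W s - W a) + (W t - W s))%C by ring.
  apply PV_chasles with s; auto. apply L2; auto; lra. }
destruct Hcb as [Hcb|Hcb].
- exfalso. set (t := Rmin b (c + d / 2)).
  assert (M1 : t <= b) by apply Rmin_l. assert (M2 : t <= c + d / 2) by apply Rmin_r.
  assert (M3 : c < t) by (unfold t; apply Rmin_case; lra).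
  assert (Nt : ~ poleR h t) by (apply L1; [apply Rabs_def1|]; lra).
  assert (K := Hc1 t (Ext t ltac:(lra) ltac:(lra) Nt)). lra.
- subst c. apply (Ext b); auto; lra.
Qed.

(** * The Appell kernel in the variable z = exp (i theta) / x *)

Lemma lprod_partition (p : C -> bool) l z :
  lprod l z = (lprod (filter p l) z * lprod (filter (fun a => negb (p a)) l) z)%C.
Proof.
induction l as [|a l IH]; simpl. ring. destruct (p a); simpl; rewrite IH; ring.
Qed.

Lemma box_Cmod s z : box (RtoC 0) s z -> Cmod z <= 2 * s.
Proof.
intros [H1 H2]. eapply Rle_trans. apply Cmod_le_abs. simpl in *. rewrite Rminus_0_r in *. lra.
Qed.

(** The square lies in the disc of radius [2 * s]; the factors of zeros in the disc but outside the
    square are moved into [h]. *)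
Lemma factor_box g s : 0 < s -> holo everywhere g -> g (RtoC 0) <> RtoC 0 ->
  exists l h, (forall a, In a l <-> box (RtoC 0) s a /\ g a = RtoC 0) /\ holo everywhere h /\
    (forall z, g z = (lprod l z * h z)%C) /\ (forall z, box (RtoC 0) s z -> h z <> RtoC 0).
Proof.
intros Hs Hg Hg0.
destruct (factor_zeros g (2 * s) ltac:(lra) Hg Hg0) as [l [h [H1 [H2 [H3 H4]]]]].
set (p := fun a => if excluded_middle_informative (box (RtoC 0) s a) then true else false).
assert (Hp : forall a, p a = true <-> box (RtoC 0) s a).
{ intros a. unfold p. destruct (excluded_middle_informative _); split; auto; congruence. }
exists (filter p l), (fun z => lprod (filter (fun a => negb (p a)) l) z * h z)%C.
split; [|split; [|split]].
- intros a. rewrite filter_In, Hp, H1. split; [tauto|]. intros [B Ha]. split; auto. split; auto.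
  now apply box_Cmod.
- apply holo_mult; auto. apply holo_lprod.
- intros z. rewrite H3, (lprod_partition p). ring.
- intros z Bz. apply Cmult_neq_0.
  + intros E. apply lprod_0, filter_In in E. destruct E as [_ E]. apply Hp in Bz.
    rewrite Bz in E. discriminate.
  + apply H4. now apply box_Cmod.
Qed.

(** Its residue at [0] is [p_n (n x) / n!]. *)
Definition appell_kernel (g : C -> C) (n : nat) (x z : C) : C :=
  (Cexp (z * (RtoC (INR n) * x)) / (g z * z ^ S n))%C.

(** Partial fraction data on one square: [c] gives the coefficients of the simple fractions, with
    [c 0] for the pole at 0, [P] is a primitive of the rest, and [l], [h] factor [g] so that
    multiplicities can be read off. *)
Definition decomposition (g : C -> C) (n : nat) (x : C) (s : R)
    (l : list C) (c : C -> C) (P : C -> C) (h : C -> C) : Prop :=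
  (forall a, In a l <-> box (RtoC 0) s a /\ g a = RtoC 0) /\
  (forall z, box (RtoC 0) s z -> z <> RtoC 0 -> g z <> RtoC 0 ->
    cderiv P z (appell_kernel g n x z - c (RtoC 0) / z
      - lsum (fun a => c a / (z - a)) (nodup Ceq_dec l))%C) /\
  (forall z, box (RtoC 0) s z -> z <> RtoC 0 -> (count_occ Ceq_dec l z <= 1)%nat -> ccont P z) /\
  holo everywhere h /\ (forall z, g z = (lprod l z * h z)%C) /\
  (forall z, box (RtoC 0) s z -> h z <> RtoC 0).

Lemma nodup_repeat (a : C) n l : ~ In a l ->
  nodup Ceq_dec (repeat a (S n) ++ l) = a :: nodup Ceq_dec l.
Proof.
intros Ha.
assert (K : forall l', In a l' -> nodup Ceq_dec (a :: l') = nodup Ceq_dec l').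
{ intros l' I. simpl. destruct (in_dec Ceq_dec a l'); tauto. }
induction n as [|n IH].
- simpl. destruct (in_dec Ceq_dec a l); tauto.
- change (repeat a (S (S n)) ++ l) with (a :: (repeat a (S n) ++ l)).
  rewrite K; auto. simpl. now left.
Qed.
Lemma lprod_repeat n l z : lprod (repeat (RtoC 0) n ++ l) z = (z ^ n * lprod l z)%C.
Proof. induction n as [|n IH]; simpl. ring. rewrite IH. ring. Qed.
Lemma count_repeat_ne (a z : C) n l : z <> a ->
  count_occ Ceq_dec (repeat a n ++ l) z = count_occ Ceq_dec l z.
Proof.
intros H. induction n as [|n IH]; simpl; auto. destruct (Ceq_dec a z); congruence.
Qed.

Lemma decomposition_exists g n x s : 0 < s -> holo everywhere g -> g (RtoC 0) <> RtoC 0 ->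
  exists l c P h, decomposition g n x s l c P h.
Proof.
intros Hs Hg Hg0. destruct (factor_box g s Hs Hg Hg0) as [l [h [H1 [H2 [H3 H4]]]]].
assert (Hn0 : ~ In (RtoC 0) l).
{ intros I. apply H1 in I. tauto. }
(* The point 0 listed [n + 1] times stands for the factor [z ^ (n + 1)] of the denominator. *)
destruct (partial_fractions (RtoC 0) s Hs (repeat (RtoC 0) (S n) ++ l)) with
  (H := fun z => (Cexp (z * (RtoC (INR n) * x)) / h z)%C) as [c [P [K1 K2]]].
{ intros a Ha. apply in_app_or in Ha. destruct Ha as [Ha|Ha].
  - apply repeat_spec in Ha. subst. now apply box_center.
  - now apply H1. }
{ apply holo_div; auto.
  - intros z _. eexists. apply (cderiv_comp (fun z => z * (RtoC (INR n) * x))%C Cexp).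
    apply cderiv_Cexp. apply cderiv_mult. apply cderiv_id. apply cderiv_const.
  - intros z _. now apply H2. }
exists l, c, P, h. split; [exact H1|]. split; [|split; [|auto]].
- intros z Bz Nz Gz. eapply cderiv_eq. apply K1; auto.
  + intros I. apply in_app_or in I. destruct I as [I|I].
    apply repeat_spec in I. auto. apply H1 in I. tauto.
  + rewrite nodup_repeat by auto. rewrite lprod_repeat. simpl lsum.
    replace (z - 0)%C with z by ring. unfold appell_kernel.
    assert (Pz : lprod l z <> RtoC 0).
    { intros E. apply Gz. rewrite H3, E. ring. }
    assert (Zn : (z ^ S n)%C <> RtoC 0) by now apply Cpow_nz.
    rewrite H3.
    replace (Cexp (z * (INR n * x)) / h z / (z ^ S n * lprod l z))%C with
      (Cexp (z * (INR n * x)) / (lprod l z * h z * z ^ S n))%C by (field; auto).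
    ring.
- intros z Bz Nz Hc. apply K2; auto. now rewrite count_repeat_ne.
Qed.

Lemma holo_lsum D (f : C -> C -> C) l : (forall a, In a l -> holo D (f a)) ->
  holo D (fun z => lsum (fun a => f a z) l).
Proof.
induction l as [|a l IH]; intros H; simpl. apply holo_const.
intros z Hz. destruct (H a (or_introl eq_refl) z Hz) as [d Hd].
destruct (IH (fun b Hb => H b (or_intror Hb)) z Hz) as [e He].
eexists. apply cderiv_plus; eauto.
Qed.

Lemma ccont_ne_near f z : ccont f z -> f z <> RtoC 0 -> nearC z (fun w => f w <> RtoC 0).
Proof.
intros Hf N. apply (clim_near (nearC z) f (f z) (fun y => y <> RtoC 0) Hf). now apply near_ne.
Qed.

Lemma holo_Cexp_lin D k : holo D (fun z => Cexp (z * k))%C.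
Proof.
intros z _. eexists. apply (cderiv_comp (fun z => z * k)%C Cexp).
apply cderiv_Cexp. apply cderiv_mult. apply cderiv_id. apply cderiv_const.
Qed.
Lemma holo_id D : holo D (fun z => z).
Proof. intros z _. eexists. apply cderiv_id. Qed.
Lemma holo_pow D n : holo D (fun z => z ^ n)%C.
Proof.
induction n as [|n IH]; simpl. apply holo_const. apply holo_mult; auto. apply holo_id.
Qed.

(** Two readings of the residue of the kernel at 0: the generating series gives a Laurent
    coefficient, and the decomposition gives [c 0] because all its other terms have primitives near
    0. *)
Lemma appell_coefficient g n x s l c P h p : 0 < s -> holo everywhere g -> g (RtoC 0) <> RtoC 0 ->
  is_appell g p -> decomposition g n x s l c P h ->
  c (RtoC 0) = (rescaled p n x / RtoC (INR (fact n)))%C.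
Proof.
intros Hs Hg Hg0 Hp (D1 & D2 & D3 & D4 & D5 & D6).
assert (Ng : nearC (RtoC 0) (fun z => g z <> RtoC 0)).
{ apply ccont_ne_near; auto. now apply (holo_ccont everywhere). }
destruct (near_box _ _ Ng) as [s1 [Hs1 B1]].
set (s2 := Rmin s s1). assert (Hs2 : 0 < s2) by (unfold s2; apply Rmin_case; auto).
assert (S1 : s2 <= s) by apply Rmin_l. assert (S2 : s2 <= s1) by apply Rmin_r.
assert (Bg : forall z, box (RtoC 0) s2 z -> g z <> RtoC 0).
{ intros z [Z1 Z2]. apply B1. split; lra. }
assert (Bs : forall z, box (RtoC 0) s2 z -> box (RtoC 0) s z).
{ intros z [Z1 Z2]. split; lra. }
assert (HR : holo (box (RtoC 0) s2) (fun z => lsum (fun a => c a / (z - a))%C (nodup Ceq_dec l))).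
{ apply (holo_lsum _ (fun a z => c a / (z - a))%C). intros a Ha. apply holo_div.
  - intros z Bz E. apply Cminus_eq_0 in E. subst z. apply nodup_In, D1 in Ha.
    apply (Bg a Bz). tauto.
  - apply holo_const.
  - apply holo_minus. apply holo_id. apply holo_const. }
destruct (holo_primitive (RtoC 0) s2 _ Hs2 HR) as [Q HQ].
symmetry. apply (residue_eq (appell_kernel g n x) (RtoC 0) _ _ (fun z => P z + Q z)%C s2); auto.
- destruct (Hp (RtoC (INR n) * x)%C) as [r [Hr Hps]].
  (* Multiplied by [w ^ (n + 1)], the kernel is the generating function at the point [n x]; the
     residue is its coefficient of index [n]. *)
  exists n, (fun j => p j (RtoC (INR n) * x) / RtoC (INR (fact j)))%C, (Rmin r s2).
  split. apply Rmin_case; auto. split; [|reflexivity].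
  intros w Hw. replace (w - 0)%C with w in * by ring.
  assert (M1 := Rmin_l r s2). assert (M2 := Rmin_r r s2).
  assert (Nw : w <> RtoC 0) by (apply Cmod_gt_0; lra).
  assert (Gw : g w <> RtoC 0).
  { apply Bg. apply box_disc. replace (w - 0)%C with w by ring. lra. }
  replace (w ^ S n * appell_kernel g n x w)%C with (Cexp (w * (RtoC (INR n) * x)) / g w)%C.
  apply Hps. lra. unfold appell_kernel.
  assert (Zn : (w ^ S n)%C <> RtoC 0) by now apply Cpow_nz. field. auto.
- intros w Bw Nw. apply (holo_div (fun w => box (RtoC 0) s2 w /\ w <> RtoC 0)
    (fun z => Cexp (z * (RtoC (INR n) * x))) (fun z => g z * z ^ S n))%C; auto.
  + intros z [Bz Nz]. apply Cmult_neq_0; auto. now apply Cpow_nz.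
  + apply holo_Cexp_lin.
  + apply holo_mult. intros z _. now apply Hg. apply holo_pow.
- intros w Bw Nw. eapply cderiv_eq. apply cderiv_plus. apply D2; auto. apply HQ; auto.
  replace (w - 0)%C with w by ring. ring.
Qed.

(** * Residues of F in the variable theta *)

Definition exp_over (x w : C) : C := (Cexp (Ci * w) / x)%C.

Lemma exp_over_ne x w : x <> RtoC 0 -> exp_over x w <> RtoC 0.
Proof.
intros Hx E. apply (Cexp_ne (Ci * w)%C). unfold exp_over in E.
replace (Cexp (Ci * w)) with (Cexp (Ci * w) / x * x)%C by (field; auto). rewrite E. ring.
Qed.
Lemma cderiv_exp_over x w : x <> RtoC 0 -> cderiv (exp_over x) w (Ci * exp_over x w)%C.
Proof.
intros Hx. unfold exp_over. eapply cderiv_eq. apply cderiv_div; auto. apply cderiv_expi0.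
apply cderiv_const. cbv beta; field; auto.
Qed.
Lemma exp_over_shift x al w : x <> RtoC 0 ->
  exp_over x w = (exp_over x al * Cexp (Ci * (w - al)))%C.
Proof.
intros Hx. unfold exp_over.
replace (Cexp (Ci * w)) with (Cexp (Ci * al) * Cexp (Ci * (w - al)))%C.
field. auto. rewrite <- Cexp_plus. f_equal. ring.
Qed.

(** [n] being an integer, [e^(- i n theta) = (x z)^(- n)] is single-valued in [z]; the factor [z] in
    front comes from [dz = i z d theta]. *)
Lemma F_theta_kernel g n x w : x <> RtoC 0 -> g (exp_over x w) <> RtoC 0 ->
  F_theta g n x w = (exp_over x w * appell_kernel g n x (exp_over x w) / x ^ n)%C.
Proof.
intros Hx Hg. unfold F_theta, g_theta, appell_kernel. fold (exp_over x w).
set (z := exp_over x w) in *. assert (Nz : z <> RtoC 0) by now apply exp_over_ne.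
assert (Ez : Cexp (Ci * w)%C = (z * x)%C) by (unfold z, exp_over; field; auto).
replace (RtoC (INR n) * (Cexp (Ci * w) - Ci * w))%C
  with (z * (RtoC (INR n) * x) + - (RtoC (INR n) * (Ci * w)))%C by (rewrite Ez; ring).
rewrite Cexp_plus, Cexp_opp, Cexp_mult_nat, Ez, Cpow_mult_l.
assert (Zn : (z ^ n)%C <> RtoC 0) by now apply Cpow_nz.
assert (Xn : (x ^ n)%C <> RtoC 0) by now apply Cpow_nz.
cbn [Cpow]. field. auto.
Qed.

Lemma F_theta_deriv g n x : x <> RtoC 0 -> holo everywhere g ->
  holo (fun w => g (exp_over x w) <> RtoC 0) (F_theta g n x).
Proof.
intros Hx Hg. apply (holo_div _ (fun w => Cexp (RtoC (INR n) * (Cexp (Ci * w) - Ci * w)))%C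
  (fun w => g (exp_over x w))); auto.
- intros w _. eexists.
  apply (cderiv_comp (fun w => RtoC (INR n) * (Cexp (Ci * w) - Ci * w))%C Cexp).
  apply cderiv_Cexp. apply cderiv_scal, cderiv_minus. apply cderiv_expi0.
  apply cderiv_scal, cderiv_id.
- intros w _. destruct (Hg (exp_over x w) I) as [d Hd]. eexists.
  apply (cderiv_comp (exp_over x) g). exact Hd. now apply cderiv_exp_over.
Qed.

Lemma lsum_remove (f : C -> C) a l : NoDup l -> In a l ->
  lsum f l = (f a + lsum f (remove Ceq_dec a l))%C.
Proof.
induction l as [|b l IH]; intros Nd I. destruct I.
inversion Nd; subst. simpl. destruct (Ceq_dec a b) as [->|E].
- rewrite notin_remove; auto.
- destruct I as [->|I]; [congruence|]. simpl. rewrite IH; auto. ring.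
Qed.

Lemma lsum_scal k f l : lsum (fun a => k * f a)%C l = (k * lsum f l)%C.
Proof. induction l as [|a l IH]; simpl. ring. rewrite IH. ring. Qed.

(** The function is the logarithmic derivative of [e^(i (w - al)) - 1], which has a simple zero at
    [al]; hence the residue is 1 and the difference is regular. *)
Lemma exp_kernel_residue_part al : exists R s, 0 < s /\
  (forall w, box al s w -> w <> al -> Cexp (Ci * (w - al))%C <> RtoC 1) /\
  forall w, box al s w -> w <> al -> cderiv R w
    (Ci * Cexp (Ci * (w - al)) / (Cexp (Ci * (w - al)) - 1) - 1 / (w - al))%C.
Proof.
assert (H0 : holo everywhere (fun w => Cexp (Ci * (w - al)))%C).
{ intros w _. eexists. apply cderiv_expi. }
destruct (holo_divide everywhere _ al everywhere_open H0 I) as [E [HE KE]].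
assert (E1 : Cexp (Ci * (al - al))%C = RtoC 1).
{ replace (Ci * (al - al))%C with (RtoC 0) by ring. apply Cexp_0. }
rewrite E1 in KE.
assert (Eal : E al = Ci).
{ apply (cderiv_unique (fun w => Cexp (Ci * (w - al)))%C al).
  - exists E. split; [|split]; auto. intros w. rewrite E1, KE. ring.
    now apply (holo_ccont everywhere).
  - eapply cderiv_eq. apply cderiv_expi. rewrite E1. ring. }
assert (NE : nearC al (fun w => E w <> RtoC 0)).
{ apply ccont_ne_near. now apply (holo_ccont everywhere). rewrite Eal. apply Ci_ne. }
destruct (near_box _ _ NE) as [s [Hs Bs]].
assert (HQ : holo (box al s) (fun w => Ci * Cexp (Ci * (w - al)) / E w)%C).
{ apply holo_div; auto. apply holo_mult. apply holo_const. intros w _; now apply H0.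
  intros w _; now apply HE. }
destruct (holo_divide _ _ al (box_near al s) HQ (box_center al s Hs)) as [q [Hq Kq]].
destruct (holo_primitive al s q Hs Hq) as [R HR].
assert (Nu : forall w, box al s w -> w <> al -> (Cexp (Ci * (w - al)) - 1)%C <> RtoC 0).
{ intros w Bw Nw. rewrite KE. replace (1 + (w - al) * E w - 1)%C with ((w - al) * E w)%C by ring.
  apply Cmult_neq_0; auto. now apply Cminus_eq_contra. }
exists R, s. split; auto. split.
- intros w Bw Nw E'. apply (Nu w Bw Nw). rewrite E'. ring.
- intros w Bw Nw. eapply cderiv_eq. apply HR; auto.
  assert (Kw := Kq w). cbv beta in Kw. rewrite E1, Eal in Kw.
  assert (Dw := Cminus_eq_contra _ _ Nw).
  assert (Nuw := Nu w Bw Nw). assert (NEw := Bs w Bw).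
  assert (X : (Cexp (Ci * (w - al)) - 1)%C = ((w - al) * E w)%C) by (rewrite KE; ring).
  rewrite X. replace (q w) with ((Ci * Cexp (Ci * (w - al)) / E w - Ci * 1 / Ci) / (w - al))%C.
  field. repeat split; auto. apply Ci_ne. rewrite Kw. field. split; auto. apply Ci_ne.
Qed.

(** [Res] is a description operator, so both uniqueness and existence are needed. A primitive of [F]
    minus the simple fraction determines the value; clearing the zero of [g] at [a] produces a
    Laurent expansion. *)
Lemma residue_F g n x s l c P h al a : x <> RtoC 0 -> holo everywhere g ->
  decomposition g n x s l c P h -> In a l -> exp_over x al = a ->
  Res (F_theta g n x) al = (c a / (Ci * x ^ n))%C.
Proof.
intros Hx Hg D Ha Eal. destruct D as (D1 & D2 & D3 & D4 & D5 & D6).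
assert (Ba := proj1 (proj1 (D1 a) Ha)).
assert (Na : a <> RtoC 0) by (rewrite <- Eal; now apply exp_over_ne).
assert (Cz : ccont (exp_over x) al) by (eapply cderiv_ccont; now apply cderiv_exp_over).
assert (HZ : holo everywhere (exp_over x)).
{ intros w _. eexists. now apply cderiv_exp_over. }
assert (Xn : (x ^ n)%C <> RtoC 0) by now apply Cpow_nz.
set (rest := filter (fun b => if Ceq_dec b a then false else true) l).
assert (NB : nearC al (fun w => box (RtoC 0) s (exp_over x w))).
{ apply (clim_near (nearC al) (exp_over x) (exp_over x al)); auto. rewrite Eal. now apply box_near. }
assert (NR : nearC al (fun w => lprod rest (exp_over x w) <> RtoC 0)).
{ apply ccont_ne_near. apply (clim_comp _ (exp_over x) (lprod rest)); auto.
  apply (holo_ccont everywhere); [apply holo_lprod|exact I].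
  rewrite Eal. intros E. apply lprod_0, filter_In in E. destruct (Ceq_dec a a); destruct E; congruence. }
(* [exp_over x w - a = (w - al) * E w] with [E al = i a] nonzero: multiplicities in [z] and in
   [theta] coincide. *)
destruct (holo_divide everywhere _ al everywhere_open HZ I) as [E [HE KE]].
assert (Eal2 : E al = (Ci * a)%C).
{ apply (cderiv_unique (exp_over x) al).
  - exists E. split; [|split]; auto. intros w. rewrite KE at 1. ring.
    now apply (holo_ccont everywhere).
  - eapply cderiv_eq. now apply cderiv_exp_over. now rewrite Eal. }
assert (NE : nearC al (fun w => E w <> RtoC 0)).
{ apply ccont_ne_near. now apply (holo_ccont everywhere). rewrite Eal2.
  apply Cmult_neq_0; auto. apply Ci_ne. }
destruct (near_box _ _ (filter_and _ _ NB (filter_and _ _ NR NE))) as [s1 [Hs1 B1]].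
destruct (exp_kernel_residue_part al) as [R1 [s2 [Hs2 [Nu HR1]]]].
set (s3 := Rmin s1 s2). assert (Hs3 : 0 < s3) by (unfold s3; apply Rmin_case; auto).
assert (S1 : s3 <= s1) by apply Rmin_l. assert (S2 : s3 <= s2) by apply Rmin_r.
assert (B3 : forall w, box al s3 w -> box (RtoC 0) s (exp_over x w) /\
  lprod rest (exp_over x w) <> RtoC 0 /\ E w <> RtoC 0).
{ intros w [W1 W2]. apply B1. split; lra. }
assert (B32 : forall w, box al s3 w -> box al s2 w) by (intros w [W1 W2]; split; lra).
assert (Nra : forall w, box al s3 w -> w <> al -> g (exp_over x w) <> RtoC 0).
{ intros w Bw Nw G. destruct (B3 w Bw) as (Q1 & Q2 & Q3). rewrite D5 in G.
  revert G. apply Cmult_neq_0; [|now apply D6]. rewrite (lprod_split a).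
  apply Cmult_neq_0; auto. apply Cpow_nz. rewrite KE, Eal.
  replace (a + (w - al) * E w - a)%C with ((w - al) * E w)%C by ring.
  apply Cmult_neq_0; auto. now apply Cminus_eq_contra. }
assert (Val : forall k, is_residue (F_theta g n x) al k -> k = (c a / (Ci * x ^ n))%C).
{ assert (HT : holo (box al s3) (fun w => lsum (fun b => c b * (Ci * exp_over x w / (exp_over x w - b)))%C
     (remove Ceq_dec a (nodup Ceq_dec l)))).
  { apply (holo_lsum _ (fun b w => c b * (Ci * exp_over x w / (exp_over x w - b)))%C).
    intros b Hb. apply in_remove in Hb. destruct Hb as [Hb Nb]. apply nodup_In in Hb.
    apply holo_mult. apply holo_const. apply holo_div.
    - intros w Bw G. apply Cminus_eq_0 in G. destruct (B3 w Bw) as (Q1 & Q2 & Q3). apply Q2.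
      apply lprod_0. rewrite G. apply filter_In. split; auto. destruct (Ceq_dec b a); congruence.
    - apply holo_mult. apply holo_const. intros w _; now apply HZ.
    - apply holo_minus. intros w _; now apply HZ. apply holo_const. }
  destruct (holo_primitive al s3 _ Hs3 HT) as [R2 HR2].
  intros k Hk.
  apply (residue_eq _ al k _ (fun w => / (Ci * x ^ n) * (P (exp_over x w) + Ci * c (RtoC 0) * w
     + c a * R1 w + R2 w))%C s3 Hs3 Hk).
  - intros w Bw Nw. apply F_theta_deriv; auto.
  - intros w Bw Nw. destruct (B3 w Bw) as (Q1 & Q2 & Q3). assert (Gw := Nra w Bw Nw).
    assert (Nz := exp_over_ne x w Hx).
    eapply cderiv_eq. apply cderiv_scal. apply cderiv_plus. apply cderiv_plus. apply cderiv_plus.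
    apply (cderiv_comp (exp_over x) P). apply D2; auto. now apply cderiv_exp_over.
    apply cderiv_scal, cderiv_id. apply cderiv_scal, HR1; auto. apply HR2; auto.
    rewrite F_theta_kernel by auto.
    assert (Nd := NoDup_nodup Ceq_dec l).
    assert (Ia : In a (nodup Ceq_dec l)) by now apply nodup_In.
    rewrite (lsum_remove _ a (nodup Ceq_dec l) Nd Ia).
    rewrite (lsum_ext (fun b => c b * (Ci * exp_over x w / (exp_over x w - b)))%C
      (fun b => (Ci * exp_over x w) * (c b / (exp_over x w - b)))%C).
    2:{ intros b _. unfold Cdiv. ring. }
    rewrite lsum_scal. set (T := lsum _ (remove Ceq_dec a (nodup Ceq_dec l))).
    assert (Dw := Cminus_eq_contra _ _ Nw).
    assert (Nuw := Cminus_eq_contra _ _ (Nu w (B32 w Bw) Nw)).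
    rewrite (exp_over_shift x al w Hx) in *. rewrite Eal in *.
    set (u := Cexp (Ci * (w - al))%C) in *.
    assert (Nu0 : u <> RtoC 0) by apply Cexp_ne.
    set (K := appell_kernel g n x (a * u)%C).
    replace (a * u - a)%C with (a * (u - 1))%C by ring.
    field. repeat split; auto. apply Ci_ne. }
unfold Res. apply (iota_unique (V := C_CompleteNormedModule)); auto.
assert (Ex : exists k, is_residue (F_theta g n x) al k).
(* The multiplicity [m + 1] of [a] is the pole order of [F] at [al]: after multiplication by
   [(w - al) ^ (m + 1)], the powers of [w - al] cancel and the remaining denominator has no zero
   nearby. *)
{ assert (Hm := proj1 (count_occ_In Ceq_dec l a) Ha).
  remember (count_occ Ceq_dec l a) as M eqn:EM. destruct M as [|m]; [lia|].
  assert (HB : holo (box al s3) (fun w => Cexp (RtoC (INR n) * (Cexp (Ci * w) - Ci * w)) /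
    (E w ^ S m * (lprod rest (exp_over x w) * h (exp_over x w))))%C).
  { apply holo_div.
    - intros w Bw. destruct (B3 w Bw) as (Q1 & Q2 & Q3).
      apply Cmult_neq_0. now apply Cpow_nz. apply Cmult_neq_0; auto.
    - intros w _. eexists.
      apply (cderiv_comp (fun w => RtoC (INR n) * (Cexp (Ci * w) - Ci * w))%C Cexp).
      apply cderiv_Cexp. apply cderiv_scal, cderiv_minus. apply cderiv_expi0.
      apply cderiv_scal, cderiv_id.
    - apply holo_mult.
      + intros w _. destruct (HE w I) as [d Hd]. eexists.
        apply (cderiv_comp E (fun y => y ^ S m)%C). apply cderiv_pow. exact Hd.
      + apply holo_mult.
        * intros w _. destruct (cderiv_lprod rest (exp_over x w)) as [d Hd]. eexists.
          apply (cderiv_comp (exp_over x) (lprod rest)). exact Hd. now apply cderiv_exp_over.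
        * intros w _. destruct (D4 (exp_over x w) I) as [d Hd]. eexists.
          apply (cderiv_comp (exp_over x) h). exact Hd. now apply cderiv_exp_over. }
  destruct (holo_pseries _ al s3 Hs3 HB) as [b [r [Hr Hb]]].
  exists (b m), m, b, (Rmin r s3). split. apply Rmin_case; auto. split; auto.
  intros w Hw. assert (M1 := Rmin_l r s3). assert (M2 := Rmin_r r s3).
  assert (Bw : box al s3 w) by (apply box_disc; lra).
  assert (Dw : (w - al)%C <> RtoC 0) by (apply Cmod_gt_0; lra).
  specialize (Hb w ltac:(lra)).
  destruct (B3 w Bw) as (Q1 & Q2 & Q3).
  match type of Hb with pser _ _ ?v => replace ((w - al) ^ S m * F_theta g n x w)%C with v; auto end.
  unfold F_theta, g_theta. fold (exp_over x w). rewrite (D5 (exp_over x w)), (lprod_split a l).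
  rewrite <- EM. fold rest.
  replace (exp_over x w - a)%C with ((w - al) * E w)%C by (rewrite KE, Eal; ring).
  rewrite Cpow_mult_l.
  assert (Em : (E w ^ S m)%C <> RtoC 0) by now apply Cpow_nz.
  assert (Dm : ((w - al) ^ S m)%C <> RtoC 0) by now apply Cpow_nz.
  assert (Hh := D6 _ Q1). field. repeat split; auto. }
destruct Ex as [k Hk]. now rewrite <- (Val k Hk).
Qed.

(** * Logarithms of the zeros in the fundamental strip *)

Lemma Arg_spec w : w <> RtoC 0 -> - PI < Arg w <= PI /\
  Re w = Cmod w * cos (Arg w) /\ Im w = Cmod w * sin (Arg w).
Proof.
intros Nw. apply Cmod_gt_0 in Nw. assert (E2 := Cmod2_alt w).
set (r := Cmod w) in *. set (q := Re w / r).
assert (Eq : Re w = r * q) by (unfold q; field; lra).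
assert (Q2 : q ^ 2 <= 1).
{ apply (Rmult_le_reg_l (r ^ 2)). now apply pow_lt. rewrite <- Rpow_mult_distr, <- Eq, E2.
  generalize (pow2_ge_0 (Im w)). lra. }
assert (Q : -1 <= q <= 1) by nra.
assert (B := acos_bound q). assert (Cq := cos_acos q Q). assert (Sq := sin_acos q Q).
assert (S1 : r * sin (acos q) = Rabs (Im w)).
{ assert (0 <= sin (acos q)) by (apply sin_ge_0; lra).
  rewrite <- (Rabs_right (r * sin (acos q))) by (apply Rle_ge, Rmult_le_pos; lra).
  apply Rsqr_eq_abs_0. rewrite Rsqr_mult, Sq.
  rewrite Rsqr_sqrt by (unfold Rsqr; lra). unfold Rsqr. 
  replace (r * r * (1 - q * q)) with (r ^ 2 - (r * q) ^ 2) by ring. rewrite <- Eq, E2. ring. }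
unfold Arg. fold r q. destruct (Rle_dec 0 (Im w)) as [L|L].
- rewrite Rabs_right in S1 by lra. rewrite Cq. generalize PI_RGT_0. lra.
- rewrite Rabs_left in S1 by lra. rewrite cos_neg, sin_neg, Cq. repeat split; try lra.
  destruct B as [_ [B|B]]; [lra|]. rewrite B, sin_PI in S1. lra.
Qed.

Lemma theta_pt_strip x z : x <> RtoC 0 -> z <> RtoC 0 -> - PI < Re (theta_pt x z) <= PI.
Proof. intros Hx Hz. apply Arg_spec. now apply Cmult_neq_0. Qed.

Lemma exp_over_theta_pt x z : x <> RtoC 0 -> z <> RtoC 0 -> exp_over x (theta_pt x z) = z.
Proof.
intros Hx Hz. assert (N : (x * z)%C <> RtoC 0) by now apply Cmult_neq_0.
destruct (Arg_spec _ N) as (_ & A1 & A2).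
assert (E : Cexp (Ci * theta_pt x z)%C = (x * z)%C).
{ rewrite expi_coords0. unfold theta_pt. cbn [Re Im fst snd]. rewrite Ropp_involutive.
  apply Cmod_gt_0 in N. rewrite exp_ln by auto.
  apply injective_projections; cbn [fst snd]; symmetry; [exact A1|exact A2]. }
unfold exp_over. rewrite E. field. auto.
Qed.

Lemma cos_1_small d : - (2 * PI) < d < 2 * PI -> cos d = 1 -> d = 0.
Proof.
intros Hd E. replace d with (2 * (d / 2)) in E by field. rewrite cos_2a_sin in E.
assert (d / 2 = 0); [|lra]. apply sin_0_strip. lra. nra.
Qed.

Lemma Cmod_exp_over x w : x <> RtoC 0 -> Cmod (exp_over x w) = exp (- Im w) / Cmod x.
Proof.
intros Hx. unfold exp_over. rewrite Cmod_div, Cmod_Cexp by auto. f_equal. f_equal.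
simpl. unfold Im. ring.
Qed.

Lemma exp_over_inj x v w : x <> RtoC 0 -> - PI < Re v <= PI -> - PI < Re w <= PI ->
  exp_over x v = exp_over x w -> v = w.
Proof.
intros Hx Hv Hw E.
assert (E' : Cexp (Ci * (v - w))%C = RtoC 1).
{ rewrite (exp_over_shift x w v Hx) in E. assert (N := exp_over_ne x w Hx).
  replace (Cexp (Ci * (v - w))) with (exp_over x w * Cexp (Ci * (v - w)) / exp_over x w)%C by (field; auto).
  rewrite E. field. auto. }
rewrite expi_coords in E'.
assert (M := f_equal Cmod E).
rewrite !Cmod_exp_over in M by auto. apply Cmod_gt_0 in Hx.
assert (M2 : exp (- Im v) = exp (- Im w)).
{ apply (Rmult_eq_reg_r (/ Cmod x)). exact M. apply Rinv_neq_0_compat. lra. }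
apply exp_inv in M2. assert (Ei : Im v = Im w) by lra.
apply (f_equal fst) in E'. simpl in E'. rewrite Ei, Rminus_diag, exp_0 in E'.
assert (D : Re v - Re w = 0) by (apply cos_1_small; lra).
apply injective_projections; [unfold Re in D; lra|exact Ei].
Qed.

Lemma theta_pt_exp_over x w : x <> RtoC 0 -> - PI < Re w <= PI -> theta_pt x (exp_over x w) = w.
Proof.
intros Hx Hw. assert (N := exp_over_ne x w Hx).
apply (exp_over_inj x); auto. now apply theta_pt_strip. now apply exp_over_theta_pt.
Qed.

Lemma theta_pt_Im x z : Im (theta_pt x z) = - ln (Cmod (x * z)).
Proof. reflexivity. Qed.

(** Poles below the truncation level [Y] are discarded. *)
Definition weight (Y : R) (al : C) : R := if Rle_dec Y (Im al) then Theta (psi al) else 0.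

(** The cut conditions under which [pole_log w al] can be differentiated at [th]. *)
Definition admissible (w : R) (al th : C) : Prop :=
  (w <> 0 -> slit (1 - / Cexp (Ci * (th - al)))%C) /\
  (w <> 1 -> slit (1 - Cexp (Ci * (th - al)))%C).

Lemma curve_im_ge T tau : Rabs tau <= T -> Im (curve T) <= Im (curve tau).
Proof.
assert (Ev : Im (curve tau) = Im (curve (Rabs tau))).
{ unfold Rabs. destruct (Rcase_abs tau); auto. rewrite curve_opp. simpl. unfold Im. ring. }
rewrite Ev. intros [L|L]; [|rewrite L; lra].
left. apply curve_im_decr; auto. apply Rabs_pos.
Qed.

Lemma Theta_ne_0 al : Re al <> PI -> Theta (psi al) <> 0 -> ln (sinc (Re al)) <= Im al.
Proof.
intros H. rewrite psi_eq by auto. simpl.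
destruct (Rlt_dec 0 (Im al - ln (sinc (Re al)))); [lra|].
destruct (Rlt_dec (Im al - ln (sinc (Re al))) 0); lra.
Qed.
Lemma Theta_ne_1 al : Theta (psi al) <> 1 -> Re al <> PI /\ Im al <= ln (sinc (Re al)).
Proof.
intros H. destruct (Req_EM_T (Re al) PI) as [E|E].
- exfalso. apply H. unfold psi. destruct (Req_EM_T (Re al) PI); [reflexivity|tauto].
- split; auto. rewrite psi_eq in H by auto. simpl in H.
  destruct (Rlt_dec 0 (Im al - ln (sinc (Re al)))); [lra|lra].
Qed.

(** Only a curve point straight above or below [al] matters. Nonzero weight puts [al] on or above
    the curve, weight other than 1 puts it on or below the curve or under the cutting level;
    [al <> curve tau] makes each comparison strict, so the curve avoids every cut in use. *)
Lemma admissible_curve Y T2 tau al : Im (curve T2) <= Y -> Rabs tau <= T2 ->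
  - PI < Re al <= PI -> (Im al < Y -> Im al < Im (curve T2)) -> al <> curve tau ->
  admissible (weight Y al) al (curve tau).
Proof.
intros HY Ht Hal Hgap Ne. destruct (curve_spec tau) as (_ & X1 & _).
assert (Cos : cos (Re (curve tau) - Re al) = 1 -> Re al = Re (curve tau)).
{ intros E. apply cos_1_small in E; lra. }
assert (NIm : Re al = Re (curve tau) -> Im al <> Im (curve tau)).
{ intros E1 E2. apply Ne. now apply injective_projections. }
assert (Ge := curve_im_ge T2 tau Ht).
unfold weight. split; intros Hw.
- apply slit_one_minus_inv_expi. intros E. specialize (Cos E).
  destruct (Rle_dec Y (Im al)) as [L|L]; [|lra].
  apply Theta_ne_0 in Hw; [|lra]. rewrite Cos, <- curve_im in Hw. specialize (NIm Cos). lra.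
- apply slit_one_minus_expi. intros E. specialize (Cos E). specialize (NIm Cos).
  destruct (Rle_dec Y (Im al)) as [L|L].
  + apply Theta_ne_1 in Hw. destruct Hw as [_ Hw]. rewrite Cos, <- curve_im in Hw. lra.
  + assert (Im al < Im (curve T2)) by (apply Hgap; lra). lra.
Qed.

Lemma ln_sinc_Rabs y : ln (sinc (Rabs y)) = ln (sinc y).
Proof. unfold Rabs. destruct (Rcase_abs y); auto. now rewrite sinc_even. Qed.

(** Over the abscissae of the segments the curve is no higher than [Im (curve T1) < Y], so a pole
    there at level [Y] or higher is above the curve and has weight 1; the poles below [Y] have
    weight 0 and lie under the segment. *)
Lemma admissible_segment Y T1 t al : 0 < T1 -> Im (curve T1) < Y ->
  Re (curve T1) <= Rabs t <= PI ->
  - PI < Re al <= PI -> (Im al < Y -> Im al < Im (curve T1)) ->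
  admissible (weight Y al) al (t, Im (curve T1)).
Proof.
intros HT HY Ht Hal Hgap. unfold weight. split; intros Hw.
- apply slit_one_minus_inv_expi. intros _. destruct (Rle_dec Y (Im al)) as [L|L]; [|lra].
  simpl. change (snd (t, Im (curve T1))) with (Im (curve T1)). lra.
- apply slit_one_minus_expi. cbn [Re Im fst snd]. intros E.
  destruct (Rle_dec Y (Im al)) as [L|L].
  2:{ apply Hgap. lra. }
  exfalso. apply Theta_ne_1 in Hw. destruct Hw as [N Hw].
  (* At [t = - PI] the difference could be [- 2 PI]; [N] rules this out. *)
  assert (t - Re al = 0).
  { apply cos_1_small; auto. assert (B := Rabs_le_between t PI). lra. }
  assert (Et : Re al = t) by lra. rewrite Et in *.
  rewrite <- ln_sinc_Rabs in Hw. rewrite curve_im in HY.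
  destruct (curve_spec T1) as (_ & _ & _ & A3 & _). specialize (A3 HT).
  assert (Rabs t < PI).
  { destruct Ht as [_ [Ht|Ht]]; auto. exfalso.
    unfold Rabs in Ht. destruct (Rcase_abs t); lra. }
  destruct Ht as [[Ht|Ht] _].
  + assert (Q := ln_sinc_decr (Re (curve T1)) (Rabs t)). lra.
  + rewrite Ht in HY. lra.
Qed.

(** Since [dz / z = i d theta], the fraction at 0 contributes a term linear in [w]. *)
Definition primitive_F (n : nat) (x : C) (l : list C) (c P : C -> C) (wt : C -> R) (w : C) : C :=
  (/ (Ci * x ^ n) * (P (exp_over x w) + Ci * c (RtoC 0) * w +
    lsum (fun a => c a * pole_log (wt (theta_pt x a)) (theta_pt x a) w) (nodup Ceq_dec l)))%C.

Lemma cderiv_lsum (f df : C -> C -> C) w l : (forall a, In a l -> cderiv (f a) w (df a w)) ->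
  cderiv (fun v => lsum (fun a => f a v) l) w (lsum (fun a => df a w) l).
Proof.
induction l as [|a l IH]; intros H; simpl. apply cderiv_const.
apply cderiv_plus. apply H; now left. apply IH. intros; apply H; now right.
Qed.

Lemma primitive_F_deriv g n x s l c P h wt w : x <> RtoC 0 -> g (RtoC 0) <> RtoC 0 ->
  decomposition g n x s l c P h ->
  box (RtoC 0) s (exp_over x w) -> g (exp_over x w) <> RtoC 0 ->
  (forall a, In a l -> admissible (wt (theta_pt x a)) (theta_pt x a) w) ->
  cderiv (primitive_F n x l c P wt) w (F_theta g n x w).
Proof.
intros Hx Hg0 (D1 & D2 & D3 & D4 & D5 & D6) Bw Gw Adm.
assert (Nz := exp_over_ne x w Hx).
assert (Xn : (x ^ n)%C <> RtoC 0) by now apply Cpow_nz.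
assert (Sh : forall a, In a l -> a <> RtoC 0 /\
   exp_over x w = (a * Cexp (Ci * (w - theta_pt x a)))%C).
{ intros a Ha. assert (Na : a <> RtoC 0) by (intros ->; apply D1 in Ha; tauto).
  split; auto. rewrite (exp_over_shift x (theta_pt x a) w Hx). now rewrite exp_over_theta_pt. }
assert (Nu : forall a, In a l -> Cexp (Ci * (w - theta_pt x a))%C <> RtoC 1).
{ intros a Ha E. destruct (Sh a Ha) as [Na Ea]. apply Gw. rewrite Ea, E.
  replace (a * 1)%C with a by ring. now apply D1. }
unfold primitive_F. eapply cderiv_eq.
- apply cderiv_scal. apply cderiv_plus. apply cderiv_plus.
  apply (cderiv_comp (exp_over x) P). apply D2; auto. now apply cderiv_exp_over.
  apply cderiv_scal, cderiv_id.
  apply (cderiv_lsum (fun a w => c a * pole_log (wt (theta_pt x a)) (theta_pt x a) w)%C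
    (fun a w => c a * (Ci * Cexp (Ci * (w - theta_pt x a)) / (Cexp (Ci * (w - theta_pt x a)) - 1)))%C).
  intros a Ha. apply nodup_In in Ha. apply cderiv_scal.
  apply pole_log_deriv; auto; now apply Adm.
- rewrite F_theta_kernel by auto.
  rewrite (lsum_ext (fun a => c a * (Ci * Cexp (Ci * (w - theta_pt x a)) / (Cexp (Ci * (w - theta_pt x a)) - 1)))%C
    (fun a => (Ci * exp_over x w) * (c a / (exp_over x w - a)))%C).
  2:{ intros a Ha. apply nodup_In in Ha. destruct (Sh a Ha) as [Na Ea].
      assert (N1 := Cminus_eq_contra _ _ (Nu a Ha)). rewrite Ea.
      set (u := Cexp (Ci * (w - theta_pt x a))%C) in *.
      replace (a * u - a)%C with (a * (u - 1))%C by ring. field. auto. }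
  rewrite lsum_scal. set (T := lsum _ _). field. repeat split; auto. apply Ci_ne.
Qed.

(** * Poles of the integrand along the curve *)

Lemma not_pole_cont_R (h : R -> C) t : rcont h t -> ~ poleR h t.
Proof.
intros Hc Hp. specialize (Hc 1 ltac:(lra)). apply nearR_iff in Hc. destruct Hc as [d [Hd Hc]].
unfold is_pole in Hp. specialize (Hp (fun y => Cmod (h t) + 1 < y)).
assert (Q : Rbar_locally p_infty (fun y => Cmod (h t) + 1 < y)) by now exists (Cmod (h t) + 1).
specialize (Hp Q). unfold filtermap, locally', within in Hp. apply nearR_iff in Hp.
destruct Hp as [d' [Hd' Hp]].
set (s := t + Rmin d d' / 2).
assert (M : 0 < Rmin d d') by (apply Rmin_case; lra).
assert (M1 := Rmin_l d d'). assert (M2 := Rmin_r d d').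
assert (As : Rabs (s - t) = Rmin d d' / 2) by (unfold s; rewrite Rabs_right; lra).
specialize (Hp s ltac:(lra)). specialize (Hc s ltac:(lra)).
assert (s <> t) by (unfold s; lra). specialize (Hp H).
assert (T := Cmod_triangle (h s - h t) (h t)). replace (h s - h t + h t)%C with (h s) in T by ring. lra.
Qed.

Lemma not_pole_cont_C (h : C -> C) (z : C) : ccont h z -> ~ is_pole (U := C_UniformSpace) h z.
Proof.
intros Hc Hp. specialize (Hc 1 ltac:(lra)). apply nearC_iff in Hc. destruct Hc as [d [Hd Hc]].
unfold is_pole in Hp. specialize (Hp (fun y => Cmod (h z) + 1 < y)).
assert (Q : Rbar_locally p_infty (fun y => Cmod (h z) + 1 < y)) by now exists (Cmod (h z) + 1).
specialize (Hp Q). unfold filtermap, locally', within in Hp. apply nearC_iff in Hp.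
destruct Hp as [d' [Hd' Hp]].
assert (M : 0 < Rmin d d') by (apply Rmin_case; lra).
assert (M1 := Rmin_l d d'). assert (M2 := Rmin_r d d').
set (s := (z + RtoC (Rmin d d' / 2))%C).
assert (Es : (s - z)%C = RtoC (Rmin d d' / 2)) by (unfold s; ring).
assert (As : Cmod (s - z) = Rmin d d' / 2) by (rewrite Es, Cmod_R, Rabs_right; lra).
specialize (Hp s ltac:(lra)). specialize (Hc s ltac:(lra)).
assert (s <> z).
{ intros E. rewrite E in As. replace (z - z)%C with (RtoC 0) in As by ring. rewrite Cmod_0 in As. lra. }
specialize (Hp H).
assert (T := Cmod_triangle (h s - h z) (h z)). replace (h s - h z + h z)%C with (h s) in T by ring. lra.
Qed.

Lemma zeros_isolated (g : C -> C) (z0 : C) : holo everywhere g -> g (RtoC 0) <> RtoC 0 ->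
  nearC z0 (fun z => z <> z0 -> g z <> RtoC 0).
Proof.
intros Hg Hg0. assert (Hs : 0 < Cmod z0 + 1) by (generalize (Cmod_ge_0 z0); lra).
destruct (factor_box g (Cmod z0 + 1) Hs Hg Hg0) as [l [h [H1 [H2 [H3 H4]]]]].
assert (B0 : box (RtoC 0) (Cmod z0 + 1) z0).
{ apply box_disc. replace (z0 - 0)%C with z0 by ring. lra. }
set (rest := filter (fun b => if Ceq_dec b z0 then false else true) l).
assert (NR : nearC z0 (fun w => lprod rest w <> RtoC 0)).
{ apply ccont_ne_near.
  apply (holo_ccont everywhere); [apply holo_lprod|exact I].
  intros E. apply lprod_0, filter_In in E. destruct (Ceq_dec z0 z0); destruct E; congruence. }
generalize (filter_and _ _ NR (box_near _ _ _ B0)). apply filter_imp.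
intros w [W1 W2] Nw. rewrite H3, (lprod_split z0 l).
apply Cmult_neq_0; [|now apply H4]. apply Cmult_neq_0; auto.
apply Cpow_nz. now apply Cminus_eq_contra.
Qed.

Lemma rcont_exp_curve x tau : x <> RtoC 0 -> rcont (fun t => exp_over x (curve t)) tau.
Proof.
intros Hx. apply (rcont_comp (exp_over x) curve). eapply cderiv_ccont. now apply cderiv_exp_over.
apply curve_rcont.
Qed.

Lemma exp_curve_inj x s t : x <> RtoC 0 -> exp_over x (curve s) = exp_over x (curve t) -> s = t.
Proof.
intros Hx E. apply curve_re_inj.
destruct (curve_spec s) as (_ & A & _). destruct (curve_spec t) as (_ & B & _).
apply exp_over_inj in E; auto; try lra. now rewrite E.
Qed.

Lemma g_curve_isolated g x tau : x <> RtoC 0 -> holo everywhere g -> g (RtoC 0) <> RtoC 0 ->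
  nearR tau (fun t => t <> tau -> g (exp_over x (curve t)) <> RtoC 0).
Proof.
intros Hx Hg Hg0.
generalize (clim_near (nearR tau) _ _ _ (rcont_exp_curve x tau Hx)
  (zeros_isolated g (exp_over x (curve tau)) Hg Hg0)).
apply filter_imp. intros t Ht Nt. apply Ht. intros E. apply Nt. now apply (exp_curve_inj x).
Qed.

Definition numerator (n : nat) (t : R) : C := (dcurve t * RtoC (exp (- INR n * t ^ 2)))%C.

Lemma rcont_numerator n t : rcont (numerator n) t.
Proof.
apply clim_mult; [typeclasses eauto|apply dcurve_rcont|].
apply (clim_real_comp (nearR t) (fun y => exp (- INR n * y ^ 2)) (fun y => y)).
- apply derivable_continuous_pt. reg.
- apply clim_RtoC_id.
Qed.

Lemma numerator_ne n t : numerator n t <> RtoC 0.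
Proof.
apply Cmult_neq_0.
- intros E. assert (H := dcurve_re t). rewrite E in H. simpl in H. lra.
- intros E. apply RtoC_inj in E. generalize (exp_pos (- INR n * t ^ 2)). lra.
Qed.

Lemma curve_integrand_eq g n x t :
  curve_integrand g n x t = (numerator n t / g (exp_over x (curve t)))%C.
Proof. unfold curve_integrand, numerator. now rewrite curve'_dcurve. Qed.

Lemma rcont_g_curve g x t : x <> RtoC 0 -> holo everywhere g ->
  rcont (fun s => g (exp_over x (curve s))) t.
Proof.
intros Hx Hg. apply (rcont_comp g). now apply (holo_ccont everywhere). now apply rcont_exp_curve.
Qed.

Lemma curve_integrand_rcont g n x t : x <> RtoC 0 -> holo everywhere g ->
  g (exp_over x (curve t)) <> RtoC 0 -> rcont (curve_integrand g n x) t.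
Proof.
intros Hx Hg N. unfold rcont. rewrite curve_integrand_eq.
apply (clim_ext (nearR t) (fun s => numerator n s / g (exp_over x (curve s)))%C).
intros s. now rewrite curve_integrand_eq.
apply clim_div; auto. typeclasses eauto. apply rcont_numerator. now apply rcont_g_curve.
Qed.

(** The numerator never vanishes, so nothing cancels a zero of the denominator; the zeros met by the
    curve are isolated because the curve is injective after exponentiation. *)
Lemma curve_integrand_pole g n x t : x <> RtoC 0 -> holo everywhere g -> g (RtoC 0) <> RtoC 0 ->
  poleR (curve_integrand g n x) t <-> g (exp_over x (curve t)) = RtoC 0.
Proof.
intros Hx Hg Hg0. split.
- intros Hp. destruct (Ceq_dec (g (exp_over x (curve t))) (RtoC 0)) as [E|E]; auto.
  exfalso. revert Hp. apply not_pole_cont_R. now apply curve_integrand_rcont.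
- intros E Pr [M HM]. unfold filtermap, locally', within.
  assert (C1 := rcont_numerator n t). assert (C2 := rcont_g_curve g x t Hx Hg).
  unfold rcont in C2. rewrite E in C2.
  assert (N0 := proj1 (Cmod_gt_0 _) (numerator_ne n t)). set (N := Cmod (numerator n t)) in *.
  assert (HM' : 0 < Rabs M + 1) by (generalize (Rabs_pos M); lra).
  specialize (C1 (N / 2) ltac:(lra)).
  specialize (C2 (N / 2 / (Rabs M + 1)) ltac:(apply Rdiv_lt_0_compat; lra)).
  generalize (filter_and _ _ C1 (filter_and _ _ C2 (g_curve_isolated g x t Hx Hg Hg0))).
  apply filter_imp. intros s (S1 & S2 & S3) Ns. apply HM. specialize (S3 Ns).
  rewrite curve_integrand_eq, Cmod_div by auto.
  set (G := g (exp_over x (curve s))) in *. replace (G - 0)%C with G in S2 by ring.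
  apply Cmod_gt_0 in S3.
  assert (T := Cmod_triangle (numerator n t - numerator n s) (numerator n s)).
  replace (numerator n t - numerator n s + numerator n s)%C with (numerator n t) in T by ring.
  rewrite <- Copp_minus_distr, Cmod_opp in T. fold N in T.
  apply Rle_lt_trans with (Rabs M + 1 - 1); [generalize (Rle_abs M); lra|].
  apply (Rmult_lt_reg_r (Cmod G)); auto. unfold Rdiv. rewrite Rmult_assoc, Rinv_l, Rmult_1_r by lra.
  apply (Rmult_lt_compat_l (Rabs M + 1)) in S2; auto.
  replace ((Rabs M + 1) * (N / 2 / (Rabs M + 1))) with (N / 2) in S2 by (field; lra). lra.
Qed.

(** * Truncated contours *)

(** [Y] is the truncation level; no zero of [g] has its level between
    [Im (curve T2)] and [Y]. *)
Definition truncation (g : C -> C) (n : nat) (x : C) (s : R) (l : list C) (c P h : C -> C)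
    (Y T2 : R) : Prop :=
  x <> RtoC 0 /\ holo everywhere g /\ g (RtoC 0) <> RtoC 0 /\ decomposition g n x s l c P h /\
  Im (curve T2) <= Y /\
  (forall w, Im (curve T2) <= Im w -> box (RtoC 0) s (exp_over x w)) /\
  (forall a, In a l -> Im (theta_pt x a) < Y -> Im (theta_pt x a) < Im (curve T2)).

(** On the curve [e^(n (e^(i theta) - i theta)) = e^n e^(- n tau^2)]; the constant removes the
    factor [e^n]. *)
Definition curve_primitive (n : nat) (x : C) (l : list C) (c P : C -> C) (Y t : R) : C :=
  (RtoC (exp (- INR n)) * primitive_F n x l c P (weight Y) (curve t))%C.

Lemma curve_strip t : - PI < Re (curve t) <= PI.
Proof. destruct (curve_spec t) as (_ & H & _). lra. Qed.

Lemma truncation_zero_ne g n x s l c P h Y T2 a : truncation g n x s l c P h Y T2 ->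
  In a l -> a <> RtoC 0.
Proof.
intros (Hx & Hg & Hg0 & D & _) Ha ->. apply (proj1 D) in Ha. tauto.
Qed.

Lemma truncation_admissible g n x s l c P h Y T2 t a : truncation g n x s l c P h Y T2 ->
  Rabs t <= T2 -> In a l -> a <> exp_over x (curve t) ->
  admissible (weight Y (theta_pt x a)) (theta_pt x a) (curve t).
Proof.
intros TR Ht Ha Ne. assert (Na := truncation_zero_ne _ _ _ _ _ _ _ _ _ _ a TR Ha).
destruct TR as (Hx & Hg & Hg0 & D & HY & HB & Gap).
apply (admissible_curve Y T2); auto.
- now apply theta_pt_strip.
- intros E. apply Ne. rewrite <- E. now rewrite exp_over_theta_pt.
Qed.

Lemma curve_primitive_regular g n x s l c P h Y T2 t : truncation g n x s l c P h Y T2 ->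
  Rabs t <= T2 -> g (exp_over x (curve t)) <> RtoC 0 ->
  regular_at (curve_integrand g n x) (curve_primitive n x l c P Y) t.
Proof.
intros TR Ht Gt. assert (TR' := TR). destruct TR' as (Hx & Hg & Hg0 & D & HY & HB & Gap).
split; [|split].
- rewrite curve_integrand_pole; auto.
- assert (CV : cderiv (primitive_F n x l c P (weight Y)) (curve t) (F_theta g n x (curve t))).
  { apply (primitive_F_deriv g n x s l c P h); auto.
    - apply HB. now apply curve_im_ge.
    - intros a Ha. apply (truncation_admissible g n x s l c P h Y T2); auto.
      intros E. apply Gt. rewrite <- E. now apply D. }
  eapply rderiv_eq.
  apply (rderiv_comp curve (fun w => RtoC (exp (- INR n)) * primitive_F n x l c P (weight Y) w)%C).
  apply cderiv_scal. exact CV. apply curve_rderiv.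
  rewrite curve_integrand_eq. unfold F_theta, g_theta, numerator. fold (exp_over x (curve t)).
  rewrite curve_equation, <- RtoC_mult, Cexp_RtoC.
  replace (INR n * (1 - t ^ 2)) with (INR n + - INR n * t ^ 2) by ring.
  rewrite exp_plus, RtoC_mult.
  assert (E : (RtoC (exp (- INR n)) * RtoC (exp (INR n)))%C = RtoC 1).
  { rewrite <- RtoC_mult, <- exp_plus, Rplus_opp_l, exp_0. reflexivity. }
  set (A := RtoC (exp (- INR n))) in *. set (B := RtoC (exp (INR n))) in *.
  replace (A * (B * RtoC (exp (- INR n * t ^ 2)) / g (exp_over x (curve t))) * dcurve t)%C with
    ((A * B) * (dcurve t * RtoC (exp (- INR n * t ^ 2)) / g (exp_over x (curve t))))%C
    by (field; auto).
  rewrite E. ring.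
- now apply curve_integrand_rcont.
Qed.

(** A double factor of [g] would make its derivative vanish at the point, hence that of [g_theta] by
    the chain rule. Multiplicity at most 1 is what makes [P] continuous there. *)
Lemma simple_zero_count g x l h al : x <> RtoC 0 -> holo everywhere h ->
  (forall z, g z = (lprod l z * h z)%C) -> simple_zero (g_theta g x) al ->
  (count_occ Ceq_dec l (exp_over x al) <= 1)%nat.
Proof.
intros Hx Hh Hgh [_ [d [Hd Nd]]]. apply cderiv_is_derive in Hd.
set (a := exp_over x al) in *.
destruct (count_occ Ceq_dec l a) as [|[|m]] eqn:Em; auto. exfalso. apply Nd.
set (rest := filter (fun b => if Ceq_dec b a then false else true) l).
destruct (holo_mult everywhere _ _ (holo_lprod everywhere rest) Hh a I) as [e He].
assert (K : cderiv g a (RtoC 0)).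
{ apply (cderiv_ext (fun z => (z - a) ^ S (S m) * (lprod rest z * h z))%C).
  { intros z. rewrite Hgh, (lprod_split a l), Em. fold rest. ring. }
  eapply cderiv_eq. apply cderiv_mult; [|exact He].
  apply (cderiv_comp (fun z => z - a)%C (fun y => y ^ S (S m))%C). apply cderiv_pow.
  apply cderiv_minus. apply cderiv_id. apply cderiv_const.
  cbv beta. replace (a - a)%C with (RtoC 0) by ring. cbn [Cpow]. ring. }
apply (cderiv_unique (g_theta g x) al); auto.
eapply cderiv_eq. apply (cderiv_comp (exp_over x) g). exact K. now apply cderiv_exp_over. ring.
Qed.

Lemma rcont_lsum (f : C -> R -> C) t l : (forall a, In a l -> rcont (f a) t) ->
  rcont (fun s => lsum (fun a => f a s) l) t.
Proof.
induction l as [|a l IH]; intros H; simpl. apply rcont_const.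
apply clim_plus. typeclasses eauto. apply H; now left. apply IH. intros; apply H; now right.
Qed.

Lemma clim_symmetric f q : rcont f q -> clim (at_right 0) (fun e => f (q + e)%R - f (q - e)%R)%C (RtoC 0).
Proof.
intros H. apply clim_eq with (f q - f q)%C; [|ring].
apply clim_minus. typeclasses eauto. now apply clim_right. now apply clim_left.
Qed.

(** The pole met at [t] contributes its own logarithm of weight 1/2, whose symmetric jump tends to
    0; all the rest is continuous at [t]. *)
Lemma curve_primitive_symmetric g n x s l c P h Y T2 t : truncation g n x s l c P h Y T2 ->
  (forall a, g a = RtoC 0 -> on_curve (theta_pt x a) ->
     simple_zero (g_theta g x) (theta_pt x a)) ->
  Rabs t <= T2 -> g (exp_over x (curve t)) = RtoC 0 ->
  clim (at_right 0) (fun e => curve_primitive n x l c P Y (t + e)%R -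
    curve_primitive n x l c P Y (t - e)%R)%C (RtoC 0).
Proof.
intros TR Hsimple Ht Gt. assert (TR' := TR). destruct TR' as (Hx & Hg & Hg0 & D & HY & HB & Gap).
set (a := exp_over x (curve t)) in *.
assert (Ea : theta_pt x a = curve t) by (apply theta_pt_exp_over; auto using curve_strip).
assert (Im2 := curve_im_ge T2 t Ht).
assert (Ba : box (RtoC 0) s a) by now apply HB.
assert (Ia : In a l) by now apply D.
assert (Na : a <> RtoC 0) by now apply exp_over_ne.
(* The point is on the curve, where [psi] is 0. It is not below the truncation level: its height is
   at least [Im (curve T2)], and no zero lies in the gap. *)
assert (Wa : weight Y (theta_pt x a) = 1 / 2).
{ unfold weight. rewrite Ea. destruct (Rle_dec Y (Im (curve t))) as [L|L].
  - rewrite psi_eq. 2:{ destruct (curve_spec t) as (_ & A & _). lra. }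
    rewrite curve_im, Rminus_diag. simpl.
    destruct (Rlt_dec 0 0); lra.
  - exfalso. specialize (Gap a Ia). rewrite Ea in Gap. lra. }
assert (Cnt : (count_occ Ceq_dec l a <= 1)%nat).
{ assert (S := Hsimple a Gt). rewrite Ea in S.
  apply (simple_zero_count g x l h (curve t)); auto; try apply D. apply S.
  apply on_curve_iff. destruct (curve_spec t) as (_ & A & _). split; auto. apply curve_im. }
assert (Nd := NoDup_nodup Ceq_dec l).
assert (Ia' : In a (nodup Ceq_dec l)) by now apply nodup_In.
set (k := (RtoC (exp (- INR n)) * / (Ci * x ^ n))%C).
set (A := fun r => (k * (P (exp_over x (curve r)) + Ci * c (RtoC 0) * curve r +
  lsum (fun b => c b * pole_log (weight Y (theta_pt x b)) (theta_pt x b) (curve r))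
    (remove Ceq_dec a (nodup Ceq_dec l))))%C).
assert (EW : forall r, curve_primitive n x l c P Y r =
  (A r + (k * c a) * pole_log (1 / 2) (curve t) (curve r))%C).
{ intros r. unfold curve_primitive, primitive_F, A, k.
  rewrite (lsum_remove _ a (nodup Ceq_dec l) Nd Ia'). rewrite Wa, Ea. ring. }
assert (CA : rcont A t).
{ apply clim_mult; [typeclasses eauto|apply rcont_const|].
  apply clim_plus; [typeclasses eauto| |].
  apply clim_plus; [typeclasses eauto| |].
  - apply (rcont_comp P (fun r => exp_over x (curve r))). apply D; auto.
    now apply rcont_exp_curve.
  - apply clim_mult; [typeclasses eauto|apply rcont_const|apply curve_rcont].
  - apply (rcont_lsum (fun b r => c b * pole_log (weight Y (theta_pt x b)) (theta_pt x b) (curve r))%C).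
    intros b Hb. apply in_remove in Hb. destruct Hb as [Hb Nb]. apply nodup_In in Hb.
    apply clim_mult; [typeclasses eauto|apply rcont_const|].
    apply (rcont_comp (pole_log (weight Y (theta_pt x b)) (theta_pt x b)) curve);
      [|apply curve_rcont].
    destruct (truncation_admissible g n x s l c P h Y T2 t b TR Ht Hb Nb) as [A1 A2].
    eapply cderiv_ccont. apply pole_log_deriv; auto.
    intros E. apply Nb. assert (Nzb := truncation_zero_ne _ _ _ _ _ _ _ _ _ _ b TR Hb).
    rewrite <- (exp_over_theta_pt x b Hx Nzb).
    unfold a. rewrite (exp_over_shift x (theta_pt x b) (curve t) Hx), E. ring. }
apply (clim_ext (at_right 0) (fun e => (A (t + e)%R - A (t - e)%R) + (k * c a) *
  (pole_log (1 / 2) (curve t) (curve (t + e)%R) - pole_log (1 / 2) (curve t) (curve (t - e)%R)))%C).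
{ intros e. rewrite !EW. ring. }
apply clim_eq with (0 + (k * c a) * 0)%C; [|ring].
apply clim_plus; [typeclasses eauto|now apply clim_symmetric|].
apply clim_mult; [typeclasses eauto|apply clim_const; typeclasses eauto|].
apply (pole_log_symmetric curve t (dcurve t)). apply curve_rderiv.
generalize (dcurve_re t). lra.
Qed.

Lemma curve_PV g n x s l c P h Y T2 T : truncation g n x s l c P h Y T2 ->
  (forall a, g a = RtoC 0 -> on_curve (theta_pt x a) ->
     simple_zero (g_theta g x) (theta_pt x a)) ->
  0 < T < T2 -> ~ poleR (curve_integrand g n x) T -> ~ poleR (curve_integrand g n x) (- T) ->
  is_PV (curve_integrand g n x) (- T) T
    (curve_primitive n x l c P Y T - curve_primitive n x l c P Y (- T)%R)%C.
Proof.
intros TR Hsimple HT N1 N2. assert (TR' := TR). destruct TR' as (Hx & Hg & Hg0 & D & HY & HB & Gap).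
apply PV_global; auto. lra.
intros p Hp.
assert (Is := g_curve_isolated g x p Hx Hg Hg0). apply nearR_iff in Is.
destruct Is as [d [Hd Is]].
assert (M1 := Rmin_l d (T2 - T)). assert (M2 := Rmin_r d (T2 - T)).
(* This radius keeps the neighbourhood inside [[- T2, T2]], where the primitive is under control. *)
exists (Rmin d (T2 - T)). split. apply Rmin_case; lra. split.
- intros t Ht Nt. apply (curve_primitive_regular g n x s l c P h Y T2); auto.
  apply Rabs_def2 in Ht. apply Rabs_le. lra. apply Is; auto. lra.
- destruct (Ceq_dec (g (exp_over x (curve p))) (RtoC 0)) as [E|E].
  + right. split. rewrite curve_integrand_pole; auto.
    apply (curve_primitive_symmetric g n x s l c P h Y T2); auto. apply Rabs_le; lra.
  + left. apply (curve_primitive_regular g n x s l c P h Y T2); auto. apply Rabs_le; lra.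
Qed.

Lemma primitive_F_period n x l c P wt w : x <> RtoC 0 ->
  primitive_F n x l c P wt (w + RtoC (2 * PI))%C =
  (primitive_F n x l c P wt w + RtoC (2 * PI) / x ^ n *
    (c (RtoC 0) + lsum (fun a => RtoC (wt (theta_pt x a)) * c a) (nodup Ceq_dec l)))%C.
Proof.
intros Hx. unfold primitive_F.
assert (E : exp_over x (w + RtoC (2 * PI))%C = exp_over x w).
{ unfold exp_over. replace (Ci * (w + RtoC (2 * PI)))%C with (Ci * w + Ci * RtoC (2 * PI))%C by ring.
  now rewrite Cexp_period. }
rewrite E.
assert (El : forall L, lsum (fun a => c a * pole_log (wt (theta_pt x a)) (theta_pt x a) (w + RtoC (2 * PI)))%C L =
  (lsum (fun a => c a * pole_log (wt (theta_pt x a)) (theta_pt x a) w) L +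
   Ci * RtoC (2 * PI) * lsum (fun a => RtoC (wt (theta_pt x a)) * c a) L)%C).
{ induction L as [|a L IH]; simpl. ring. rewrite IH, pole_log_period. ring. }
rewrite El. assert (Xn : (x ^ n)%C <> RtoC 0) by now apply Cpow_nz.
field. split; auto. apply Ci_ne.
Qed.

Lemma curve_coords T : curve T = (Re (curve T), Im (curve T)).
Proof. now destruct (curve T). Qed.

(** One primitive [V] serves on the left segment, the curve and the right segment. The end values at
    the junctions cancel, and the increment of [V] from [- PI] to [PI] is its growth over one
    period. *)
Lemma segments_formula g n x s l c P h Y T2 T1 : truncation g n x s l c P h Y T2 ->
  0 < T1 <= T2 -> Im (curve T1) < Y ->
  (forall w, Im w = Im (curve T1) -> g (exp_over x w) <> RtoC 0) /\
  (RtoC (exp (INR n)) * (curve_primitive n x l c P Y T1 - curve_primitive n x l c P Y (- T1)%R) +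
   (int_c1 (F_theta g n x) (Im (curve T1)) + int_c2 (F_theta g n x) (Im (curve T1))))%C =
  (RtoC (2 * PI) / x ^ n *
    (c (RtoC 0) + lsum (fun a => RtoC (weight Y (theta_pt x a)) * c a) (nodup Ceq_dec l)))%C.
Proof.
intros TR HT HY1. assert (TR' := TR). destruct TR' as (Hx & Hg & Hg0 & D & HY & HB & Gap).
set (Y1 := Im (curve T1)) in *. set (X1 := Re (curve T1)) in *.
assert (I12 : Im (curve T2) <= Y1) by (apply curve_im_ge; rewrite Rabs_right; lra).
assert (X1p : 0 < X1 < PI).
{ destruct (curve_spec T1) as (_ & A & _ & B & _). split; [apply B; lra|apply A]. }
assert (Gap1 : forall a, In a l -> Im (theta_pt x a) < Y -> Im (theta_pt x a) < Y1).
{ intros a Ha La. specialize (Gap a Ha La). lra. }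
assert (NG : forall w, Im w = Y1 -> g (exp_over x w) <> RtoC 0).
{ intros w Hw G. assert (Ia : In (exp_over x w) l) by (apply D; split; auto; apply HB; lra).
  assert (Na := exp_over_ne x w Hx).
  assert (E : Im (theta_pt x (exp_over x w)) = Y1).
  { assert (M := Cmod_exp_over x (theta_pt x (exp_over x w)) Hx).
    rewrite exp_over_theta_pt, Cmod_exp_over in M by auto.
    apply Cmod_gt_0 in Hx. apply (Rmult_eq_reg_r (/ Cmod x)) in M.
    2:{ apply Rinv_neq_0_compat; lra. }
    apply exp_inv in M. lra. }
  assert (Q := Gap1 _ Ia). lra. }
split; auto.
set (V := primitive_F n x l c P (weight Y)).
assert (DV : forall t, X1 <= Rabs t <= PI -> cderiv V (t, Y1) (F_theta g n x (t, Y1))).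
{ intros t Ht. apply (primitive_F_deriv g n x s l c P h); auto.
  intros a Ha. apply admissible_segment; auto; try lra.
    apply theta_pt_strip; auto. apply (truncation_zero_ne g n x s l c P h Y T2); auto. }
assert (CF : forall t, rcont (fun t => F_theta g n x (t, Y1)) t).
{ intros t. apply rcont_hor. apply (holo_ccont _ _ _ (F_theta_deriv g n x Hx Hg)). now apply NG. }
assert (Int : forall u v, (forall t, Rmin u v <= t <= Rmax u v -> X1 <= Rabs t <= PI) ->
  RI (fun t => F_theta g n x (t, Y1)) u v = (V (v, Y1) - V (u, Y1))%C).
{ intros u v Huv. apply RI_rint. apply (rint_FTC (fun t => V (t, Y1))); auto.
  intros t Ht. eapply rderiv_eq. apply (rderiv_comp (fun t => (t, Y1)) V). apply DV; auto.
  apply rderiv_hor. ring. }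
assert (XA : X_at Y1 = X1) by (apply X_at_curve; lra).
unfold int_c1, int_c2. rewrite XA.
change (RInt (V := C_R_CompleteNormedModule)) with RI.
rewrite (Int (- PI) (- X1)), (Int X1 PI).
2:{ intros t Ht. rewrite Rmin_left, Rmax_right in Ht by lra. rewrite Rabs_right; lra. }
2:{ intros t Ht. rewrite Rmin_left, Rmax_right in Ht by lra. rewrite Rabs_left; lra. }
replace (PI, Y1) with (((- PI)%R, Y1) + RtoC (2 * PI))%C
  by (apply injective_projections; simpl; ring).
unfold V. rewrite primitive_F_period by auto. fold V.
unfold curve_primitive. fold V.
replace (curve (- T1)) with (- X1, Y1).
2:{ rewrite curve_opp. unfold X1, Y1. apply injective_projections; simpl; unfold Re, Im; ring. }
replace (curve T1) with (X1, Y1) by (symmetry; apply curve_coords).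
assert (E : (RtoC (exp (INR n)) * RtoC (exp (- INR n)))%C = RtoC 1).
{ rewrite <- RtoC_mult, <- exp_plus, Rplus_opp_r, exp_0. reflexivity. }
set (A := RtoC (exp (INR n))) in *. set (B := RtoC (exp (- INR n))) in *.
set (S := (RtoC (2 * PI) / x ^ n * _)%C).
replace (A * (B * V (X1, Y1) - B * V ((- X1)%R, Y1)))%C with ((A * B) * (V (X1, Y1) - V ((- X1)%R, Y1)))%C by ring.
rewrite E. ring.
Qed.

Lemma gap_below (f : C -> R) l Y : exists d, 0 < d /\ forall a, In a l -> f a < Y -> f a < Y - d.
Proof.
induction l as [|b l [d [Hd IH]]].
- exists 1. split. lra. intros a [].
- destruct (Rlt_dec (f b) Y) as [L|L].
  + assert (M1 := Rmin_l d ((Y - f b) / 2)). assert (M2 := Rmin_r d ((Y - f b) / 2)).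
    exists (Rmin d ((Y - f b) / 2)). split. apply Rmin_case; lra.
    intros a [<-|Ha] La. lra. specialize (IH a Ha La). lra.
  + exists d. split; auto. intros a [<-|Ha] La; auto. lra.
Qed.

Lemma truncation_exists g n x T : x <> RtoC 0 -> holo everywhere g -> g (RtoC 0) <> RtoC 0 ->
  0 < T -> exists s l c P h T2, 0 < s /\ T < T2 /\
    truncation g n x s l c P h (Im (curve T)) T2.
Proof.
intros Hx Hg Hg0 HT. set (Y := Im (curve T)). set (Y1 := Im (curve (T + 1))).
(* A point of height at least [Y1] is sent to modulus at most [exp (- Y1) / |x|], hence into this
   square. *)
set (s := exp (- Y1) / Cmod x + 1).
assert (Px := proj1 (Cmod_gt_0 x) Hx).
assert (Hs0 : 0 < exp (- Y1) / Cmod x) by (apply Rdiv_lt_0_compat; auto; apply exp_pos).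
assert (Hs : 0 < s) by (unfold s; lra).
destruct (decomposition_exists g n x s Hs Hg Hg0) as [l [c [P [h D]]]].
destruct (gap_below (fun a => Im (theta_pt x a)) l Y) as [d [Hd Gap]].
assert (Cc := clim_Im (nearR T) _ _ (curve_rcont T) d Hd).
apply nearR_iff in Cc. destruct Cc as [d' [Hd' Cc]].
assert (M1 := Rmin_l d' 1). assert (M2 := Rmin_r d' 1).
(* Close enough to [T] that the level falls by less than the gap [d] under [Y], and below [T + 1],
   for which the square was chosen. *)
set (T2 := T + Rmin d' 1 / 2).
assert (M3 : 0 < Rmin d' 1) by (apply Rmin_case; lra).
specialize (Cc T2). rewrite <- RtoC_minus, Cmod_R in Cc. fold Y in Cc.
specialize (Cc ltac:(unfold T2; rewrite Rabs_right; lra)). apply Rabs_def2 in Cc.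
exists s, l, c, P, h, T2. split; auto. split. unfold T2; lra.
assert (I2 : Im (curve T2) < Y) by (apply curve_im_decr; unfold T2; lra).
assert (I1 : Y1 < Im (curve T2)) by (apply curve_im_decr; unfold T2; lra).
repeat (split; [first [exact Hx|exact Hg|exact Hg0|exact D|lra]|]). split.
- intros w Hw. apply box_disc. replace (exp_over x w - 0)%C with (exp_over x w) by ring.
  rewrite Cmod_exp_over by auto. unfold s.
  assert (exp (- Im w) / Cmod x <= exp (- Y1) / Cmod x); [|lra].
  apply Rmult_le_compat_r. left; now apply Rinv_0_lt_compat.
  left. apply exp_increasing. lra.
- intros a Ha La. specialize (Gap a Ha La). lra.
Qed.

Lemma truncated_formula g n x p T e :
  x <> RtoC 0 -> holo everywhere g -> g (RtoC 0) <> RtoC 0 -> is_appell g p ->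
  (forall a, g a = RtoC 0 -> on_curve (theta_pt x a) ->
     simple_zero (g_theta g x) (theta_pt x a)) ->
  0 < T -> ~ poleR (curve_integrand g n x) T -> ~ poleR (curve_integrand g n x) (- T) ->
  (forall Y1, Y1 < Im (curve T) -> (forall w, on_c1 Y1 w \/ on_c2 Y1 w ->
      ~ is_pole (U := C_UniformSpace) (F_theta g n x) w) ->
    Cmod (int_c1 (F_theta g n x) Y1 + int_c2 (F_theta g n x) Y1) <= e) ->
  exists v L, is_PV (curve_integrand g n x) (- T) T v /\ NoDup L /\
    (forall a, In a L -> g a = RtoC 0) /\
    (forall a, g a = RtoC 0 -> Im (curve T) <= Im (theta_pt x a) -> In a L) /\
    Cmod (RtoC (exp (INR n)) * v -
      (RtoC (2 * PI) / x ^ n * (rescaled p n x / RtoC (INR (fact n))) + RtoC (2 * PI) * Ci *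
        lsum (fun a => RtoC (weight (Im (curve T)) (theta_pt x a)) *
          Res (F_theta g n x) (theta_pt x a)) L))%C <= e.
Proof.
intros Hx Hg Hg0 Hp Hsimple HT N1 N2 Hseg.
destruct (truncation_exists g n x T Hx Hg Hg0 HT) as [s [l [c [P [h [T2 [Hs [HT2 TR]]]]]]]].
set (Y := Im (curve T)) in *.
assert (TR' := TR). destruct TR' as (_ & _ & _ & D & HY & HB & Gap).
set (W := curve_primitive n x l c P Y).
exists (W T - W (- T)%R)%C, (nodup Ceq_dec l).
split; [|split; [|split; [|split]]].
- apply (curve_PV g n x s l c P h Y T2); auto.
- apply NoDup_nodup.
- intros a Ha. apply nodup_In in Ha. now apply D.
- intros a Ga Ia. apply nodup_In, D. split; auto.
  assert (Na : a <> RtoC 0) by congruence.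
  rewrite <- (exp_over_theta_pt x a Hx Na). apply HB. lra.
- rewrite <- (appell_coefficient g n x s l c P h p Hs Hg Hg0 Hp D).
  assert (Xn : (x ^ n)%C <> RtoC 0) by now apply Cpow_nz.
  assert (ES : (RtoC (2 * PI) * Ci * lsum (fun a => RtoC (weight Y (theta_pt x a)) *
          Res (F_theta g n x) (theta_pt x a)) (nodup Ceq_dec l))%C =
     (RtoC (2 * PI) / x ^ n * lsum (fun a => RtoC (weight Y (theta_pt x a)) * c a) (nodup Ceq_dec l))%C).
  { rewrite <- !lsum_scal. apply lsum_ext. intros a Ha. apply nodup_In in Ha.
    assert (Na := truncation_zero_ne _ _ _ _ _ _ _ _ _ _ a TR Ha).
    rewrite (residue_F g n x s l c P h (theta_pt x a) a) by (auto; now apply exp_over_theta_pt).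
    field. split; auto. apply Ci_ne. }
  rewrite ES. rewrite <- Cmult_plus_distr_l.
  set (K := (RtoC (2 * PI) / x ^ n * _)%C).
  assert (R1 : rcont W T).
  { eapply rderiv_rcont. apply (curve_primitive_regular g n x s l c P h Y T2); auto.
    rewrite Rabs_right; lra. intros E. apply N1. rewrite curve_integrand_pole; auto. }
  assert (R2 : rcont W (- T)).
  { eapply rderiv_rcont. apply (curve_primitive_regular g n x s l c P h Y T2); auto.
    rewrite Rabs_Ropp, Rabs_right; lra. intros E. apply N2. rewrite curve_integrand_pole; auto. }
  (* The level of [T] may carry poles away from the curve. The levels of [T + d] carry none for
     small [d > 0]; the estimate passes to the limit because [W] is continuous at [T] and [- T]. *)
  apply (clim_bound (at_right 0) (fun d => RtoC (exp (INR n)) * (W (T + d)%R - W (- T - d)%R) - K)%C).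
  + apply clim_minus; [typeclasses eauto| |apply clim_const; typeclasses eauto].
    apply clim_mult; [typeclasses eauto|apply clim_const; typeclasses eauto|].
    apply clim_minus; [typeclasses eauto|now apply clim_right|now apply clim_left].
  + apply at_right_iff. exists (T2 - T). split. lra. intros d Hd.
    assert (I1 : Im (curve (T + d)) < Y) by (apply curve_im_decr; lra).
    destruct (segments_formula g n x s l c P h Y T2 (T + d) TR) as [NG SF]; try lra.
    fold W in SF. fold K in SF.
    replace (- T - d) with (- (T + d)) by ring.
    rewrite <- SF. set (Q := (int_c1 _ _ + int_c2 _ _)%C).
    match goal with |- Cmod ?z <= _ => replace z with (- Q)%C by ring end.
    rewrite Cmod_opp. apply Hseg; auto.
    intros w Hw. apply not_pole_cont_C.
    apply (holo_ccont _ _ _ (F_theta_deriv g n x Hx Hg)). apply NG.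
    destruct Hw as [[Hw _]|[Hw _]]; exact Hw.
Qed.

(** * From finite residue sums to partial sums of the series *)

Lemma lsum_perm f l l' : Permutation l l' -> lsum f l = lsum f l'.
Proof.
induction 1; simpl; auto. now rewrite IHPermutation. ring. congruence.
Qed.

Lemma lsum_filter f (p : C -> bool) l : (forall a, In a l -> p a = false -> f a = RtoC 0) ->
  lsum f (filter p l) = lsum f l.
Proof.
induction l as [|a l IH]; intros H; simpl; auto.
assert (IH' := IH (fun b Hb => H b (or_intror Hb))).
destruct (p a) eqn:E; simpl; rewrite IH'; auto. rewrite (H a (or_introl eq_refl) E). ring.
Qed.

Lemma csum_lsum (f : nat -> C) (F : C -> C) zeta K : (forall k, (k < K)%nat -> f k = F (zeta k)) ->
  csum f K = lsum F (map zeta (seq 0 K)).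
Proof.
assert (App : forall l l', lsum F (l ++ l') = (lsum F l + lsum F l')%C).
{ induction l as [|a l IH]; intros l'; simpl. ring. rewrite IH. ring. }
induction K as [|K IH]; intros H. reflexivity.
rewrite seq_S, map_app, App. simpl. rewrite IH by auto. rewrite (H K) by auto. ring.
Qed.

Lemma initial_segment (A : nat -> Prop) m : (forall k, A k -> (k < m)%nat) ->
  (forall j k, (j <= k)%nat -> A k -> A j) -> exists K, forall k, A k <-> (k < K)%nat.
Proof.
intros Hb Hd.
assert (Q : forall i, (forall k, (k < i)%nat -> A k) \/
  exists K, (forall k, (k < K)%nat -> A k) /\ ~ A K).
{ induction i as [|i [IH|IH]]; auto. left; intros; lia.
  destruct (excluded_middle_informative (A i)) as [H|H].
  - left. intros k Hk. destruct (Nat.eq_dec k i) as [->|]; auto. apply IH. lia.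
  - right. now exists i. }
destruct (Q (S m)) as [H|[K [H1 H2]]].
- exfalso. specialize (H m ltac:(lia)). apply Hb in H. lia.
- exists K. intros k. split; auto. intros Hk. destruct (Nat.lt_ge_cases k K); auto.
  exfalso. apply H2. now apply (Hd K k).
Qed.

Lemma valid_index_le N j k : (j <= k)%nat -> valid_index N k = true -> valid_index N j = true.
Proof.
destruct N as [m|]; simpl; auto. rewrite !Nat.ltb_lt. lia.
Qed.

Lemma NoDup_map_in {A B : Type} (f : A -> B) l : (forall a b, In a l -> In b l -> f a = f b -> a = b) ->
  NoDup l -> NoDup (map f l).
Proof.
induction l as [|a l IH]; intros H Hn; simpl. constructor.
inversion Hn; subst. constructor.
- intros I. apply in_map_iff in I. destruct I as [b [E Ib]].
  apply H in E; [|now right|now left]. now subst.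
- apply IH; auto. intros; apply H; auto; now right.
Qed.

(** Height is a decreasing function of the modulus, so the zeros at level [Y] or higher form an
    initial segment of the enumeration; being contained in [L], it is finite. The remaining elements
    of [L] have weight 0. *)
Lemma residue_partial_sum g n x N zeta L Y K0 : x <> RtoC 0 -> g (RtoC 0) <> RtoC 0 ->
  enumerates_zeros g N zeta -> NoDup L -> (forall a, In a L -> g a = RtoC 0) ->
  (forall a, g a = RtoC 0 -> Y <= Im (theta_pt x a) -> In a L) ->
  (forall k, (k <= K0)%nat -> Y <= Im (theta_pt x (zeta k))) ->
  exists K, (K0 <= K)%nat /\ csum (residue_term g n x N zeta) K =
    lsum (fun a => RtoC (weight Y (theta_pt x a)) * Res (F_theta g n x) (theta_pt x a))%C L.
Proof.
intros Hx Hg0 [Z1 [Z2 Z3]] Nd L1 L2 HK0.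
set (A := fun k => valid_index N k = true /\ Y <= Im (theta_pt x (zeta k))).
assert (Zv : forall k, valid_index N k = true -> g (zeta k) = RtoC 0).
{ intros k Hk. apply Z1. now exists k. }
assert (Ad : forall j k, (j <= k)%nat -> A k -> A j).
{ intros j k Hjk [A1 A2]. assert (Vj := valid_index_le N j k Hjk A1). split; auto.
  eapply Rle_trans. exact A2. rewrite !theta_pt_Im. apply Ropp_le_contravar.
  apply Rcomplements.ln_le.
  - apply Cmod_gt_0, Cmult_neq_0; auto. intros E. apply Hg0. assert (Gj := Zv j Vj). now rewrite E in Gj.
  - rewrite !Cmod_mult. apply Rmult_le_compat_l. apply Cmod_ge_0. now apply Z3. }
assert (Nm : forall K, (forall k, (k < K)%nat -> A k) -> NoDup (map zeta (seq 0 K))).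
{ intros K HK. apply NoDup_map_in; [|apply seq_NoDup].
  intros i j Hi Hj. apply in_seq in Hi, Hj. apply Z2; apply HK; lia. }
assert (Ab : forall k, A k -> (k < length L)%nat).
{ intros k Hk. assert (Hlt : forall j, (j < S k)%nat -> A j) by (intros j Hj; apply (Ad j k); auto; lia).
  replace (S k) with (length (map zeta (seq 0 (S k)))) by (now rewrite length_map, length_seq).
  assert (I : (length (map zeta (seq 0 (S k))) <= length L)%nat); [|rewrite length_map, length_seq in I; lia].
  apply NoDup_incl_length; auto. intros a Ha. apply in_map_iff in Ha.
  destruct Ha as [j [<- Hj]]. apply in_seq in Hj. destruct (Hlt j ltac:(lia)) as [V1 V2].
  apply L2; auto. }
destruct (initial_segment A (length L) Ab Ad) as [K1 HK1].
assert (E : csum (residue_term g n x N zeta) K1 =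
    lsum (fun a => RtoC (weight Y (theta_pt x a)) * Res (F_theta g n x) (theta_pt x a))%C L).
{ set (F := fun a => (RtoC (weight Y (theta_pt x a)) * Res (F_theta g n x) (theta_pt x a))%C).
  rewrite (csum_lsum _ F zeta).
  2:{ intros k Hk. apply HK1 in Hk. destruct Hk as [V1 V2]. unfold residue_term, F, weight.
      rewrite V1. destruct (Rle_dec Y (Im (theta_pt x (zeta k)))); [reflexivity|lra]. }
  set (q := fun a => if Rle_dec Y (Im (theta_pt x a)) then true else false).
  rewrite <- (lsum_filter F q L).
  2:{ intros a _ Q. unfold F, weight. unfold q in Q.
      destruct (Rle_dec Y (Im (theta_pt x a))); [discriminate|ring]. }
  apply lsum_perm. apply NoDup_Permutation.
  - apply Nm. intros k. apply HK1.
  - now apply NoDup_filter.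
  - intros a. rewrite in_map_iff, filter_In. split.
    + intros [k [<- Hk]]. apply in_seq in Hk. destruct (proj2 (HK1 k) ltac:(lia)) as [V1 V2].
      split. apply L2; auto. unfold q. destruct (Rle_dec Y (Im (theta_pt x (zeta k)))); auto.
    + intros [Ia Q]. unfold q in Q. destruct (Rle_dec Y (Im (theta_pt x a))) as [La|]; [|discriminate].
      destruct (proj1 (Z1 a) (L1 a Ia)) as [k [Vk <-]]. exists k. split; auto.
      apply in_seq. assert (k < K1)%nat; [|lia]. apply HK1. split; auto. }
destruct (Nat.le_gt_cases K0 K1) as [Le|Gt].
- exists K1. split; auto.
- exists K0. split; auto. rewrite <- E.
  (* All indices up to [K0] satisfy the height condition, so the initial segment can stop before
     [K0] only because the family is exhausted; the later terms are then 0. *)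
  assert (NV : valid_index N K1 = false).
  { destruct (valid_index N K1) eqn:V; auto. exfalso.
    assert (K1 < K1)%nat; [|lia]. apply HK1. split; auto. apply HK0. lia. }
  assert (Zr : forall i, csum (residue_term g n x N zeta) (K1 + i) = csum (residue_term g n x N zeta) K1).
  { induction i as [|i IH]. now rewrite Nat.add_0_r.
    rewrite Nat.add_succ_r. cbn [csum]. rewrite IH. unfold residue_term at 2.
    destruct (valid_index N (K1 + i)) eqn:V; [|ring].
    rewrite (valid_index_le N K1 (K1 + i)) in NV by (auto; lia). discriminate. }
  replace K0 with (K1 + (K0 - K1))%nat by lia. apply Zr.
Qed.

Lemma finite_lower_bound (f : nat -> R) K : exists B, forall k, (k <= K)%nat -> B <= f k.
Proof.
induction K as [|K [B IH]].
- exists (f 0%nat). intros k Hk. replace k with 0%nat by lia. lra.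
- assert (M1 := Rmin_l B (f (S K))). assert (M2 := Rmin_r B (f (S K))).
  exists (Rmin B (f (S K))). intros k Hk.
  destruct (Nat.eq_dec k (S K)) as [->|]; auto. specialize (IH k ltac:(lia)). lra.
Qed.

Theorem theorem3p1
  (g : C -> C) (g_entire : entire g) (g0 : g (RtoC 0) <> RtoC 0)
  (N : option nat) (zeta : nat -> C) (zeta_enum : enumerates_zeros g N zeta)
  (p : nat -> C -> C) (p_appell : is_appell g p)
  (n : nat) (x : C) (x0 : x <> RtoC 0)
  (simple_on_curve : forall k : nat, valid_index N k = true ->
     on_curve (theta_pt x (zeta k)) ->
     simple_zero (g_theta g x) (theta_pt x (zeta k)))
  (vanish : segments_vanish (F_theta g n x))
  (resum : C)
  (residue_sum : is_series (K := C_AbsRing) (V := C_NormedModule)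
     (residue_term g n x N zeta) resum) :
  exists pv : C,
    is_PV_line (curve_integrand g n x) pv /\
    (rescaled p n x / RtoC (INR (fact n)) =
     x ^ n / RtoC (2 * PI) *
       (RtoC (exp (INR n)) * pv - RtoC (2 * PI) * Ci * resum))%C.
Proof.
assert (Hg : holo everywhere g).
{ intros z _. destruct (g_entire z) as [d Hd]. exists d. now apply cderiv_is_derive. }
assert (Hsimple : forall a, g a = RtoC 0 -> on_curve (theta_pt x a) ->
  simple_zero (g_theta g x) (theta_pt x a)).
{ intros a Ga. destruct (proj1 (proj1 zeta_enum a) Ga) as [k [Vk <-]]. auto. }
assert (Xn : (x ^ n)%C <> RtoC 0) by now apply Cpow_nz.
assert (PIp := PI_RGT_0). assert (PI4 := PI_4).
assert (N2 : RtoC (2 * PI) <> RtoC 0) by (apply RtoC_ne; lra).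
assert (En := exp_pos (INR n)).
assert (NE : RtoC (exp (INR n)) <> RtoC 0) by (apply RtoC_ne; lra).
set (E := RtoC (exp (INR n))) in *.
set (A := (RtoC (2 * PI) / x ^ n * (rescaled p n x / RtoC (INR (fact n))))%C).
(* The principal value is the number forced by the formula; what remains is to prove the convergence
   to it. *)
exists ((A + RtoC (2 * PI) * Ci * resum) / E)%C. split.
2:{ unfold A. field. repeat split; auto. intros F. apply RtoC_inj in F.
    generalize (INR_fact_neq_0 n). auto. }
intros Q HQ. apply nearC_iff in HQ. destruct HQ as [e0 [He0 HQ]].
(* The error is estimated before the final division by [exp n]. *)
set (e := exp (INR n) * e0). assert (He : 0 < e) by now apply Rmult_lt_0_compat.
specialize (vanish (fun y => Cmod (y - 0) < e / 4)).
assert (V : nearC (RtoC 0) (fun y => Cmod (y - 0) < e / 4)).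
{ apply nearC_iff. exists (e / 4). split; auto. lra. }
specialize (vanish V). destruct vanish as [M HM].
rewrite is_series_csum in residue_sum.
(* [2 PI <= 8] turns [e / 16] into at most [e / 2]; together with [e / 4] from the segments this
   stays below [e]. *)
destruct (residue_sum (e / 16) ltac:(lra)) as [K0 HK0].
destruct (finite_lower_bound (fun k => Im (theta_pt x (zeta k))) K0) as [B HB].
(* Below [M] the segment integrals are small; below [B] the first [K0 + 1] points of the enumeration
   are above the cutting level. *)
destruct (curve_im_unbounded (Rmin M B)) as [T0 [HT0 HT]].
exists T0. intros T LT [P1 P2].
assert (IT := HT T ltac:(lra)).
assert (M1 := Rmin_l M B). assert (M2 := Rmin_r M B).
destruct (truncated_formula g n x p T (e / 4) x0 Hg g0 p_appell Hsimple ltac:(lra) P1 P2)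
  as [v [L [H1 [H2 [H3 [H4 H5]]]]]].
{ intros Y1 HY1 NP. specialize (HM Y1 ltac:(lra) NP). left.
  replace (int_c1 (F_theta g n x) Y1 + int_c2 (F_theta g n x) Y1)%C with
    (int_c1 (F_theta g n x) Y1 + int_c2 (F_theta g n x) Y1 - 0)%C by ring. exact HM. }
destruct (residue_partial_sum g n x N zeta L (Im (curve T)) K0 x0 g0 zeta_enum H2 H3 H4)
  as [K [LK EK]].
{ intros k Hk. specialize (HB k Hk). lra. }
exists v. split; auto. apply HQ. rewrite <- EK in H5. specialize (HK0 K LK).
set (S := csum (residue_term g n x N zeta) K) in *. fold E A in H5.
replace (v - (A + RtoC (2 * PI) * Ci * resum) / E)%C with
  ((((E * v - (A + RtoC (2 * PI) * Ci * S)) + RtoC (2 * PI) * Ci * (S - resum)) / E))%C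
  by (field; auto).
rewrite Cmod_div by auto. unfold E at 2. rewrite Cmod_R, Rabs_right by lra.
apply (Rmult_lt_reg_r (exp (INR n))); auto. unfold Rdiv. rewrite Rmult_assoc, Rinv_l, Rmult_1_r by lra.
rewrite (Rmult_comm e0). fold e.
eapply Rle_lt_trans. apply Cmod_triangle.
rewrite !Cmod_mult, Cmod_Ci, Cmod_R, Rabs_right by lra.
set (r := Cmod (S - resum)) in *. assert (0 <= r) by apply Cmod_ge_0. nra.
Qed.
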